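(* Let $n\ge 2$ and consider the uncertain system $$\dot x_i=x_{i+1}+\theta\psi_i(y)\ (i=1,\dots,n-1),\qquad \dot x_n=u+\theta\psi_n(y),\qquad y=x_1,$$ with state $x=[x_1,\dots,x_n]^{T}\in\mathbb R^n$, input $u\in\mathbb R$, output $y\in\mathbb R$, and unknown constant $\theta\in\mathbb R$ satisfying $|\theta|\le\bar\theta$. The functions $\psi_i$ are known, with $\psi_i(0)$ not necessarily zero. Assume that each $\psi_i$ is $C^1$ and satisfies $|\psi_i(y)-\psi_i(y^* )|\le L_i|y-y^*|$ and $|\partial\psi_i(y)/\partial y|\le\Psi_i$ for all $y,y^*\in\mathbb D\subset\mathbb R$, where $\mathbb D$ is a closed set, the $L_i$ are known parameters and $\Psi_i>0$. Consider the controller described in the context, composed of the control law, the adaptive law, the state observer and the dynamic filter, under the plant-side and controller-side triggering laws described there. Then there exists $\underline q$ such that, for any given positive number $q>\underline q$, there always exists a set of parameters $\beta=[c^T,\rho^T,\phi^T,\delta,\sigma]^T\in\mathbb R^{3n}$ such that the set $\Omega_\eta(q)=\{\eta\in\mathbb R^{4n}: V(\eta)\le q\}$ is a positively invariant set and the solution of the closed-loop system is semiglobally bounded. Moreover, the output $y$ is practically stabilized to the origin, and Zeno behavior is excluded.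
   Context: $\mathbb N$ is the set of nonnegative integers and $\|\cdot\|$ is the 2-norm. **Triggering and transmission.** The plant-side detector generates instants $\bar t_k$ and the controller-side detector generates instants $t_j$ ($k,j\in\mathbb N$). - Plant side: $\bar t_{k+1}=\inf\{t>\bar t_k: |y(t)-y(\bar t_k)|\ge\gamma_y\}$. The transmitted output is $\bar y(t)=y(\bar t_k)$ for $t\in[\bar t_k,\bar t_{k+1})$. - Controller side: $t_{j+1}$ is the infimum of the times $t>t_j$ at which at least one of the following holds: $|\bar y(t)-\bar y(t_j)|\ge\gamma_{\bar y}$; $\|\xi(t)-\xi(t_j)\|\ge\gamma_\xi$; $\|\zeta(t)-\zeta(t_j)\|\ge\gamma_\zeta$; $|\hat\theta(t)-\hat\theta(t_j)|\ge\gamma_h$; $\|\alpha_f(t)-\alpha_f(t_j)\|\ge\gamma_f$. Here $\alpha_f=[\alpha_{2f},\dots,\alpha_{nf}]^T$. The thresholds $\gamma_y,\gamma_{\bar y},\gamma_\xi,\gamma_\zeta,\gamma_h,\gamma_f$ are positive design parameters of the triggering laws, with $\gamma_{\bar y}>\gamma_y$; they are not part of $\beta$. **Controller.** The states $\xi,\zeta\in\mathbb R^n$, $\hat\theta\in\mathbb R$ and $\alpha_{2f},\dots,\alpha_{nf}\in\mathbb R$ are continuous in $t$. For $t\in[t_j,t_{j+1})$, $j\in\mathbb N$: - State observer: $\dot\xi(t)=A_c\xi(t_j)+k\bar y(t_j)+bu(t)$ and $\dot\zeta(t)=A_c\zeta(t_j)+\psi(\bar y(t_j))$. Here $b=[0,\dots,0,1]^T$,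 $\psi=[\psi_1,\dots,\psi_n]^T$ and $k=[k_1,\dots,k_n]^T$. The matrix $A_c\in\mathbb R^{n\times n}$ has first column $-k$, ones on the superdiagonal and zeros elsewhere. The gain $k$ is chosen so that $A_c$ is Hurwitz, and is determined before the selection of $\beta$. - Adaptive law: $\dot{\hat\theta}(t)=\bar y(t_j)[\psi_1(\bar y(t_j))+\zeta_2(t_j)]-\delta\hat\theta(t_j)$, with $\delta>0$. - Dynamic filter: $\dot\alpha_{if}(t)=\rho_i(-\alpha_{if}(t_j)+\alpha_{i-1}(t_j))$ for $i=2,\dots,n$, with $\rho_i>0$. - Virtual inputs and errors: $z_1=y$ and $z_i=\xi_i-\alpha_{if}$ for $i=2,\dots,n$; $\upsilon_i=\alpha_{if}-\alpha_{i-1}$ for $i=2,\dots,n$; $\alpha_1=-c_1\bar y-\hat\theta(\psi_1(\bar y)+\zeta_2)$; $\alpha_i=-c_iz_i-k_i(\bar y-\xi_1)-\rho_i\upsilon_i$ for $i=2,\dots,n-1$. - Control law: $u(t)=-c_nz_n(t_j)-k_n(\bar y(t_j)-\xi_1(t_j))-\rho_n\upsilon_n(t_j)$. **Parameters in $\beta$.** $c=[c_1,\dots,c_n]^T$ are feedback gains, $\rho=[\rho_2,\dots,\rho_n]^T$ are filter gains, $\delta$ is the adaptive-law parameter, and $\phi=[\phi_2,\dots,\phi_n]^T$ and $\sigma$ are positive adjustable parameters used in the analysis (they do not appear in the closed-loop equations). **Companion variables.** $\hat\alpha_1=-c_1y-\hat\theta(\psi_1(y)+\zeta_2)$; $\hat\upsilon_i=\alpha_{if}-\hat\alpha_{i-1}$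 for $i=2,\dots,n$; $\hat\alpha_i=-c_iz_i-k_i(y-\xi_1)-\rho_i\hat\upsilon_i$ for $i=2,\dots,n-1$. **Error coordinates and Lyapunov function.** $\varepsilon=x-(\xi+\theta\zeta)$ and $\tilde\theta=\theta-\hat\theta$. Also $\eta=[z^T,\hat\upsilon^T,\tilde\theta,\varepsilon^T,\zeta^T]^T\in\mathbb R^{4n}$, with $z=[z_1,\dots,z_n]^T$ and $\hat\upsilon=[\hat\upsilon_2,\dots,\hat\upsilon_n]^T$. The matrix $P$ is the positive definite matrix satisfying $PA_c+A_c^TP=-I$. The Lyapunov function is $$V(\eta)=\tfrac12\sum_{i=1}^nz_i^2+\tfrac12\sum_{i=2}^n\hat\upsilon_i^2+\tfrac12\tilde\theta^2+\varepsilon^TP\varepsilon+\zeta^TP\zeta.$$ **Meaning of the conclusions.** Positively invariant: if $V(\eta(t_0))\le q$ at the initial time $t_0$, then $V(\eta(t))\le q$ for all $t\ge t_0$. Semiglobally bounded: all signals of the closed-loop system are bounded for solutions starting in $\Omega_\eta(q)$. Practically stabilized to the origin: there exists $\epsilon>0$ such that $\limsup_{t\to\infty}|y(t)|\le\epsilon$. Zeno behavior excluded: there exist constants $\bar\omega,\omega>0$ such that $\bar t_{k+1}-\bar t_k\ge\bar\omega$ and $t_{j+1}-t_j\ge\omega$ for all $k,j\in\mathbb N$.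
   Formalization: The triggering thresholds are not arbitrary and fixed in advance: after q and β are chosen, the claim is proved for all admissible thresholds below some positive bound depending on q and β; for thresholds fixed before q it fails (e.g. n=2, ψ=0, θ=0, q large). *)

(* Defs.v *)
From HB Require Import structures.
From mathcomp Require Import all_boot all_order all_algebra.
From mathcomp Require Import complex.
From mathcomp Require Import all_classical all_reals all_analysis.

Set Implicit Arguments.
Unset Strict Implicit.
Unset Printing Implicit Defensive.

Import Order.TTheory GRing.Theory Num.Theory.
Import numFieldNormedType.Exports.

Local Open Scope classical_set_scope.
Local Open Scope ring_scope.

(* 1-based coordinates: [crd v 1], ..., [crd v m] are the entries of v.  The
   families indexed by 2, ..., n (the filter states, the filter gains) are
   vectors of size n.-1, whose member of index i is therefore [crd v i.-1]. *)
Definition crd (R : realType) m (v : 'cV[R]_m) (i : nat) : R :=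
  if insub i.-1 is Some j then v (j : 'I_m) 0 else 0.

(* The norm provided by the library on matrices is the sup norm. *)
Definition norm2 (R : realType) m (v : 'cV[R]_m) : R :=
  Num.sqrt (\sum_(i < m) v i 0 ^+ 2).

Definition quad (R : realType) m (P : 'M[R]_m) (v : 'cV[R]_m) : R :=
  (v^T *m P *m v) 0 0.

Definition posdef (R : realType) m (P : 'M[R]_m) : Prop :=
  P^T = P /\ forall v : 'cV[R]_m, v != 0 -> 0 < quad P v.

Definition hurwitz (R : realType) m (A : 'M[R]_m) : Prop :=
  forall l : R[i],
    eigenvalue (map_mx (fun a : R => real_complex R a) A) l -> complex.Re l < 0.

Definition C1 (R : realType) (f : R -> R) : Prop :=
  (forall y, derivable f y 1) /\ continuous (derive1 f).

Section DesignData.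
Context (R : realType) (n : nat).

(* [beta_phi] and [beta_sigma] are analysis parameters: they belong to the
   parameter vector but not to the closed-loop equations. *)
Record parameters := MkParameters {
  beta_c : 'cV[R]_n ;
  beta_rho : 'cV[R]_n.-1 ;
  beta_phi : 'cV[R]_n.-1 ;
  beta_delta : R ;
  beta_sigma : R }.

Definition admissible_parameters (B : parameters) : Prop :=
  [/\ forall i, 0 < beta_rho B i 0, forall i, 0 < beta_phi B i 0,
      0 < beta_delta B & 0 < beta_sigma B].

Record thresholds := MkThresholds {
  gamma_y : R ;
  gamma_ybar : R ;
  gamma_xi : R ;
  gamma_zeta : R ;
  gamma_h : R ;
  gamma_f : R }.

Definition admissible_thresholds (g : thresholds) : Prop :=
  [/\ 0 < gamma_y g, gamma_y g < gamma_ybar g &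
      [/\ 0 < gamma_xi g, 0 < gamma_zeta g, 0 < gamma_h g & 0 < gamma_f g]].

Definition thresholds_le (g : thresholds) (r : R) : Prop :=
  [/\ gamma_y g <= r, gamma_ybar g <= r &
      [/\ gamma_xi g <= r, gamma_zeta g <= r, gamma_h g <= r &
          gamma_f g <= r]].

Record ctrl_state := CtrlState {
  xi : 'cV[R]_n ;
  zeta : 'cV[R]_n ;
  thetahat : R ;
  alphaf : 'cV[R]_n.-1 }.

Record error_state := ErrorState {
  err_z : 'cV[R]_n ;
  err_upsilon : 'cV[R]_n.-1 ;
  err_theta : R ;
  err_eps : 'cV[R]_n ;
  err_zeta : 'cV[R]_n }.

Definition lyapunov (P : 'M[R]_n) (e : error_state) : R :=
  2^-1 * (\sum_i err_z e i 0 ^+ 2) + 2^-1 * (\sum_i err_upsilon e i 0 ^+ 2)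
  + 2^-1 * err_theta e ^+ 2 + quad P (err_eps e) + quad P (err_zeta e).

Definition Omega (P : 'M[R]_n) (q : R) : set error_state :=
  [set e | lyapunov P e <= q].

(* The end of the interval of existence and the event times are extended
   reals: an event that never happens is scheduled at +oo. *)
Record trajectory := Trajectory {
  t0 : R ;
  tend : \bar R ;
  plant_time : nat -> \bar R ;
  ctrl_time : nat -> \bar R ;
  state : R -> 'cV[R]_n ;
  ctrl : R -> ctrl_state ;
  ybar : R -> R ;
  input : R -> R }.

End DesignData.

Section ClosedLoop.
Context (R : realType) (n : nat).
Variables (psi : 'I_n -> R -> R) (k : 'cV[R]_n).

Definition psiv (y : R) : 'cV[R]_n := \col_i psi i y.

Definition Ac : 'M[R]_n :=
  \matrix_(i, j) (if j == 0%N :> nat then - k i 0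
                  else (j == i.+1 :> nat)%:R).

Definition bvec : 'cV[R]_n := \col_i (i.+1 == n)%:R.

Section Controller.
Variable B : parameters R n.
Implicit Types (w : ctrl_state R n) (v : R).

Definition zcoord w (y : R) (i : nat) : R :=
  if i == 1%N then y else crd (xi w) i - crd (alphaf w) i.-1.

(* alpha_i, 1 <= i < n, as a function of the value v standing for the output:
   v = ybar yields the virtual inputs, v = y their companions (with a hat). *)
Fixpoint alpha w v (i : nat) : R :=
  match i with
  | 0 => 0
  | 1 => - crd (beta_c B) 1 * v
         - thetahat w * (crd (psiv v) 1 + crd (zeta w) 2)
  | i'.+1 => - crd (beta_c B) i * zcoord w v i
             - crd k i * (v - crd (xi w) 1)
             - crd (beta_rho B) i.-1 * (crd (alphaf w) i.-1 - alpha w v i')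
  end.

Definition upsilon w v (i : nat) : R := crd (alphaf w) i.-1 - alpha w v i.-1.

Definition control w v : R :=
  - crd (beta_c B) n * zcoord w v n - crd k n * (v - crd (xi w) 1)
  - crd (beta_rho B) n.-1 * upsilon w v n.

Definition xi_rate w v (u : R) : 'cV[R]_n :=
  Ac *m xi w + v *: k + u *: bvec.

Definition zeta_rate w v : 'cV[R]_n := Ac *m zeta w + psiv v.

Definition thetahat_rate w v : R :=
  v * (crd (psiv v) 1 + crd (zeta w) 2) - beta_delta B * thetahat w.

Definition alphaf_rate w v : 'cV[R]_n.-1 :=
  \col_i (beta_rho B i 0 * (- alphaf w i 0 + alpha w v i.+1)).

Definition plant_rate (theta : R) (x : 'cV[R]_n) (u : R) : 'cV[R]_n :=
  \col_(i < n) ((if i.+1 == n then u else crd x i.+2)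
                + theta * psi i (crd x 1)).

Definition cderive m (f : R -> 'cV[R]_m) (s : R) (v : 'cV[R]_m) : Prop :=
  forall i, is_derive s 1 (fun r => f r i 0) (v i 0).

Definition ccontinuous m (D : set R) (f : R -> 'cV[R]_m) : Prop :=
  forall i, {within D, continuous (fun r => f r i 0)}.

Section Trajectory.
Variables (theta : R) (tau : trajectory R n).

Definition output (s : R) : R := crd (state tau s) 1.

Definition lifespan : set R :=
  [set s | t0 tau <= s /\ (s%:E < tend tau)%E].

Definition plant_sample (i : nat) : R := fine (plant_time tau i).
Definition ctrl_sample (j : nat) : R := fine (ctrl_time tau j).

(* Infima are over the interval of existence; inf of the empty set is +oo. *)
Definition plant_triggering (g : thresholds R) : Prop :=
  plant_time tau 0 = (t0 tau)%:E /\
  forall i, plant_time tau i.+1 = ereal_inf [set s%:E | s in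
    [set s | [/\ lifespan s, (plant_time tau i < s%:E)%E &
       gamma_y g <= `|output s - output (plant_sample i)|]]].

Definition ctrl_triggered (g : thresholds R) (s r : R) : Prop :=
  let w := ctrl tau s in let w' := ctrl tau r in
  gamma_ybar g <= `|ybar tau s - ybar tau r| \/
  gamma_xi g <= norm2 (xi w - xi w') \/
  gamma_zeta g <= norm2 (zeta w - zeta w') \/
  gamma_h g <= `|thetahat w - thetahat w'| \/
  gamma_f g <= norm2 (alphaf w - alphaf w').

Definition ctrl_triggering (g : thresholds R) : Prop :=
  ctrl_time tau 0 = (t0 tau)%:E /\
  forall j, ctrl_time tau j.+1 = ereal_inf [set s%:E | s in
    [set s | [/\ lifespan s, (ctrl_time tau j < s%:E)%E &
       ctrl_triggered g s (ctrl_sample j)]]].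

(* The inter-event intervals cover the interval of existence, so a trajectory
   with infinitely many events accumulating at a finite time ends there. *)
Definition transmission : Prop :=
  forall s, lifespan s ->
    (exists i, [/\ (plant_time tau i <= s%:E)%E,
                   (s%:E < plant_time tau i.+1)%E &
                   ybar tau s = output (plant_sample i)]) /\
    (exists j, [/\ (ctrl_time tau j <= s%:E)%E,
                   (s%:E < ctrl_time tau j.+1)%E &
                   input tau s = control (ctrl tau (ctrl_sample j))
                                         (ybar tau (ctrl_sample j))]).

(* Continuous signals, differentiable between consecutive controller events. *)
Definition dynamics : Prop :=
  [/\ ccontinuous lifespan (state tau),
      ccontinuous lifespan (fun s => xi (ctrl tau s)),
      ccontinuous lifespan (fun s => zeta (ctrl tau s)),
      {within lifespan, continuous (fun s => thetahat (ctrl tau s))} &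
      ccontinuous lifespan (fun s => alphaf (ctrl tau s))] /\
  forall j s, lifespan s -> (ctrl_time tau j < s%:E)%E ->
    (s%:E < ctrl_time tau j.+1)%E ->
    let w := ctrl tau (ctrl_sample j) in
    let v := ybar tau (ctrl_sample j) in
    [/\ cderive (state tau) s
          (plant_rate theta (state tau s) (input tau s)),
        cderive (fun r => xi (ctrl tau r)) s (xi_rate w v (input tau s)),
        cderive (fun r => zeta (ctrl tau r)) s (zeta_rate w v),
        is_derive s 1 (fun r => thetahat (ctrl tau r)) (thetahat_rate w v) &
        cderive (fun r => alphaf (ctrl tau r)) s (alphaf_rate w v)].

Definition closed_loop (g : thresholds R) : Prop :=
  [/\ ((t0 tau)%:E < tend tau)%E, plant_triggering g, ctrl_triggering g,
      transmission & dynamics].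

Definition eta_at (s : R) : error_state R n :=
  let w := ctrl tau s in
  let y := output s in
  ErrorState (\col_i zcoord w y i.+1) (\col_i upsilon w y i.+2)
             (theta - thetahat w)
             (state tau s - (xi w + theta *: zeta w)) (zeta w).

Definition signals_bounded (M : R) : Prop :=
  forall s, t0 tau <= s ->
    let w := ctrl tau s in
    [/\ norm2 (state tau s) <= M, `|output s| <= M, `|ybar tau s| <= M &
        `|input tau s| <= M] /\
    [/\ norm2 (xi w) <= M, norm2 (zeta w) <= M, `|thetahat w| <= M &
        norm2 (alphaf w) <= M] /\
    [/\ forall i, (1 <= i <= n)%N -> `|zcoord w (output s) i| <= M,
        forall i, (1 <= i < n)%N -> `|alpha w (ybar tau s) i| <= M &
        forall i, (2 <= i <= n)%N -> `|upsilon w (ybar tau s) i| <= M].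

Definition practically_stable (eps : R) : Prop :=
  (limf_esup (fun s : R => `|output s|%:E) (pinfty_nbhs R) <= eps%:E)%E.

Definition dwell_time (wbar w : R) : Prop :=
  (forall i, (plant_time tau i + wbar%:E <= plant_time tau i.+1)%E) /\
  (forall j, (ctrl_time tau j + w%:E <= ctrl_time tau j.+1)%E).

End Trajectory.

(* A solution is taken to be non-continuable. *)
Definition solution (theta : R) (g : thresholds R) (tau : trajectory R n) :
    Prop :=
  closed_loop theta tau g /\
  ~ exists tau' : trajectory R n,
      [/\ closed_loop theta tau' g, t0 tau' = t0 tau,
          (tend tau < tend tau')%E &
          forall s, lifespan tau s ->
            state tau' s = state tau s /\ ctrl tau' s = ctrl tau s].

End Controller.
End ClosedLoop.

(* Main.v *)
Require Import Defs.
From HB Require Import structures.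
From mathcomp Require Import all_boot all_order all_algebra.
From mathcomp Require Import all_classical all_reals all_analysis.
From mathcomp Require Import ring lra.

Set Implicit Arguments.
Unset Strict Implicit.
Unset Printing Implicit Defensive.

Import Order.TTheory GRing.Theory Num.Theory.
Import numFieldNormedType.Exports.

Local Open Scope classical_set_scope.
Local Open Scope ring_scope.

(* The error vector is bounded on [V <= q + 1], so every constant below may depend
   on [q]. In [V'] the coordinates [z_i] and [upsilon_i] contribute
   [- c_i z_i^2] and [- rho_i upsilon_i^2] plus cross terms; those in which a given
   coordinate [e] occurs are at most [M |e|], where [M] depends only on [q] and on
   the gains chosen before that of [e] (first the [c_i], then [rho_2], ...,
   [rho_n]), so a gain [1 + M^2] absorbs them up to a universal constant. The terms
   in [theta~], [eps] and [zeta] are controlled by [delta = 1] and the Lyapunov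
   equation. Hence, without sampling, [V' <= - al V + C0] with [al] and [C0]
   independent of [q], and [q0 = (C0 + 1) / al]. Sampling perturbs the rates by
   [O(gammamax)], which preserves [V' < 0] on the boundary of [V <= q].
   On this invariant set all signals are Lipschitz, so that the inter-event times
   are bounded below; a solution with a finite lifetime would then have limits at
   its end point, from which a Picard iteration continues it. *)

(** The bounds on the [psi_i] are local, hence depend on [q], whereas [q0] must precede [q]. This
    works because every term whose size depends on [q] can be given a factor [z_i] or [upsilon_i],
    which a gain then absorbs. Two terms need care. The product of [y], [theta~] and
    [psi_1 + zeta_2], produced by [z_1], cancels against the adaptive law. In the equation of
    [zeta], [psi(y)] is split: [psi(0)] goes into [C0], and [psi(y) - psi(0)], at most a multiple of
    [|y|], is charged to [z_1]. The decay estimate is needed slightly above the level [q], since the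
    derivative is evaluated just after a time where [V = q]; this is the reason for the margin in
    [V <= q + 1]. Nothing is known beforehand about accumulation of events, so the invariance of
    [V <= q] cannot be proved interval by interval. Real induction replaces the count of events: it
    uses only continuity on the left of a time, and differentiability immediately on its right.
    Dwell times come afterwards, from Lipschitz bounds on the invariant set. *)

(** * Real induction, and differential inequalities with exceptional times *)

Section RealInduction.
Context (R : realType).
Implicit Types (a b s r h d e M : R) (f : R -> R).

(** Let [m] be the supremum of the points up to which [Q] holds throughout. The second hypothesis
    gives [Q m]; if [m < b], the third carries [Q] beyond [m], which is absurd. *)
Lemma real_induction a b (Q : R -> Prop) :
  Q a ->
  (forall s, a < s -> s <= b -> (forall r, a <= r -> r < s -> Q r) -> Q s) ->
  (forall s, a <= s -> s < b -> Q s ->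
     exists2 h, 0 < h & forall r, s < r -> r < s + h -> Q r) ->
  forall s, a <= s -> s <= b -> Q s.
Proof.
move=> Qa Qlim Qstep s0 as0 s0b.
have ab : a <= b by exact: le_trans s0b.
pose A := [set s | [/\ a <= s, s <= b & forall r, a <= r -> r <= s -> Q r]].
have Aa : A a.
  by split=> // r ar ra; have -> : r = a by apply/eqP; rewrite eq_le ra ar.
have supA : has_sup A by split; [exists a | exists b => r []].
have am : a <= sup A by apply: ub_le_sup => //; exists b => r [].
have mb : sup A <= b by apply: ge_sup => [|r []//]; exists a.
have Qlt r : a <= r -> r < sup A -> Q r.
  move=> ar rm; have e0 : 0 < sup A - r by rewrite subr_gt0.
  have [s [_ _ Qs] rs] := sup_adherent e0 supA.
  by apply: Qs => //; lra.
have Qm : Q (sup A).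
  have [<-//|am'] := eqVneq a (sup A).
  by apply: Qlim => //; rewrite lt_neqAle am' am.
have [mb'|bm] := ltP (sup A) b; last first.
  have [->|s0m] := eqVneq s0 (sup A) => //.
  by apply: Qlt => //; rewrite lt_neqAle s0m (le_trans s0b).
have [h h0 Qh] := Qstep _ am mb' Qm.
pose t := sup A + Num.min h (b - sup A) / 2.
have min0 : 0 < Num.min h (b - sup A) by rewrite lt_min h0 subr_gt0.
have minh : Num.min h (b - sup A) <= h by rewrite ge_min lexx.
have minb : Num.min h (b - sup A) <= b - sup A by rewrite ge_min lexx orbT.
have At : A t.
  split; [by rewrite /t; lra| by rewrite /t; lra |] => r ar rt.
  have [rm|] := ltP r (sup A); first exact: Qlt.
  rewrite le_eqVlt => /orP[/eqP<-//|mr].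
  by apply: Qh => //; apply: le_lt_trans rt _; rewrite /t; lra.
have : t <= sup A by apply: ub_le_sup => //; exists b => r [].
by rewrite /t; lra.
Qed.

(** Continuity for the topology of the subspace [D], in a form that passes to subsets without a
    change of topology. *)
Definition econtinuous (D : set R) f := forall s, D s -> forall e, 0 < e ->
  exists2 d, 0 < d & forall r, D r -> `|r - s| < d -> `|f r - f s| < e.

Lemma within_econtinuous (D : set R) f :
  {within D, continuous f} <-> econtinuous D f.
Proof.
split.
  move=> /subspace_continuousP cf s Ds e e0.
  have /cvgrPdist_lt /(_ e e0) := cf s Ds.
  rewrite near_withinE => /nbhs_ballP[d /= d0 H].
  exists d => // r Dr rs; rewrite distrC; apply: H => //.
  by rewrite /ball /= distrC.
move=> cf; apply/subspace_continuousP => s Ds; apply/cvgrPdist_lt => e e0.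
have [d d0 H] := cf s Ds e e0.
rewrite near_withinE; apply/nbhs_ballP; exists d => //= r rs Dr.
by rewrite distrC; apply: H => //; rewrite distrC.
Qed.

Lemma econtinuousS (D E : set R) f :
  D `<=` E -> econtinuous E f -> econtinuous D f.
Proof.
move=> DE cf s /DE Es e e0; have [d d0 H] := cf s Es e e0.
by exists d => // r /DE; exact: H.
Qed.

Lemma mean_value a b f : a < b -> econtinuous `[a, b] f ->
  (forall r, a < r -> r < b -> exists l, is_derive r 1 f l) ->
  exists c l, [/\ a < c, c < b, is_derive c 1 f l & f b - f a = l * (b - a)].
Proof.
move=> ab /within_econtinuous cf df.
have [|c] := @MVT R f (fun x => 'D_1 f x) a b ab _ cf.
  move=> x; rewrite in_itv /= => /andP[ax xb].
  have [l Hl] := df x ax xb.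
  by split; [apply: (@ex_derive _ _ _ _ _ _ _ Hl)|].
rewrite in_itv /= => /andP[ac cb] E; exists c, ('D_1 f c); split => //.
have [l Hl] := df c ac cb.
by split; [apply: (@ex_derive _ _ _ _ _ _ _ Hl)|].
Qed.

(** A derivative is required only on a right neighbourhood of each [s], with [s] itself excluded.
    This tolerates sampling instants, even if they accumulate from the left. *)
Lemma lipschitz_of_derive a b f M : 0 <= M -> econtinuous `[a, b] f ->
  (forall s, a <= s -> s < b -> exists2 h, 0 < h &
     forall r, s < r -> r < s + h -> r < b ->
       exists2 l, is_derive r 1 f l & `|l| <= M) ->
  forall s, a <= s -> s <= b -> `|f s - f a| <= M * (s - a).
Proof.
move=> M0 cf df; apply: real_induction.
- by rewrite !subrr normr0 mulr0.
- move=> s as' sb IH; rewrite leNgt; apply/negP => H.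
  have Ds : `[a, b]%classic s by rewrite /= in_itv /= (ltW as').
  have e0 : 0 < `|f s - f a| - M * (s - a) by rewrite subr_gt0.
  have [d d0 Hd] := cf s Ds _ e0.
  pose r := Num.max a (s - d / 2).
  have ar : a <= r by rewrite le_max lexx.
  have rs : r < s by rewrite gt_max as' /=; lra.
  have rd : s - d / 2 <= r by rewrite le_max lexx orbT.
  have Dr : `[a, b]%classic r by rewrite /= in_itv /= ar /=; lra.
  have := Hd r Dr; rewrite distrC ger0_norm ?subr_ge0 ?(ltW rs) //.
  move=> /(_ ltac:(lra)) H1; have H2 := IH r ar rs.
  have H3 : M * (r - a) <= M * (s - a) by rewrite ler_wpM2l //; lra.
  have H4 : `|f s - f a| <= `|f r - f s| + `|f r - f a|.
    have -> : f s - f a = - (f r - f s) + (f r - f a) by ring.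
    by rewrite (le_trans (ler_normD _ _)) // normrN.
  by lra.
- move=> s as' sb H; have [h h0 Hh] := df s as' sb.
  exists (Num.min h (b - s)); first by rewrite lt_min h0 subr_gt0.
  move=> r sr; rewrite -ltrBlDl lt_min => /andP[rh rb].
  have [||c [l [sc cr dl E]]] := @mean_value s r f sr.
  + apply: econtinuousS cf => x /=; rewrite !in_itv /= => /andP[x1 x2].
    by apply/andP; split; lra.
  + move=> x sx xr; have [|||l ? _] := Hh x; [lra..|].
    by exists l.
  have [|||l' Hl' Ml] := Hh c; [lra..|].
  have ll' : l = l' by rewrite -(@derive_val _ _ _ _ _ _ _ dl) (@derive_val _ _ _ _ _ _ _ Hl').
  have -> : f r - f a = (f r - f s) + (f s - f a) by ring.
  apply: le_trans (ler_normD _ _) _; rewrite E ll' normrM (gtr0_norm (x := r - s)) ?subr_gt0 //.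
  have : `|l'| * (r - s) <= M * (r - s) by rewrite ler_wpM2r // subr_ge0 ltW.
  by lra.
Qed.

(** At a point where [f = q] the inequality would make [f] decrease, but [f] may have no derivative
    there; continuity transfers the sign of the derivative to the points just after it, and the mean
    value theorem concludes. *)
Lemma sublevel_invariant a b f q al C :
  0 < al -> C < al * q -> econtinuous `[a, b] f -> f a <= q ->
  (forall s, a <= s -> s < b -> exists2 h, 0 < h &
     forall r, s < r -> r < s + h -> r < b -> exists l, is_derive r 1 f l /\
       (f r <= q + 1 -> l <= - al * f r + C)) ->
  forall s, a <= s -> s <= b -> f s <= q.
Proof.
move=> al0 Cq cf fa df; apply: real_induction => //.
- move=> s as' sb IH; rewrite leNgt; apply/negP => H.
  have Ds : `[a, b]%classic s by rewrite /= in_itv /= (ltW as').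
  have e0 : 0 < f s - q by rewrite subr_gt0.
  have [d d0 Hd] := cf s Ds _ e0.
  pose r := Num.max a (s - d / 2).
  have ar : a <= r by rewrite le_max lexx.
  have rs : r < s by rewrite gt_max as' /=; lra.
  have rd : s - d / 2 <= r by rewrite le_max lexx orbT.
  have Dr : `[a, b]%classic r by rewrite /= in_itv /= ar /=; lra.
  have := Hd r Dr; rewrite distrC ger0_norm ?subr_ge0 ?(ltW rs) //.
  move=> /(_ ltac:(lra)) H1; have H2 := IH r ar rs.
  by have := ler_norm (f s - f r); rewrite distrC; lra.
- move=> s as' sb H; have [h h0 Hh] := df s as' sb.
  have Ds : `[a, b]%classic s by rewrite /= in_itv /= as' ltW.
  have [fsq|qfs] := ltP (f s) q.
    have e0 : 0 < q - f s by rewrite subr_gt0.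
    have [d d0 Hd] := cf s Ds _ e0.
    exists (Num.min d (b - s)); first by rewrite lt_min d0 subr_gt0.
    move=> r sr; rewrite -ltrBlDl lt_min => /andP[rd rb].
    have Dr : `[a, b]%classic r.
      by rewrite /= in_itv /= (le_trans as' (ltW sr)) -(lerD2r (- s)) ltW.
    have := Hd r Dr; rewrite ger0_norm ?subr_ge0 ?(ltW sr) // => /(_ rd)/ltW.
    by move=> /(le_trans (ler_norm _)); rewrite lerD2r.
  have fs : f s = q by apply/eqP; rewrite eq_le H.
  (* Within [e] of the level [q], [f] is at most [q + 1], so that the inequality applies, and at
     least [C / al], so that the inequality makes the derivative nonpositive. *)
  pose e := Num.min 1 (q - C / al).
  have qC : C / al < q by rewrite ltr_pdivrMr // mulrC.
  have e0 : 0 < e by rewrite lt_min ltr01 subr_gt0.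
  have [d d0 Hd] := cf s Ds e e0.
  exists (Num.min (Num.min h d) (b - s)).
    by rewrite !lt_min h0 d0 subr_gt0.
  move=> r sr; rewrite -ltrBlDl !lt_min -andbA => /and3P[rh rd rb].
  have [||c [l [sc cr dl E]]] := @mean_value s r f sr.
  + apply: econtinuousS cf => x /=; rewrite !in_itv /= => /andP[sx xr].
    by rewrite (le_trans as' sx) (le_trans xr) // -(lerD2r (- s)) ltW.
  + move=> x sx xr; have [|||l [? _]] := Hh x; [by []| | |by exists l].
      by rewrite -ltrBlDl; apply: lt_trans rh; rewrite ltrD2r.
    by rewrite -(ltrD2r (- s)); apply: lt_trans rb; rewrite ltrD2r.
  have cs : c - s < r - s by rewrite ltrD2r.
  have [|||l' [Hl' Ml]] := Hh c; [by []| | |].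
  + by rewrite -ltrBlDl; exact: lt_trans rh.
  + by rewrite -(ltrD2r (- s)); exact: lt_trans rb.
  have ll' : l = l' by rewrite -(@derive_val _ _ _ _ _ _ _ dl) (@derive_val _ _ _ _ _ _ _ Hl').
  have Dc : `[a, b]%classic c.
    by rewrite /= in_itv /= (le_trans as' (ltW sc)) -(lerD2r (- s)) (le_trans (ltW cs) (ltW rb)).
  have := Hd c Dc; rewrite ger0_norm ?subr_ge0 ?(ltW sc) // => /(_ (lt_trans cs rd)).
  rewrite fs lt_min ltr_norml => /andP[/andP[_ fc1]]; rewrite ltr_norml => /andP[fcC _].
  have fcq : f c <= q + 1 by rewrite addrC -lerBlDr ltW.
  have Cfc : C <= al * f c.
    rewrite mulrC -ler_pdivrMr // ltW //.
    by move: fcC; rewrite opprB ltrD2r.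
  have l0 : l <= 0.
    by rewrite ll'; apply: le_trans (Ml fcq) _; rewrite mulNr addrC subr_le0.
  by rewrite -subr_le0 -fs E mulr_le0_ge0 // subr_ge0 ltW.
Qed.

End RealInduction.

(** * Calculus of bounded quantities that differ by [O(g)] *)

Section Agreement.
Context (R : realType) (T : Type) (S : R -> T -> Prop).
Implicit Types (f h : T -> R).

(* [S g] is the set of points perturbed by at most [g]: [agree f f'] says that
   [f] and [f'] are bounded and differ by [O(g)]; [agree f f], that [f] is bounded. *)
Definition agree f f' := exists C, forall g p, 0 <= g -> g <= 1 -> S g p ->
  [/\ `|f p| <= C, `|f' p| <= C & `|f p - f' p| <= C * g].

Lemma agree_sym f f' : agree f f' -> agree f' f.
Proof.
by move=> [C H]; exists C => g p g0 g1 /(H g p g0 g1)[? ? ?]; rewrite distrC.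
Qed.

Lemma agree_bounded f C : 0 <= C ->
  (forall g p, 0 <= g -> g <= 1 -> S g p -> `|f p| <= C) -> agree f f.
Proof.
move=> C0 H; exists C => g p g0 g1 Sp; split; [exact: H Sp|exact: H Sp|].
by rewrite subrr normr0 mulr_ge0.
Qed.

Lemma agree_l f f' : agree f f' -> agree f f.
Proof.
move=> [C H]; apply: (@agree_bounded _ `|C|) => // g p g0 g1 Sp.
by have [H1 _ _] := H g p g0 g1 Sp; apply: le_trans H1 (ler_norm _).
Qed.

Lemma agree_r f f' : agree f f' -> agree f' f'.
Proof. by move=> /agree_sym/agree_l. Qed.

Lemma agree_cst (a : R) : agree (fun=> a) (fun=> a).
Proof. by apply: (@agree_bounded _ `|a|). Qed.

Lemma agree_near f f' C : agree f f ->
  (forall g p, S g p -> `|f p - f' p| <= C * g) -> agree f f'.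
Proof.
move=> [C1 H1] H; exists (`|C1| + `|C|) => g p g0 g1 Sp.
have [a _ _] := H1 g p g0 g1 Sp; have b := H g p Sp.
have c1 := ler_norm C1; have c2 := ler_norm C; have c0 := normr_ge0 C.
have c3 : C * g <= `|C| * g by rewrite ler_wpM2r.
have c4 : `|C| * g <= `|C| by rewrite ler_piMr.
have c5 : 0 <= `|C1| * g by rewrite mulr_ge0.
split; [lra| |by rewrite mulrDl; lra].
have -> : f' p = f p - (f p - f' p) by ring.
by rewrite (le_trans (ler_normB _ _)) //; lra.
Qed.

Lemma agreeD f f' h h' : agree f f' -> agree h h' ->
  agree (fun p => f p + h p) (fun p => f' p + h' p).
Proof.
move=> [C H] [K J]; exists (C + K) => g p g0 g1 Sp.
have [a1 a2 a3] := H g p g0 g1 Sp; have [b1 b2 b3] := J g p g0 g1 Sp.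
split; [exact: le_trans (ler_normD _ _) (lerD _ _)..|].
rewrite mulrDl; have -> : f p + h p - (f' p + h' p) = (f p - f' p) + (h p - h' p) by ring.
exact: le_trans (ler_normD _ _) (lerD _ _).
Qed.

Lemma agreeN f f' : agree f f' -> agree (fun p => - f p) (fun p => - f' p).
Proof.
move=> [C H]; exists C => g p g0 g1 Sp; have [a b c] := H g p g0 g1 Sp.
by split; rewrite ?normrN // opprK addrC distrC.
Qed.

Lemma agreeB f f' h h' : agree f f' -> agree h h' ->
  agree (fun p => f p - h p) (fun p => f' p - h' p).
Proof. by move=> H K; apply: agreeD => //; apply: agreeN. Qed.

Lemma agreeM f f' h h' : agree f f' -> agree h h' ->
  agree (fun p => f p * h p) (fun p => f' p * h' p).
Proof.
move=> [C H] [K J]; exists (`|C| * `|K| + `|C| * `|K|) => g p g0 g1 Sp.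
have [a1 a2 a3] := H g p g0 g1 Sp; have [b1 b2 b3] := J g p g0 g1 Sp.
have c1 := ler_norm C; have c2 := ler_norm K.
have P0 : 0 <= `|C| * `|K| by rewrite mulr_ge0.
have M u v : `|u| <= C -> `|v| <= K -> `|u * v| <= `|C| * `|K|.
  by move=> ? ?; rewrite normrM ler_pM //; lra.
have m1 := M _ _ a1 b1; have m2 := M _ _ a2 b2.
split; [lra..|].
have -> : f p * h p - f' p * h' p = f p * (h p - h' p) + (f p - f' p) * h' p by ring.
rewrite [X in _ <= X]mulrDl; apply: le_trans (ler_normD _ _) _; apply: lerD; rewrite normrM.
  rewrite -mulrA; apply: ler_pM => //; first by lra.
  by apply: le_trans b3 _; rewrite ler_wpM2r.
rewrite mulrAC; apply: ler_pM => //; last by lra.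
by apply: le_trans a3 _; rewrite ler_wpM2r.
Qed.

Lemma agree_norm f f' : agree f f' -> agree (fun p => `|f p|) (fun p => `|f' p|).
Proof.
move=> [C H]; exists C => g p g0 g1 Sp; have [a b c] := H g p g0 g1 Sp.
by rewrite !normr_id; split => //; apply: le_trans (ler_dist_dist _ _) c.
Qed.

Lemma agree_ext f f' h h' : (forall g p, S g p -> f p = h p) ->
  (forall g p, S g p -> f' p = h' p) -> agree f f' -> agree h h'.
Proof.
by move=> E E' [C H]; exists C => g p g0 g1 Sp; rewrite -(E g p Sp) -(E' g p Sp); exact: H.
Qed.

Lemma agree_sum m (f f' : 'I_m -> T -> R) : (forall i, agree (f i) (f' i)) ->
  agree (fun p => \sum_i f i p) (fun p => \sum_i f' i p).
Proof.
elim: m f f' => [|m IH] f f' H.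
  by under [X in agree X _]eq_fun do rewrite big_ord0; under [X in agree _ X]eq_fun do rewrite big_ord0; exact: agree_cst.
under [X in agree X _]eq_fun do rewrite big_ord_recl.
under [X in agree _ X]eq_fun do rewrite big_ord_recl.
by apply: agreeD => //; apply: IH => i.
Qed.

Lemma agreeP f : agree f f -> exists2 C, 0 < C &
  forall g p, 0 <= g -> g <= 1 -> S g p -> `|f p| <= C.
Proof.
move=> [C H]; exists (`|C| + 1) => [|g p g0 g1 Sp]; first by have := normr_ge0 C; lra.
by have [a _ _] := H g p g0 g1 Sp; have := ler_norm C; lra.
Qed.

End Agreement.

(** * C1 functions on bounded intervals *)

Section ContinuouslyDifferentiable.
Context (R : realType).
Implicit Types f : R -> R.

Lemma continuous_bounded f (K : R) : continuous f ->
  exists2 C, 0 < C & forall y, `|y| <= K -> `|f y| <= C.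
Proof.
move=> cf; have [K0|K0] := leP 0 K; last first.
  by exists 1 => // y yK; have := normr_ge0 y; lra.
have cn : {within `[- K, K], continuous (fun y => `|f y|)}.
  apply: continuous_subspaceT => y.
  by apply: continuous_comp; [exact: cf | exact: norm_continuous].
have [|c _ Hc] := EVT_max _ cn; first by lra.
exists (`|f c| + 1) => [|y yK]; first by have := normr_ge0 (f c); lra.
have := Hc y; rewrite in_itv /= -ler_norml => /(_ yK); lra.
Qed.

Lemma C1_econtinuous f D : C1 f -> econtinuous D f.
Proof.
move=> [df _]; apply/within_econtinuous/continuous_subspaceT => y.
exact/differentiable_continuous/derivable1_diffP.
Qed.

Lemma C1_is_derive f (y : R) : C1 f -> is_derive y (1:R) f (derive1 f y).
Proof. by move=> [df _]; rewrite derive1E; split. Qed.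

Lemma C1_lipschitz f (K : R) : C1 f ->
  exists2 C, 0 < C & forall y y', `|y| <= K -> `|y'| <= K ->
    `|f y - f y'| <= C * `|y - y'|.
Proof.
move=> fC1; have [C C0 HC] := continuous_bounded K fC1.2.
exists C => //.
have main y y' : y <= y' -> `|y| <= K -> `|y'| <= K -> `|f y' - f y| <= C * (y' - y).
  move=> yy' yK y'K.
  apply: (@lipschitz_of_derive _ y y') => //; first exact: ltW.
    exact: C1_econtinuous.
  move=> s as' sb; exists 1 => // r sr _ rb; exists (derive1 f r); first exact: C1_is_derive.
  apply: HC; rewrite ler_norml; move: yK y'K; rewrite !ler_norml => /andP[? ?] /andP[? ?].
  by apply/andP; split; lra.
move=> y y' yK y'K; have [le|/ltW le] := leP y y'.
  by rewrite distrC [X in _ <= C * X]distrC [X in _ <= C * X]ger0_norm ?subr_ge0 //; apply: main.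
by rewrite [X in _ <= C * X]ger0_norm ?subr_ge0 //; apply: main.
Qed.

(** Both arguments stay in one bounded interval, on which a C1 function is bounded and Lipschitz. *)
Lemma agree_comp_C1 (T : Type) (S : R -> T -> Prop) (ps : R -> R) (f f' : T -> R) :
  C1 ps -> agree S f f' -> agree S (fun p => ps (f p)) (fun p => ps (f' p)).
Proof.
move=> pC1 [K H]; have [C C0 HC] := C1_lipschitz K pC1.
have [C' C'0 HC'] := continuous_bounded K (fun y => differentiable_continuous ((derivable1_diffP _ _).1 (pC1.1 y))).
exists (C' + C * `|K|) => g p g0 g1 Sp; have [a b c] := H g p g0 g1 Sp.
have := HC' _ a; have := HC' _ b; have := HC _ _ a b.
have CK : 0 <= C * `|K| by rewrite mulr_ge0 // ltW.
move=> h1 h2 h3; split; [lra..|]; apply: le_trans h1 _.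
have : C * `|f p - f' p| <= C * (`|K| * g).
  rewrite ler_wpM2l ?(ltW C0) //; apply: le_trans c _.
  by rewrite ler_wpM2r // ler_norm.
have : 0 <= C' * g by rewrite mulr_ge0 // ltW.
by rewrite mulrDl -mulrA; lra.
Qed.

End ContinuouslyDifferentiable.

(** * Closed-loop rates and their perturbation by sampling *)

Section Coordinates.
Context (R : realType).

Lemma crd_ord m (v : 'cV[R]_m) (i : 'I_m) : crd v i.+1 = v i 0.
Proof. by rewrite /crd /= valK. Qed.

(** The default value 0 stands for the missing superdiagonal entry in the last row of [Ac], so that
    the formulas for the rates below need no separate case there. *)
Lemma crd_out m (v : 'cV[R]_m) i : (m <= i)%N -> crd v i.+1 = 0.
Proof. by move=> mi; rewrite /crd insubF //= ltnNge mi. Qed.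

Lemma crdP m i : (exists o : 'I_m, forall v : 'cV[R]_m, crd v i = v o 0) \/
  (forall v : 'cV[R]_m, crd v i = 0).
Proof.
have [im|mi] := ltnP i.-1 m.
  by left; exists (Ordinal im) => v; rewrite /crd insubT.
by right => v; rewrite /crd insubF // ltnNge mi.
Qed.

Lemma crdD m (u v : 'cV[R]_m) i : crd (u + v) i = crd u i + crd v i.
Proof. by have [[j E]|E] := crdP m i; rewrite !E ?mxE ?addr0. Qed.

Lemma crdN m (u : 'cV[R]_m) i : crd (- u) i = - crd u i.
Proof. by have [[j E]|E] := crdP m i; rewrite !E ?mxE ?oppr0. Qed.

Lemma crdZ m (a : R) (u : 'cV[R]_m) i : crd (a *: u) i = a * crd u i.
Proof. by have [[j E]|E] := crdP m i; rewrite !E ?mxE ?mulr0. Qed.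

Lemma crd_const m (a : R) i : (0 < i)%N -> (i <= m)%N ->
  crd (const_mx a : 'cV[R]_m) i = a.
Proof. by case: i => // i _ im; rewrite (crd_ord _ (Ordinal im)) mxE. Qed.

End Coordinates.

Section Static.
Context (R : realType) (n : nat).
Variables (psi : 'I_n -> R -> R) (k : 'cV[R]_n).
Hypothesis (n_ge2 : (1 < n)%N) (psi_C1 : forall i, C1 (psi i)).
Implicit Types (w ws dw : ctrl_state R n) (x dx : 'cV[R]_n) (B : parameters R n).

Lemma Ac_mulE (v : 'cV[R]_n) i :
  crd (Ac k *m v) i.+1 = - crd k i.+1 * crd v 1 + crd v i.+2.
Proof.
have [ni|lt_in] := leqP n i.
  by rewrite (crd_out _ ni) (crd_out k ni) (crd_out v (leqW ni)) oppr0 mul0r addr0.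
have -> : i = Ordinal lt_in by [].
set o := Ordinal _; rewrite (crd_ord _ o) (crd_ord k o) mxE.
have n0 : (0 < n)%N by exact: ltnW.
rewrite (bigD1 (Ordinal n0)) //= mxE /= (crd_ord v (Ordinal n0)); congr (_ + _).
have [ni|lt_i1] := leqP n i.+1.
  rewrite crd_out // big1 // => j j0; rewrite mxE.
  have -> : (j == 0%N :> nat) = false by apply: negbTE.
  have -> : (j == i.+1 :> nat) = false by apply/eqP => E; have := ltn_ord j; rewrite E ltnNge ni.
  by rewrite mul0r.
rewrite (crd_ord v (Ordinal lt_i1)) (bigD1 (Ordinal lt_i1)) //= mxE /= eqxx mul1r.
rewrite big1 ?addr0 // => j /andP[j0 j1]; rewrite mxE.
have -> : (j == 0%N :> nat) = false by apply: negbTE.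
have -> : (j == i.+1 :> nat) = false by apply: negbTE.
by rewrite mul0r.
Qed.

Lemma xi_rateE w v u i : crd (xi_rate k w v u) i.+1 =
  - crd k i.+1 * crd (xi w) 1 + crd (xi w) i.+2 + v * crd k i.+1
  + (if i.+1 == n then u else 0).
Proof.
rewrite /xi_rate !crdD Ac_mulE !crdZ; congr (_ + _).
have [ni|lt_in] := leqP n i.
  by rewrite crd_out // mulr0; case: eqP => // E; rewrite -E ltnn in ni.
by rewrite (crd_ord _ (Ordinal lt_in)) mxE /=; case: eqP; rewrite ?mulr1 ?mulr0.
Qed.

Lemma zeta_rateE w v i : crd (zeta_rate psi k w v) i.+1 =
  - crd k i.+1 * crd (zeta w) 1 + crd (zeta w) i.+2 + crd (psiv psi v) i.+1.
Proof. by rewrite /zeta_rate crdD Ac_mulE. Qed.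

Lemma alphaf_rateE B w v i : crd (alphaf_rate psi k B w v) i.+1 =
  - crd (beta_rho B) i.+1 * upsilon psi k B w v i.+2.
Proof.
rewrite /upsilon; have [ni|lt_in] := leqP n.-1 i.
  by rewrite !crd_out // oppr0 mul0r.
by rewrite !(crd_ord _ (Ordinal lt_in)) mxE /=; ring.
Qed.

Lemma plant_rateE th x u i : crd (plant_rate psi th x u) i.+1 =
  (if i.+1 == n then u else crd x i.+2) + th * crd (psiv psi (crd x 1)) i.+1.
Proof.
have [ni|lt_in] := leqP n i.
  rewrite !crd_out ?mulr0 ?addr0 // ?(leqW ni) //.
  by case: eqP => // E; rewrite -E ltnn in ni.
by rewrite !(crd_ord _ (Ordinal lt_in)) !mxE.
Qed.

(** Since [n] occurs in the types, it cannot be rewritten as a successor; this changes only its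
    occurrences as an index. *)
Lemma controlE B w v j : j = n -> control psi k B w v =
  - crd (beta_c B) j * zcoord w v j - crd k j * (v - crd (xi w) 1)
  - crd (beta_rho B) j.-1 * upsilon psi k B w v j.
Proof. by move=> ->. Qed.

(** [eta_at] is this function evaluated along a trajectory. As a function of the states it can be
    bounded before any trajectory is considered. *)
Definition error_of B (th : R) x w : error_state R n :=
  ErrorState (\col_i zcoord w (crd x 1) i.+1)
    (\col_i upsilon psi k B w (crd x 1) i.+2)
    (th - thetahat w) (x - (xi w + th *: zeta w)) (zeta w).

Definition ctrl_rate B w v : ctrl_state R n :=
  CtrlState (xi_rate k w v (control psi k B w v)) (zeta_rate psi k w v)
    (thetahat_rate psi B w v) (alphaf_rate psi k B w v).

(* Time derivative of [alpha w y i] when [w] and [y] have derivatives [dw] and [dy]. *)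
Fixpoint dalpha B w (y : R) dw (dy : R) (i : nat) : R :=
  match i with
  | 0 => 0
  | 1 => - crd (beta_c B) 1 * dy
         - (thetahat dw * (crd (psiv psi y) 1 + crd (zeta w) 2)
            + thetahat w * (derive1 (psi (Ordinal (ltnW n_ge2))) y * dy + crd (zeta dw) 2))
  | i'.+1 => - crd (beta_c B) i * zcoord dw dy i
             - crd k i * (dy - crd (xi dw) 1)
             - crd (beta_rho B) i.-1 * (crd (alphaf dw) i.-1 - dalpha B w y dw dy i')
  end.

(** One feedback gain [c] serves every index because the cross terms of all the [z_i] obey the same
    bound; the filter gains have to be chosen one after the other. *)
Definition gains (c : R) (r : 'cV[R]_n.-1) : parameters R n :=
  MkParameters (const_mx c) r (const_mx 1) 1 1.

(* A plant state and a controller state, together with the sampled controller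
   state [cf_ws] and output [cf_v] that drive the controller. *)
Record config := Config {
  cf_rho : 'cV[R]_n.-1 ;
  cf_th : R ;
  cf_x : 'cV[R]_n ;
  cf_w : ctrl_state R n ;
  cf_ws : ctrl_state R n ;
  cf_v : R }.

Definition error_bounded B (th : R) x w (Q : R) : Prop :=
  [/\ forall i, (i < n)%N -> `|zcoord w (crd x 1) i.+1| <= Q,
      forall i, (i.+1 < n)%N -> `|upsilon psi k B w (crd x 1) i.+2| <= Q,
      `|th - thetahat w| <= Q,
      forall i, `|(x - (xi w + th *: zeta w)) i 0| <= Q &
      forall i, `|zeta w i 0| <= Q].

Definition ctrl_close w ws (g : R) : Prop :=
  [/\ forall i, `|xi w i 0 - xi ws i 0| <= g,
      forall i, `|zeta w i 0 - zeta ws i 0| <= g,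
      `|thetahat w - thetahat ws| <= g &
      forall i, `|alphaf w i 0 - alphaf ws i 0| <= g].

(** The differential of [quad P] at [e] in the direction [d], without symmetry of [P]. *)
Definition dquad (P : 'M[R]_n) (e d : 'cV[R]_n) : R :=
  \sum_i \sum_j (d i 0 * (P i j * e j 0) + e i 0 * (P i j * d j 0)).

Definition dlyapunov (P : 'M[R]_n) B (th : R) x w dx dw : R :=
  let y := crd x 1 in let dy := crd dx 1 in
  \sum_(i < n) zcoord w y i.+1 * zcoord dw dy i.+1
  + \sum_(i < n.-1) upsilon psi k B w y i.+2 *
      (crd (alphaf dw) i.+1 - dalpha B w y dw dy i.+1)
  + (th - thetahat w) * - thetahat dw
  + dquad P (x - (xi w + th *: zeta w)) (dx - (xi dw + th *: zeta dw))
  + dquad P (zeta w) (zeta dw).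

(* The rate of [z_(i+1)] in the absence of sampling. *)
Definition zdot B (th : R) x w i : R :=
  let y := crd x 1 in
  - crd (beta_c B) 1 * zcoord w y i.+1
  + (if (i.+1 < n)%N then zcoord w y i.+2 + upsilon psi k B w y i.+2 else 0)
  + (if i == 0%N then (th - thetahat w) * (crd (psiv psi y) 1 + crd (zeta w) 2)
       + crd (x - (xi w + th *: zeta w)) 2 else 0).

(* [dlyapunov] with every rate except those of the [alpha_i] replaced by its
   value in the absence of sampling. *)
Definition dlyapunov_ideal (P : 'M[R]_n) B (th : R) x w dx dw : R :=
  let y := crd x 1 in
  \sum_(i < n) zcoord w y i.+1 * zdot B th x w i
  + \sum_(i < n.-1) upsilon psi k B w y i.+2 *
      (- crd (beta_rho B) i.+1 * upsilon psi k B w y i.+2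
       - dalpha B w y dw (crd dx 1) i.+1)
  + (th - thetahat w) *
      - (y * (crd (psiv psi y) 1 + crd (zeta w) 2) - thetahat w)
  + dquad P (x - (xi w + th *: zeta w)) (Ac k *m (x - (xi w + th *: zeta w)))
  + dquad P (zeta w) (Ac k *m zeta w + psiv psi y).

(** * Bounds and sampling errors on a bounded set of error coordinates *)

Section Box.
Variables (c thb Q : R).
Hypotheses (thb_ge0 : 0 <= thb) (Q_ge0 : 0 <= Q).

Let B (p : config) := gains c (cf_rho p).
Let w := cf_w.
Let ws := cf_ws.
Let y p := crd (cf_x p) 1.
Let v := cf_v.
Let th := cf_th.
Let eps p := cf_x p - (xi (w p) + th p *: zeta (w p)).
Let dw p := ctrl_rate (B p) (ws p) (v p).
Let dx p := plant_rate psi (th p) (cf_x p) (control psi k (B p) (ws p) (v p)).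
Let dy p := crd (dx p) 1.

(** Only the filter gains of index at most [m] are prescribed, the others being free. A bound valid
    on this set is therefore uniform in the gains that remain to be chosen. *)
Definition box (rr : nat -> R) m (g : R) (p : config) : Prop :=
  [/\ forall i, (1 < i <= m)%N -> crd (cf_rho p) i.-1 = rr i,
      `|cf_th p| <= thb, error_bounded (B p) (cf_th p) (cf_x p) (cf_w p) Q,
      ctrl_close (cf_w p) (cf_ws p) g & `|crd (cf_x p) 1 - cf_v p| <= g].

Section Agree.
Variables (rr : nat -> R) (m : nat).
Local Notation "f ~~ h" := (agree (box rr m) f h) (at level 70).

Let ag_th : th ~~ th.
Proof. by apply: (@agree_bounded _ _ _ _ thb) => // g p _ _ []. Qed.

Let ag_cst a : (fun=> a) ~~ (fun=> a). Proof. exact: agree_cst. Qed.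

Let ag_z i : (i < n)%N -> (fun p => zcoord (w p) (y p) i.+1) ~~ (fun p => zcoord (w p) (y p) i.+1).
Proof. by move=> ni; apply: (@agree_bounded _ _ _ _ Q) => // g p _ _ [_ _ [H _ _ _ _] _ _]; exact: H. Qed.

Let ag_ups0 i : (i.+1 < n)%N ->
  (fun p => upsilon psi k (B p) (w p) (y p) i.+2) ~~ (fun p => upsilon psi k (B p) (w p) (y p) i.+2).
Proof. by move=> ni; apply: (@agree_bounded _ _ _ _ Q) => // g p _ _ [_ _ [_ H _ _ _] _ _]; exact: H. Qed.

Let ag_y : y ~~ v.
Proof.
apply: (@agree_near _ _ _ _ _ 1) => [|g p [_ _ _ _ H]]; last by rewrite mul1r.
by have := ag_z (ltnW n_ge2).
Qed.

Let ag_thh : (fun p => thetahat (w p)) ~~ (fun p => thetahat (ws p)).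
Proof.
apply: (@agree_near _ _ _ _ _ 1) => [|g p [_ _ _ [_ _ H _] _]]; last by rewrite mul1r.
have H : (fun p => th p - thetahat (w p)) ~~ (fun p => th p - thetahat (w p)).
  by apply: (@agree_bounded _ _ _ _ Q) => // g p _ _ [_ _ [_ _ H _ _] _ _].
apply: agree_ext (agreeB ag_th H) => g p _; ring.
Qed.

Let ag_zeta i : (fun p => crd (zeta (w p)) i) ~~ (fun p => crd (zeta (ws p)) i).
Proof.
have [[j E]|E] := crdP R n i; last by apply: agree_ext (ag_cst 0) => g p _; rewrite E.
apply: (@agree_near _ _ _ _ _ 1) => [|g p [_ _ _ [_ H _ _] _]]; last by rewrite mul1r !E.
by apply: (@agree_bounded _ _ _ _ Q) => // g p _ _ [_ _ [_ _ _ _ H] _ _]; rewrite E.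
Qed.

Let ag_eps i : (fun p => crd (eps p) i) ~~ (fun p => crd (eps p) i).
Proof.
have [[j E]|E] := crdP R n i; last by apply: agree_ext (ag_cst 0) => g p _; rewrite E.
by apply: (@agree_bounded _ _ _ _ Q) => // g p _ _ [_ _ [_ _ _ H _] _ _]; rewrite E.
Qed.

Let ag_psi i (f f' : config -> R) : f ~~ f' ->
  (fun p => crd (psiv psi (f p)) i) ~~ (fun p => crd (psiv psi (f' p)) i).
Proof.
move=> ff; have [[j E]|E] := crdP R n i; last by apply: agree_ext (ag_cst 0) => g p _; rewrite E.
by apply: agree_ext (agree_comp_C1 (psi_C1 j) ff) => g p _; rewrite E mxE.
Qed.

Let ag_alphaf_near i :
  (fun p => crd (alphaf (w p)) i) ~~ (fun p => crd (alphaf (w p)) i) ->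
  (fun p => crd (alphaf (w p)) i) ~~ (fun p => crd (alphaf (ws p)) i).
Proof.
move=> H; apply: (@agree_near _ _ _ _ _ 1) => // g p [_ _ _ [_ _ _ K] gy]; rewrite mul1r.
by have [[j E]|E] := crdP R n.-1 i; rewrite !E // subrr normr0 (le_trans _ gy).
Qed.

Let ag_xi_near i :
  (fun p => crd (xi (w p)) i) ~~ (fun p => crd (xi (w p)) i) ->
  (fun p => crd (xi (w p)) i) ~~ (fun p => crd (xi (ws p)) i).
Proof.
move=> H; apply: (@agree_near _ _ _ _ _ 1) => // g p [_ _ _ [K _ _ _] gy]; rewrite mul1r.
by have [[j E]|E] := crdP R n i; rewrite !E // subrr normr0 (le_trans _ gy).
Qed.

Let epsE i p : crd (eps p) i = crd (cf_x p) i - crd (xi (w p)) i - th p * crd (zeta (w p)) i.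
Proof. by rewrite /eps crdD crdN crdD crdZ; ring. Qed.

Let ag_xi1 : (fun p => crd (xi (w p)) 1) ~~ (fun p => crd (xi (ws p)) 1).
Proof.
apply: ag_xi_near.
have H := agreeB (agreeB (agree_l ag_y) (ag_eps 1)) (agreeM ag_th (agree_l (ag_zeta 1))).
by apply: agree_ext H => g p _; rewrite epsE /y; ring.
Qed.

Let ag_alphaf_of i : (i.+1 < n)%N ->
  (fun p => alpha psi k (B p) (w p) (y p) i.+1) ~~ (fun p => alpha psi k (B p) (ws p) (v p) i.+1) ->
  (fun p => crd (alphaf (w p)) i.+1) ~~ (fun p => crd (alphaf (ws p)) i.+1).
Proof.
move=> ni H; apply: ag_alphaf_near.
apply: agree_ext (agreeD (ag_ups0 ni) (agree_l H)) => g p _; by rewrite /upsilon /=; ring.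
Qed.

Let ag_xi_of i : (i.+1 < n)%N ->
  (fun p => crd (alphaf (w p)) i.+1) ~~ (fun p => crd (alphaf (ws p)) i.+1) ->
  (fun p => crd (xi (w p)) i.+2) ~~ (fun p => crd (xi (ws p)) i.+2).
Proof.
move=> ni H; apply: ag_xi_near.
apply: agree_ext (agreeD (ag_z ni) (agree_l H)) => g p _; by rewrite /zcoord /=; ring.
Qed.

Let ag_rho i : (i.+2 <= m)%N -> (fun p => crd (beta_rho (B p)) i.+1) ~~ (fun p => crd (beta_rho (B p)) i.+1).
Proof.
by move=> im; apply: agree_ext (ag_cst (rr i.+2)) => g p [H _ _ _ _]; rewrite /= -(H i.+2).
Qed.

Let ag_c i : (fun p => crd (beta_c (B p)) i) ~~ (fun p => crd (beta_c (B p)) i).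
Proof. exact: (ag_cst (crd (const_mx c) i)). Qed.

(** The original signals are recovered from the error coordinates in order: [alpha_i] and
    [upsilon_(i+1)] give the filter state of index [i + 1], this and [z_(i+1)] give [xi_(i+1)], and
    these give [alpha_(i+1)]. Once a controller state is known to be bounded, [ctrl_close] makes it
    agree with its sample. *)
Lemma agree_alpha i : (i.+1 <= m)%N -> (i.+1 <= n)%N ->
  (fun p => alpha psi k (B p) (w p) (y p) i.+1) ~~ (fun p => alpha psi k (B p) (ws p) (v p) i.+1).
Proof.
elim: i => [|i IH] im ni.
  apply: agreeB.
    by apply: agreeM; [apply: agreeN; exact: ag_c | exact: ag_y].
  by apply: agreeM; [exact: ag_thh | apply: agreeD; [exact: ag_psi ag_y | exact: ag_zeta]].
have A := IH (ltnW im) (ltnW ni).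
have F := ag_alphaf_of ni A; have X := ag_xi_of ni F.
apply: agreeB; first apply: agreeB.
- apply: agreeM; first by apply: agreeN; exact: ag_c.
  by rewrite /zcoord /=; apply: agreeB.
- by apply: agreeM; [exact: ag_cst | apply: agreeB; [exact: ag_y | exact: ag_xi1]].
- by apply: agreeM; [exact: ag_rho | apply: agreeB].
Qed.

Lemma agree_alphaf i : (i.+1 <= m)%N -> (i.+1 < n)%N ->
  (fun p => crd (alphaf (w p)) i.+1) ~~ (fun p => crd (alphaf (ws p)) i.+1).
Proof. by move=> im ni; apply: ag_alphaf_of => //; apply: agree_alpha => //; exact: ltnW. Qed.

Lemma agree_xi i : (i <= m)%N -> (i < n)%N ->
  (fun p => crd (xi (w p)) i.+1) ~~ (fun p => crd (xi (ws p)) i.+1).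
Proof.
by case: i => [|i] im ni; [exact: ag_xi1 | apply: ag_xi_of => //; exact: agree_alphaf].
Qed.

Let agree_zcoord i : (i <= m)%N -> (i < n)%N ->
  (fun p => zcoord (w p) (y p) i.+1) ~~ (fun p => zcoord (ws p) (v p) i.+1).
Proof.
case: i => [|i] im ni; first exact: ag_y.
by rewrite /zcoord /=; apply: agreeB; [exact: agree_xi | exact: agree_alphaf].
Qed.

Let agree_upsilon i : (i.+1 <= m)%N -> (i.+1 < n)%N ->
  (fun p => upsilon psi k (B p) (w p) (y p) i.+2) ~~ (fun p => upsilon psi k (B p) (ws p) (v p) i.+2).
Proof.
move=> im ni; rewrite /upsilon /=; apply: agreeB; first exact: agree_alphaf.
by apply: agree_alpha => //; exact: ltnW.
Qed.

Lemma agree_x i : (i <= m)%N -> (i < n)%N ->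
  (fun p => crd (cf_x p) i.+1) ~~ (fun p => crd (cf_x p) i.+1).
Proof.
move=> im ni.
have H := agreeD (agreeD (ag_eps i.+1) (agree_l (agree_xi im ni))) (agreeM ag_th (agree_l (ag_zeta i.+1))).
by apply: agree_ext H => g p _; rewrite epsE; ring.
Qed.

Let ag_dy : (0 < m)%N -> dy ~~ dy.
Proof.
move=> m0; have H := agreeD (agree_x m0 n_ge2) (agreeM ag_th (ag_psi 1 (agree_l ag_y))).
apply: agree_ext H => g p _; rewrite /dy /dx plant_rateE;
  by have -> : (1 == n)%N = false by rewrite eqn_leq (leqNgt n) n_ge2 andbF.
Qed.

Let ag_dxi_lt i : (i.+1 <= m)%N -> (i.+1 < n)%N -> (fun p => crd (xi (dw p)) i.+1) ~~ (fun p => crd (xi (dw p)) i.+1).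
Proof.
move=> im ni; have X := agree_r (agree_xi im ni).
have H := agreeD (agreeD (agreeM (ag_cst (- crd k i.+1)) (agree_r ag_xi1)) X) (agreeM (agree_r ag_y) (ag_cst (crd k i.+1))).
apply: agree_ext H => g p _; rewrite /dw /= xi_rateE;
  by have -> : (i.+1 == n)%N = false; [rewrite eqn_leq (leqNgt n) ni andbF | rewrite addr0].
Qed.

Let agree_dalphaf i : (i.+2 <= m)%N -> (i.+1 < n)%N ->
  (fun p => crd (alphaf (dw p)) i.+1) ~~
  (fun p => - crd (beta_rho (B p)) i.+1 * upsilon psi k (B p) (w p) (y p) i.+2).
Proof.
move=> im ni; under [X in agree _ X]eq_fun do rewrite /dw /= alphaf_rateE.
by apply: agreeM; [apply/agreeN/ag_rho | apply: agree_sym; exact: agree_upsilon (ltnW im) ni].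
Qed.

Let agree_dthetahat : (fun p => thetahat (dw p)) ~~
  (fun p => y p * (crd (psiv psi (y p)) 1 + crd (zeta (w p)) 2) - thetahat (w p)).
Proof.
apply: agree_sym; apply: agreeB; first by apply: agreeM; [exact: ag_y | apply: agreeD; [exact: ag_psi ag_y | exact: ag_zeta]].
by under [X in agree _ _ X]eq_fun do rewrite mul1r.
Qed.

Let agree_dzeta i : (fun p => crd (zeta (dw p)) i.+1) ~~
  (fun p => crd (Ac k *m zeta (w p) + psiv psi (y p)) i.+1).
Proof.
apply: agree_sym; under [X in agree _ X]eq_fun do rewrite crdD Ac_mulE.
under [X in agree _ _ X]eq_fun do rewrite /dw /= zeta_rateE.
apply: agreeD; last exact: ag_psi ag_y.
by apply: agreeD; [apply: agreeM; [exact: ag_cst|]|]; exact: ag_zeta.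
Qed.

(** The rate of [alpha_(i+1)] reaches one index further, to [xi_(i+2)] and so to the filter state of
    index [i + 2]; but that state is [upsilon_(i+2) + alpha_(i+1)], and only its rate, which does
    not occur here, contains the gain of index [i + 2]. *)
Lemma bounded_dalpha i : (i.+1 <= m)%N -> (i.+1 < n)%N ->
  (fun p => dalpha (B p) (w p) (y p) (dw p) (dy p) i.+1) ~~
  (fun p => dalpha (B p) (w p) (y p) (dw p) (dy p) i.+1).
Proof.
elim: i => [|i IH] im ni.
  have Dy := ag_dy im.
  apply: agreeB; first by apply: agreeM => //; apply/agreeN/ag_c.
  apply: agreeD; apply: agreeM.
  - exact: agree_l agree_dthetahat.
  - by apply: agreeD; [exact: ag_psi (agree_l ag_y) | exact: agree_l (ag_zeta _)].
  - exact: agree_l ag_thh.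
  - apply: agreeD; last exact: agree_l (agree_dzeta _).
    apply: agreeM => //.
    have [Cy [HC]] := agreeP (agree_l ag_y).
    move=> Hy.
    have [C C0 H] := continuous_bounded Cy (psi_C1 (Ordinal (ltnW n_ge2))).2.
    apply: (agree_bounded (C := C)); first exact: ltW.
    by move=> g p g0 g1 Sp; apply: H; exact: Hy Sp.
have Dy := ag_dy (leq_ltn_trans (leq0n _) im).
apply: agreeB; first apply: agreeB.
- apply: agreeM; first by apply/agreeN/ag_c.
  rewrite /zcoord /=; apply: agreeB; first exact: ag_dxi_lt.
  by apply: agree_l; apply: agree_dalphaf; rewrite // ltnW.
- apply: agreeM; first exact: ag_cst.
  by apply: agreeB => //; apply: ag_dxi_lt; rewrite // (leq_ltn_trans _ im).
- apply: agreeM; first exact: ag_rho.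
  apply: agreeB; first by apply: agree_l; apply: agree_dalphaf; rewrite // ltnW.
  by apply: IH; rewrite // ltnW.
Qed.

(** With every filter gain prescribed, the bounds extend to the control input and to complete
    vectors. *)
Hypothesis nm : (n <= m)%N.

Let ag_xi i : (fun p => crd (xi (w p)) i.+1) ~~ (fun p => crd (xi (ws p)) i.+1).
Proof.
have [ni|lt_in] := leqP n i; last by apply: agree_xi => //; apply: leq_trans nm; exact: ltnW.
by apply: agree_ext (ag_cst 0) => g p _; rewrite crd_out.
Qed.

Let ag_x i : (fun p => crd (cf_x p) i.+1) ~~ (fun p => crd (cf_x p) i.+1).
Proof.
have [ni|lt_in] := leqP n i; last by apply: agree_x => //; apply: leq_trans nm; exact: ltnW.
by apply: agree_ext (ag_cst 0) => g p _; rewrite crd_out.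
Qed.

Let ag_alphaf i : (fun p => crd (alphaf (w p)) i.+1) ~~ (fun p => crd (alphaf (ws p)) i.+1).
Proof.
have [ni|lt_in] := leqP n.-1 i; first by apply: agree_ext (ag_cst 0) => g p _; rewrite crd_out.
have ni : (i.+1 < n)%N by rewrite -ltn_predRL.
by apply: agree_alphaf => //; apply: leq_trans nm; exact: ltnW.
Qed.

Lemma agree_control : (fun p => control psi k (B p) (w p) (y p)) ~~
  (fun p => control psi k (B p) (ws p) (v p)).
Proof.
have [i En] : exists i, n = i.+2 by exists n.-2; case: n n_ge2 => [|[]].
have im : (i.+2 <= m)%N by rewrite -En.
have ni : (i.+1 < n)%N by rewrite En.
have H := agreeB (agreeB (agreeM (ag_cst (- crd (const_mx c : 'cV[R]_n) i.+2)) (agree_zcoord (ltnW im) ni))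
  (agreeM (ag_cst (crd k i.+2)) (agreeB ag_y ag_xi1)))
  (agreeM (ag_rho im) (agree_upsilon (ltnW im) ni)).
by apply: agree_ext H => g p _; rewrite (controlE _ _ _ (esym En)).
Qed.

(** The virtual inputs and the control law are designed so that the output injection of the observer
    and the rate of the filter cancel. What remains is the formula of [zdot] at the sampled values,
    which agrees with its value at the current ones. *)
Let agree_dzcoord i : (i < n)%N ->
  (fun p => zcoord (dw p) (dy p) i.+1) ~~ (fun p => zdot (B p) (th p) (cf_x p) (w p) i).
Proof.
move=> ni; case: i ni => [|i] ni.
  (* No sampled value enters the rate of [y], so for this index the two sides are equal. *)
  rewrite /zcoord /=; have Dy := ag_dy (leq_trans (ltnW n_ge2) nm).
  apply: agree_ext Dy => // g p _; rewrite /dy /dx plant_rateE /zdot /= n_ge2.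
  have -> : (1 == n)%N = false by rewrite eqn_leq (leqNgt n) n_ge2 andbF.
  rewrite crdD crdN crdD crdZ /y /upsilon /zcoord /= crd_const ?(ltnW n_ge2) //; ring.
have H : (fun p => - c * zcoord (w p) (y p) i.+2 + (if (i.+2 < n)%N then
    zcoord (w p) (y p) i.+3 + upsilon psi k (B p) (w p) (y p) i.+3 else 0)) ~~
  (fun p => - c * zcoord (ws p) (v p) i.+2 + (if (i.+2 < n)%N then
    zcoord (ws p) (v p) i.+3 + upsilon psi k (B p) (ws p) (v p) i.+3 else 0)).
  have im := leq_trans (ltnW ni) nm.
  apply: agreeD; first by apply: agreeM; [exact: ag_cst | exact: agree_zcoord].
  case: (ltnP i.+2 n) => [ni2|_]; last exact: ag_cst.
  have im2 := leq_trans (ltnW ni2) nm.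
  by apply: agreeD; [exact: agree_zcoord | exact: agree_upsilon].
apply: agree_sym; apply: agree_ext H => g p _; first by rewrite /zdot /= addr0 crd_const // ltnW.
rewrite /dw {3}/zcoord /= xi_rateE alphaf_rateE.
have [ni2|] := ltnP i.+2 n.
  have -> : (i.+2 == n) = false by rewrite eqn_leq (leqNgt n) ni2 andbF.
  rewrite /upsilon /= /zcoord /= crd_const ?(ltnW ni) //; ring.
rewrite leq_eqVlt ltnNge ni orbF => /eqP En.
have -> : (i.+2 == n) = true by rewrite -En eqxx.
have -> : crd (xi (ws p)) i.+3 = 0 by rewrite crd_out // {1}En.
rewrite (controlE _ _ _ (esym En)) /upsilon /= /zcoord /=.
rewrite crd_const // ?(ltnW ni) //; ring.
Qed.

Let agree_deps i : (fun p => (dx p - (xi (dw p) + th p *: zeta (dw p))) i 0) ~~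
  (fun p => (Ac k *m eps p) i 0).
Proof.
(* [F p u t] is the rate of [eps_(i+1)] when the observers are driven by the controller state [u]
   and the output [t]; the input has cancelled. At the current values it is a row of
   [Ac k *m eps]. *)
pose F (p : config) (u : ctrl_state R n) t := crd (cf_x p) i.+2 + crd k i.+1 * crd (xi u) 1 - crd (xi u) i.+2
  - t * crd k i.+1 + th p * (crd k i.+1 * crd (zeta u) 1 - crd (zeta u) i.+2)
  + th p * (crd (psiv psi (y p)) i.+1 - crd (psiv psi t) i.+1).
have H : (fun p => F p (w p) (y p)) ~~ (fun p => F p (ws p) (v p)).
  apply: agreeD; first apply: agreeD; first apply: agreeB; first apply: agreeB; first apply: agreeD.
  - exact: ag_x.
  - by apply: agreeM; [exact: ag_cst | exact: ag_xi1].
  - exact: ag_xi.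
  - by apply: agreeM; [exact: ag_y | exact: ag_cst].
  - by apply: agreeM; [exact: ag_th | apply: agreeB; [apply: agreeM; [exact: ag_cst|]|]; exact: ag_zeta].
  - by apply: agreeM; [exact: ag_th | apply: agreeB; apply: ag_psi; [exact: agree_l ag_y | exact: ag_y]].
apply: agree_sym; apply: agree_ext H => g p _; rewrite /F -[RHS]crd_ord.
  rewrite Ac_mulE !epsE /y; ring.
rewrite crdD crdN crdD crdZ /dx plant_rateE /dw /= xi_rateE zeta_rateE /y.
case: eqP => [En|_]; last by ring.
have -> : crd (cf_x p) i.+2 = 0 by rewrite crd_out // En.
ring.
Qed.

Let agree_dquad (P : 'M[R]_n) (e e' d d' : config -> 'cV[R]_n) :
  (forall i, (fun p => e p i 0) ~~ (fun p => e' p i 0)) ->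
  (forall i, (fun p => d p i 0) ~~ (fun p => d' p i 0)) ->
  (fun p => dquad P (e p) (d p)) ~~ (fun p => dquad P (e' p) (d' p)).
Proof.
move=> ee dd; apply: agree_sum => i; apply: agree_sum => j; apply: agreeD.
  by apply: agreeM => //; apply: agreeM => //; exact: ag_cst.
by apply: agreeM => //; apply: agreeM => //; exact: ag_cst.
Qed.

(** The constant provided by [agree] becomes the coefficient [K] of the sampling error in
    [lyapunov_design], from which the bound on the thresholds is computed. *)
Lemma agree_dlyapunov (P : 'M[R]_n) :
  (fun p => dlyapunov P (B p) (th p) (cf_x p) (w p) (dx p) (dw p)) ~~
  (fun p => dlyapunov_ideal P (B p) (th p) (cf_x p) (w p) (dx p) (dw p)).
Proof.
apply: agreeD; first apply: agreeD; first apply: agreeD; first apply: agreeD.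
- by apply: agree_sum => i; apply: agreeM; [exact: ag_z | exact: agree_dzcoord].
- apply: agree_sum => i.
  have ni : (i.+1 < n)%N by rewrite -ltn_predRL.
  have im := leq_trans ni nm.
  apply: agreeM; first exact: ag_ups0.
  apply: agreeB; last by apply: bounded_dalpha => //; exact: ltnW.
  exact: agree_dalphaf.
- apply: agreeM; first by apply: agreeB; [exact: ag_th | exact: agree_l ag_thh].
  exact: agreeN agree_dthetahat.
- apply: agree_dquad => i; last exact: agree_deps.
  by apply: agree_ext (ag_eps i.+1) => g p _; rewrite crd_ord.
- apply: agree_dquad => i.
    by apply: agree_ext (agree_l (ag_zeta i.+1)) => g p _; rewrite crd_ord.
  by apply: agree_ext (agree_dzeta i) => g p _; rewrite crd_ord.
Qed.

Lemma bounded_signals : exists2 C, 0 < C & forall g p, 0 <= g -> g <= 1 -> box rr m g p ->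
  [/\ forall i, `|cf_x p i 0| <= C, forall i, `|dx p i 0| <= C,
   [/\ forall i, `|xi (w p) i 0| <= C, forall i, `|zeta (w p) i 0| <= C,
      `|thetahat (w p)| <= C & forall i, `|alphaf (w p) i 0| <= C],
   [/\ forall i, `|xi (dw p) i 0| <= C, forall i, `|zeta (dw p) i 0| <= C,
      `|thetahat (dw p)| <= C & forall i, `|alphaf (dw p) i 0| <= C] &
   [/\ `|v p| <= C, `|control psi k (B p) (ws p) (v p)| <= C,
      forall i, (i < n)%N -> `|zcoord (w p) (y p) i.+1| <= C,
      forall i, (i.+1 < n)%N -> `|alpha psi k (B p) (ws p) (v p) i.+1| <= C &
      forall i, (i.+1 < n)%N -> `|upsilon psi k (B p) (ws p) (v p) i.+2| <= C]].
Proof.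
have vec m' (f : config -> 'cV[R]_m') : (forall i, (fun p => crd (f p) i.+1) ~~ (fun p => crd (f p) i.+1)) ->
  exists2 C, 0 < C & forall g p, 0 <= g -> g <= 1 -> box rr m g p -> forall i, `|f p i 0| <= C.
  move=> H; have [C C0 HC] := agreeP (agree_sum (fun i : 'I_m' => agree_norm (H i))).
  exists C => // g p g0 g1 bp i; apply: le_trans (HC g p g0 g1 bp).
  rewrite /= [X in _ <= X]ger0_norm ?sumr_ge0 // (bigD1 i) //= crd_ord lerDl sumr_ge0 //.
have nat_ m' (f : nat -> config -> R) : (forall i, (i < m')%N -> f i ~~ f i) ->
  exists2 C, 0 < C & forall g p, 0 <= g -> g <= 1 -> box rr m g p -> forall i, (i < m')%N -> `|f i p| <= C.
  move=> H; have [C C0 HC] := agreeP (agree_sum (fun i : 'I_m' => agree_norm (H i (ltn_ord i)))).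
  exists C => // g p g0 g1 bp i im; apply: le_trans (HC g p g0 g1 bp).
  rewrite /= [X in _ <= X]ger0_norm ?sumr_ge0 // (bigD1 (Ordinal im)) //= lerDl sumr_ge0 //.
have dxb i : (fun p => crd (dx p) i.+1) ~~ (fun p => crd (dx p) i.+1).
  have [ni|] := eqVneq i.+1 n.
    have H := agreeD (agree_r agree_control) (agreeM ag_th (ag_psi i.+1 (agree_l ag_y))).
    by apply: agree_ext H => g p _; rewrite /dx plant_rateE ni eqxx.
  move=> /negbTE ni.
  have H := agreeD (ag_x i.+1) (agreeM ag_th (ag_psi i.+1 (agree_l ag_y))).
  by apply: agree_ext H => g p _; rewrite /dx plant_rateE ni.
have dxib i : (fun p => crd (xi (dw p)) i.+1) ~~ (fun p => crd (xi (dw p)) i.+1).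
  have H := agreeD (agreeD (agreeD (agreeM (ag_cst (- crd k i.+1)) (agree_r ag_xi1)) (agree_r (ag_xi i.+1)))
     (agreeM (agree_r ag_y) (ag_cst (crd k i.+1)))) (agreeM (agree_r agree_control) (ag_cst (i.+1 == n)%:R)).
  by apply: agree_ext H => g p _; rewrite /dw /= xi_rateE; case: eqP => _; rewrite ?mulr1 ?mulr0.
have dalb i : (fun p => crd (alphaf (dw p)) i.+1) ~~ (fun p => crd (alphaf (dw p)) i.+1).
  have [ni|lt_in] := leqP n.-1 i; first by apply: agree_ext (ag_cst 0) => g p _; rewrite crd_out.
  have ni : (i.+1 < n)%N by rewrite -ltn_predRL.
  by apply: agree_l; apply: agree_dalphaf => //; exact: leq_trans ni nm.
have [C1 C10 H1] := vec _ _ ag_x.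
have [C2 C20 H2] := vec _ _ dxb.
have [C3 C30 H3] := vec _ _ (fun i => agree_l (ag_xi i)).
have [C4 C40 H4] := vec _ _ (fun i => agree_l (ag_zeta i.+1)).
have [C5 C50 H5] := agreeP (agree_l ag_thh).
have [C6 C60 H6] := vec _ _ (fun i => agree_l (ag_alphaf i)).
have [C7 C70 H7] := vec _ _ dxib.
have [C8 C80 H8] := vec _ _ (fun i => agree_l (agree_dzeta i)).
have [C9 C90 H9] := agreeP (agree_l agree_dthetahat).
have [C10' C100 H10] := vec _ _ dalb.
have [D1 D10 J1] := agreeP (agree_r ag_y).
have [D2 D20 J2] := agreeP (agree_r agree_control).
have [D3 D30 J3] := nat_ n _ (fun i => @ag_z i).
have im i : (i < n.-1)%N -> (i.+1 <= m)%N.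
  by move=> lt_in; apply: leq_trans nm; apply: leq_trans lt_in (leq_pred _).
have ni i : (i < n.-1)%N -> (i.+1 < n)%N by rewrite ltn_predRL.
have [D4 D40 J4] := nat_ n.-1 _ (fun i lt_in => agree_r (agree_alpha (im i lt_in) (ltnW (ni i lt_in)))).
have [D5 D50 J5] := nat_ n.-1 _ (fun i lt_in => agree_r (agree_upsilon (im i lt_in) (ni i lt_in))).
exists (Num.max C1 (Num.max C2 (Num.max C3 (Num.max C4 (Num.max C5 (Num.max C6
  (Num.max C7 (Num.max C8 (Num.max C9 (Num.max C10' (Num.max D1 (Num.max D2
  (Num.max D3 (Num.max D4 D5)))))))))))))); first by rewrite lt_max C10.
move=> g p g0 g1 bp; split.
- by move=> i; apply: le_trans (H1 g p g0 g1 bp i) _; rewrite !le_max lexx ?orbT.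
- by move=> i; apply: le_trans (H2 g p g0 g1 bp i) _; rewrite !le_max lexx ?orbT.
- split.
  + by move=> i; apply: le_trans (H3 g p g0 g1 bp i) _; rewrite !le_max lexx ?orbT.
  + by move=> i; apply: le_trans (H4 g p g0 g1 bp i) _; rewrite !le_max lexx ?orbT.
  + by apply: le_trans (H5 g p g0 g1 bp) _; rewrite !le_max lexx ?orbT.
  + by move=> i; apply: le_trans (H6 g p g0 g1 bp i) _; rewrite !le_max lexx ?orbT.
- split.
  + by move=> i; apply: le_trans (H7 g p g0 g1 bp i) _; rewrite !le_max lexx ?orbT.
  + by move=> i; apply: le_trans (H8 g p g0 g1 bp i) _; rewrite !le_max lexx ?orbT.
  + by apply: le_trans (H9 g p g0 g1 bp) _; rewrite !le_max lexx ?orbT.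
  + by move=> i; apply: le_trans (H10 g p g0 g1 bp i) _; rewrite !le_max lexx ?orbT.
- split.
  + by apply: le_trans (J1 g p g0 g1 bp) _; rewrite !le_max lexx ?orbT.
  + by apply: le_trans (J2 g p g0 g1 bp) _; rewrite !le_max lexx ?orbT.
  + by move=> i lt_in; apply: le_trans (J3 g p g0 g1 bp i lt_in) _; rewrite !le_max lexx ?orbT.
  + by move=> i; rewrite -ltn_predRL => lt_in; apply: le_trans (J4 g p g0 g1 bp i lt_in) _; rewrite !le_max lexx ?orbT.
  + by move=> i; rewrite -ltn_predRL => lt_in; apply: le_trans (J5 g p g0 g1 bp i lt_in) _; rewrite !le_max lexx ?orbT.
Qed.

End Agree.
End Box.
End Static.

(** * Choice of the gains *)

Section QuadraticForms.
Context (R : realType) (n : nat).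
Implicit Types (P : 'M[R]_n) (u v e d : 'cV[R]_n).

Lemma quadE P v : quad P v = \sum_i \sum_j v i 0 * (P i j * v j 0).
Proof.
rewrite /quad -mulmxA mxE; apply: eq_bigr => i _.
by rewrite mxE mxE mulr_sumr.
Qed.

Lemma bilinE P u v : (u^T *m P *m v) 0 0 = \sum_i \sum_j u i 0 * (P i j * v j 0).
Proof.
rewrite -mulmxA mxE; apply: eq_bigr => i _.
by rewrite mxE mxE mulr_sumr.
Qed.

Lemma quad_le_sumsq P : exists2 C, 1 <= C & forall v, quad P v <= C * \sum_i v i 0 ^+ 2.
Proof.
exists (1 + \sum_i \sum_j `|P i j|) => [|v].
  by rewrite lerDl sumr_ge0 // => i _; rewrite sumr_ge0.
set s := \sum_i _ ^+ 2.
have s0 : 0 <= s by rewrite sumr_ge0 // => i _; exact: sqr_ge0.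
have vs i : v i 0 ^+ 2 <= s.
  by rewrite /s (bigD1 i) //= lerDl sumr_ge0 // => j _; exact: sqr_ge0.
rewrite mulrDl mul1r mulr_suml quadE -[leLHS]add0r lerD //.
apply: ler_sum => i _; rewrite mulr_suml; apply: ler_sum => j _.
apply: le_trans (ler_norm _) _.
rewrite !normrM mulrCA ler_wpM2l // -normrM.
have [a b] := (vs i, vs j).
have h1 := sqr_ge0 (v i 0 - v j 0); have h2 := sqr_ge0 (v i 0 + v j 0).
by rewrite ler_norml; apply/andP; split; nra.
Qed.

Lemma posdef_quad_ge0 P v : posdef P -> 0 <= quad P v.
Proof.
move=> [_ H]; have [->|/H/ltW//] := eqVneq v 0.
by rewrite quadE big1 // => i _; rewrite big1 // => j _; rewrite !mxE mul0r.
Qed.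

Lemma posdef_unitmx P : posdef P -> P \in unitmx.
Proof.
move=> [PT H]; rewrite -row_free_unit -kermx_eq0; apply/eqP/row_matrixP => i.
rewrite row0; set u := row i _.
have uP : u *m P = 0 by apply/sub_kermxP; exact: row_sub.
apply/eqP/negP => /negP u0; have uT0 : u^T != 0.
  by apply: contraNneq u0 => E; rewrite -[u]trmxK E trmx0.
by have := H _ uT0; rewrite /quad trmxK uP mul0mx mxE ltxx.
Qed.

(* [v i] is the [P]-inner product of [v] with [invmx P e_i]; Cauchy-Schwarz. *)
Lemma posdef_coord_le P : posdef P ->
  exists2 C, 0 < C & forall v i, v i 0 ^+ 2 <= C * quad P v.
Proof.
move=> pP; have [PT H] := pP; have Pu := posdef_unitmx pP.
pose u i : 'cV[R]_n := invmx P *m delta_mx i 0.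
have Puu i : P *m u i = delta_mx i 0 by rewrite mulKVmx.
have inner v i : (v^T *m P *m u i) 0 0 = v i 0.
  rewrite -mulmxA Puu mxE (bigD1 i) //= !mxE !eqxx mulr1 big1 ?addr0 // => j ji.
  by rewrite !mxE (negbTE ji) mulr0.
have inner' v i : ((u i)^T *m P *m v) 0 0 = v i 0.
  have -> : (u i)^T *m P *m v = (v^T *m P *m u i)^T by rewrite !trmx_mul trmxK PT mulmxA.
  by rewrite mxE inner.
have u0 i : 0 < u i i 0.
  have : 0 < quad P (u i).
    apply: H; apply/eqP => E; have := Puu i; rewrite E mulmx0 => /matrixP/(_ i 0).
    by rewrite !mxE !eqxx => /eqP; rewrite eq_sym oner_eq0.
  by rewrite /quad inner.
exists (1 + \sum_i u i i 0) => [|v i].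
  by rewrite ltr_pwDl // sumr_ge0 // => i _; exact: ltW.
have q0 := posdef_quad_ge0 v pP.
apply: (@le_trans _ _ (u i i 0 * quad P v)); last first.
  rewrite ler_wpM2r // (bigD1 i) //= addrCA lerDl addr_ge0 // sumr_ge0 // => j _; exact: ltW.
have := posdef_quad_ge0 (u i i 0 *: v - v i 0 *: u i) pP.
have -> : quad P (u i i 0 *: v - v i 0 *: u i) =
  u i i 0 * (u i i 0 * quad P v - v i 0 ^+ 2).
  have E : (u i i 0 *: v - v i 0 *: u i)^T = u i i 0 *: v^T - v i 0 *: (u i)^T.
    by apply/matrixP => a b; rewrite !mxE.
  rewrite /quad {}E !(mulmxBl, mulmxBr).
  rewrite -!scalemxAl -!scalemxAr.
  have a1 : (u i)^T *m P *m u i = (u i i 0)%:M.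
    by apply/matrixP => a b; rewrite !ord1 inner !mxE eqxx.
  have a2 : (u i)^T *m P *m v = (v i 0)%:M.
    by apply/matrixP => a b; rewrite !ord1 inner' !mxE eqxx.
  have a3 : v^T *m P *m u i = (v i 0)%:M.
    by apply/matrixP => a b; rewrite !ord1 inner !mxE eqxx.
  have {}E : v^T *m P *m v = (quad P v)%:M.
    by apply/matrixP => a b; rewrite !ord1 [RHS]mxE eqxx.
  rewrite a1 a2 a3 E; move: (u i i 0) (v i 0) (quad P v) => a b' c.
  by rewrite !mxE !mulr1n; ring.
by rewrite pmulr_rge0 // subr_ge0.
Qed.

Lemma dquad_bilin P e d : dquad P e d = (d^T *m P *m e) 0 0 + (e^T *m P *m d) 0 0.
Proof.
rewrite !bilinE -big_split; apply: eq_bigr => i _.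
by rewrite -big_split.
Qed.

Lemma dquad_Ac (k : 'cV[R]_n) P e : P *m Ac k + (Ac k)^T *m P = - 1%:M ->
  dquad P e (Ac k *m e) = - \sum_i e i 0 ^+ 2.
Proof.
move=> PL; rewrite dquad_bilin.
have E : (Ac k *m e)^T *m P *m e + e^T *m P *m (Ac k *m e) = - (e^T *m e).
  have -> : - (e^T *m e) = e^T *m (- 1%:M) *m e by rewrite mulmxN mulNmx mulmx1.
  by rewrite -PL trmx_mul mulmxDr mulmxDl !mulmxA addrC.
transitivity ((- (e^T *m e)) 0 0); first by rewrite -E [RHS]mxE.
by rewrite !mxE; congr (- _); apply: eq_bigr => i _; rewrite mxE expr2.
Qed.

Lemma dquadDr P e d d' : dquad P e (d + d') = dquad P e d + dquad P e d'.
Proof.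
rewrite -big_split; apply: eq_bigr => i _; rewrite -big_split; apply: eq_bigr => j _ /=.
by rewrite !mxE; ring.
Qed.

Lemma dquadE P e d : dquad P e d = \sum_i e i 0 * \sum_j (P i j + P j i) * d j 0.
Proof.
rewrite /dquad; under eq_bigr do rewrite big_split /=.
rewrite big_split /= exchange_big /= -big_split; apply: eq_bigr => i _ /=.
rewrite mulr_sumr -big_split; apply: eq_bigr => j _ /=; ring.
Qed.

End QuadraticForms.

Lemma sum_ord_first (R : realType) n (a : R) : (0 < n)%N ->
  \sum_(i < n) (if i == 0%N :> nat then a else 0) = a.
Proof.
move=> n0; rewrite (bigD1 (Ordinal n0)) //= big1 ?addr0 // => i i0.
by rewrite ifN.
Qed.

(** Young's inequality, arranged so that the residue does not depend on [M], hence not on [q]. *)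
Lemma gain_dominates_cross_term (R : realType) (M e S : R) : `|S| <= M -> - (1 + M ^+ 2) * e ^+ 2 + e * S <= - e ^+ 2 + 4^-1.
Proof.
move=> SM; have h1 : e * S <= `|e| * M.
  by apply: le_trans (ler_norm _) _; rewrite normrM ler_wpM2l.
have := sqr_ge0 (M * `|e| - 2^-1).
have -> : (M * `|e| - 2^-1) ^+ 2 = M ^+ 2 * `|e| ^+ 2 - M * `|e| + 4^-1 by field.
by rewrite real_normK ?num_real // mulNr mulrDl mul1r; lra.
Qed.

(** * Decay of the Lyapunov function under recursively chosen gains *)

Section Design.
Context (R : realType) (n : nat) (psi : 'I_n -> R -> R) (k : 'cV[R]_n) (P : 'M[R]_n).
Hypotheses (n_ge2 : (1 < n)%N) (psi_C1 : forall i, C1 (psi i)).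
Hypotheses (P_posdef : posdef P) (P_lyap : P *m Ac k + (Ac k)^T *m P = - 1%:M).

(** [V] is measured in the error coordinates themselves, so [Q] is uniform in [B]. The gains can
    therefore depend on [Q] without circularity. *)
Lemma error_bounded_lyapunov X : exists2 Q, 0 <= Q &
  forall B th x w, lyapunov P (error_of psi k B th x w) <= X ->
  error_bounded psi k B th x w Q.
Proof.
have [C C0 HC] := posdef_coord_le P_posdef.
exists (2 * `|X| + C * `|X| + 1); first by rewrite !addr_ge0 ?mulr_ge0 // ltW.
have sqn (t Y : R) : 0 <= Y -> t ^+ 2 <= Y -> `|t| <= Y + 1.
  move=> Y0; rewrite -real_normK ?num_real //; have := normr_ge0 t; nra.
move=> B th x w; rewrite /lyapunov /=.
set s1 := \sum_i _; set s2 := \sum_i _; set q1 := quad P _; set q2 := quad P _ => V.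
have s10 : 0 <= s1 by rewrite sumr_ge0 // => i _; exact: sqr_ge0.
have s20 : 0 <= s2 by rewrite sumr_ge0 // => i _; exact: sqr_ge0.
have q10 : 0 <= q1 by exact: posdef_quad_ge0.
have q20 : 0 <= q2 by exact: posdef_quad_ge0.
have t0 := sqr_ge0 (th - thetahat w).
have X0 := ler_norm X.
have CX : 0 <= C * `|X| by rewrite mulr_ge0 // ltW.
have X0' := normr_ge0 X.
split.
- move=> i ni; have : zcoord w (crd x 1) i.+1 ^+ 2 <= s1.
    rewrite /s1 (bigD1 (Ordinal ni)) //= mxE lerDl sumr_ge0 // => j _; exact: sqr_ge0.
  by move=> h; apply: le_trans (sqn _ (2 * `|X|) _ _) _; lra.
- move=> i; rewrite -ltn_predRL => ni; have : upsilon psi k B w (crd x 1) i.+2 ^+ 2 <= s2.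
    rewrite /s2 (bigD1 (Ordinal ni)) //= mxE lerDl sumr_ge0 // => j _; exact: sqr_ge0.
  by move=> h; apply: le_trans (sqn _ (2 * `|X|) _ _) _; lra.
- by apply: le_trans (sqn _ (2 * `|X|) _ _) _; lra.
- move=> i; have h := HC (x - (xi w + th *: zeta w)) i.
  have : C * q1 <= C * `|X| by rewrite ler_wpM2l ?(ltW C0) //; lra.
  move=> h'; apply: le_trans (sqn _ (C * `|X|) CX (le_trans h h')) _; lra.
- move=> i; have h := HC (zeta w) i.
  have : C * q2 <= C * `|X| by rewrite ler_wpM2l ?(ltW C0) //; lra.
  move=> h'; apply: le_trans (sqn _ (C * `|X|) CX (le_trans h h')) _; lra.
Qed.

(** [b] is the linear form in [zeta] produced by [psi(0)], and [K] bounds the coefficient of [|y|]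
    in the contribution of [psi(y) - psi(0)]. In [3 * Q + K], the three [Q] account for [z_(i+1)],
    [upsilon_(i+1)] and [eps_2]. *)
Lemma ideal_decay (Q L thb : R) (M : nat -> R) c r th x w dx dw :
  let b i := \sum_j (P i j + P j i) * psi j 0 in
  let K := \sum_(i < n) Q * \sum_j `|P i j + P j i| * L in
  0 <= Q -> 0 <= L ->
  c = 1 + (3 * Q + K) ^+ 2 ->
  (forall i, (i.+1 < n)%N -> crd r i.+1 = 1 + M i ^+ 2) ->
  (forall i, (i.+1 < n)%N ->
     `|dalpha psi k n_ge2 (gains c r) w (crd x 1) dw (crd dx 1) i.+1| <= M i) ->
  `|th| <= thb ->
  (forall i y, `|y| <= Q -> `|psi i y - psi i 0| <= L * `|y|) ->
  error_bounded psi k (gains c r) th x w Q ->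
  dlyapunov_ideal psi k n_ge2 P (gains c r) th x w dx dw <=
    - (\sum_(i < n) zcoord w (crd x 1) i.+1 ^+ 2)
    - (\sum_(i < n.-1) upsilon psi k (gains c r) w (crd x 1) i.+2 ^+ 2)
    - 2^-1 * (th - thetahat w) ^+ 2
    - \sum_i (x - (xi w + th *: zeta w)) i 0 ^+ 2
    - 2^-1 * \sum_i zeta w i 0 ^+ 2
    + (n%:R + 2^-1 * thb ^+ 2 + 2^-1 * \sum_i b i ^+ 2).
Proof.
move=> b K Q0 L0 cE rE dal thle psiL [zQ uQ tQ eQ sQ].
have n0 : (0 < n)%N by exact: ltnW.
set y := crd x 1; set e := x - _; set om := crd (psiv psi y) 1 + crd (zeta w) 2.
have crdQ (v : 'cV[R]_n) i : (forall j, `|v j 0| <= Q) -> `|crd v i| <= Q.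
  by move=> H; have [[j ->]|->] := crdP R n i; rewrite ?normr0.
have K0 : 0 <= K by rewrite sumr_ge0 // => i _; rewrite mulr_ge0 // sumr_ge0 // => j _; rewrite mulr_ge0.
have yQ : `|y| <= Q by exact: (zQ 0%N).
(* The summand [- |y| * K] is set aside here to pay for the last term of [S4]; the term in [theta~]
   is left to cancel in [S3]. *)
have S1 : \sum_(i < n) zcoord w y i.+1 * zdot psi k (gains c r) th x w i <=
    - (\sum_(i < n) zcoord w y i.+1 ^+ 2) + 4^-1 * n%:R + (y * ((th - thetahat w) * om) - `|y| * K).
  have -> : y * ((th - thetahat w) * om) - `|y| * K = \sum_(i < n)
      (if i == 0%N :> nat then y * ((th - thetahat w) * om) - `|y| * K else 0) by rewrite sum_ord_first.
  have -> : 4^-1 * n%:R = \sum_(i < n) (4^-1 : R) by rewrite sumr_const card_ord mulr_natr.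
  rewrite -sumrN -!big_split /=; apply: ler_sum => i _.
  rewrite /zdot -/y -/om /= crd_const //.
  set z := zcoord w y i.+1.
  set S := (if (i.+1 < n)%N then _ else _).
  have SQ : `|S| <= 2 * Q.
    rewrite /S; case: ifP => [ni|_]; last by rewrite normr0; lra.
    by apply: le_trans (ler_normD _ _) _; have := zQ _ ni; have := uQ _ ni; rewrite -/y; lra.
  case: eqP => [i0|_].
    have zy : z = y by rewrite /z i0.
    have E2 : `|crd e 2| <= Q by exact: crdQ.
    (* Written with the sign of [y], the amount set aside is one more cross term with factor
       [z_1]. *)
    have yK : `|y| * K = y * (Num.sg y * K) by rewrite [in LHS]normrEsg; ring.
    have := @gain_dominates_cross_term _ (3 * Q + K) z (S + crd e 2 + Num.sg y * K).
    have -> : `|S + crd e 2 + Num.sg y * K| <= 3 * Q + K.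
      apply: le_trans (ler_normD _ _) _; apply: lerD.
        by apply: le_trans (ler_normD _ _) _; lra.
      by rewrite normrM (ger0_norm K0) ler_piMl // normr_sg; case: eqP.
    move=> /(_ isT); rewrite -cE yK zy; lra.
  have := @gain_dominates_cross_term _ (3 * Q + K) z S; rewrite -cE.
  have -> : `|S| <= 3 * Q + K by lra.
  move=> /(_ isT); lra.
have S2 : \sum_(i < n.-1) upsilon psi k (gains c r) w y i.+2 *
      (- crd (beta_rho (gains c r)) i.+1 * upsilon psi k (gains c r) w y i.+2
       - dalpha psi k n_ge2 (gains c r) w y dw (crd dx 1) i.+1) <=
    - (\sum_(i < n.-1) upsilon psi k (gains c r) w y i.+2 ^+ 2) + 4^-1 * n%:R.
  apply: (@le_trans _ _ (- (\sum_(i < n.-1) upsilon psi k (gains c r) w y i.+2 ^+ 2) + 4^-1 * n.-1%:R)); last first.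
    by rewrite lerD2l ler_wpM2l // ler_nat leq_pred.
  have -> : 4^-1 * n.-1%:R = \sum_(i < n.-1) (4^-1 : R) by rewrite sumr_const card_ord mulr_natr.
  rewrite -sumrN -!big_split [leRHS]/=; apply: ler_sum => i _.
  have ni : (i.+1 < n)%N by rewrite -ltn_predRL.
  set u := upsilon _ _ _ _ _ _; set d := dalpha _ _ _ _ _ _ _ _ _.
  have := @gain_dominates_cross_term _ (M i) u (- d); rewrite normrN => /(_ (dal i ni)).
  by rewrite [crd (beta_rho _) _](rE i ni); lra.
(* The terms in [om] cancel. There remains [theta~ * thetahat], that is [theta~ * (th - theta~)],
   the effect of the leakage [delta = 1] of the adaptive law. *)
have S3 : y * ((th - thetahat w) * om) + (th - thetahat w) * - (y * om - thetahat w) <=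
    - (2^-1 * (th - thetahat w) ^+ 2) + 2^-1 * thb ^+ 2.
  have t2 : th ^+ 2 <= thb ^+ 2.
    by rewrite -(real_normK (num_real th)) ler_sqr // nnegrE // (le_trans _ thle).
  have := sqr_ge0 (thetahat w); nra.
have S4 : dquad P (zeta w) (Ac k *m zeta w + psiv psi y) <=
    - (2^-1 * \sum_i zeta w i 0 ^+ 2) + 2^-1 * (\sum_i b i ^+ 2) + `|y| * K.
  rewrite dquadDr dquad_Ac //.
  have -> : psiv psi y = psiv psi 0 + (psiv psi y - psiv psi 0) by rewrite addrC subrK.
  rewrite dquadDr.
  have h1 : dquad P (zeta w) (psiv psi 0) <= 2^-1 * (\sum_i zeta w i 0 ^+ 2) + 2^-1 * (\sum_i b i ^+ 2).
    rewrite dquadE !mulr_sumr -big_split; apply: ler_sum => i _ /=.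
    have -> : \sum_j (P i j + P j i) * psiv psi 0 j 0 = b i.
      by apply: eq_bigr => j _; rewrite mxE.
    have := sqr_ge0 (zeta w i 0 - b i); nra.
  have h2 : dquad P (zeta w) (psiv psi y - psiv psi 0) <= `|y| * K.
    rewrite dquadE mulr_sumr; apply: ler_sum => i _.
    apply: le_trans (ler_norm _) _; rewrite normrM mulrCA ler_pM //.
    rewrite mulr_sumr; apply: le_trans (ler_norm_sum _ _ _) _; apply: ler_sum => j _.
    rewrite normrM mulrCA ler_wpM2l // !mxE mulrC; exact: psiL.
  by lra.
have S5 := dquad_Ac e P_lyap.
have N : 4^-1 * n%:R + 4^-1 * n%:R <= n%:R :> R by have := ler0n R n; lra.
rewrite /dlyapunov_ideal -/y -/e -/om S5.
lra.
Qed.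

(* [dalpha] of index [i.+1] involves only the filter gains of index at most
   [i.+1], so that the gain of index [i.+2] can be chosen after its bound [M i]. *)
Lemma exists_filter_gains c (thb Q : R) m : 0 <= thb -> 0 <= Q -> (m <= n.-1)%N ->
  exists rr M : nat -> R, (forall i, 0 < rr i) /\
    forall i, (i < m)%N -> rr i.+2 = 1 + M i ^+ 2 /\
      forall g p, 0 <= g -> g <= 1 -> box psi k c thb Q rr i.+1 g p ->
      let B := gains c (cf_rho p) in
      `|dalpha psi k n_ge2 B (cf_w p) (crd (cf_x p) 1)
         (ctrl_rate psi k B (cf_ws p) (cf_v p))
         (crd (plant_rate psi (cf_th p) (cf_x p)
            (control psi k B (cf_ws p) (cf_v p))) 1) i.+1| <= M i.
Proof.
move=> thb0 Q0; elim: m => [|m IH] mn; first by exists (fun=> 1), (fun=> 0).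
have [rr [M [rr0 HM]]] := IH (ltnW mn).
have ni : (m.+1 < n)%N by rewrite -ltn_predRL.
have [C C0 HC] := agreeP (bounded_dalpha k n_ge2 psi_C1 c thb0 Q0 rr (leqnn m.+1) ni).
pose rr' i := if i == m.+2 then 1 + C ^+ 2 else rr i.
pose M' i := if i == m then C else M i.
(* Changing the gain of index [m.+2] leaves intact the boxes that prescribe gains up to [m.+1],
   hence the bounds already obtained. *)
have box_eq i g p : (i <= m.+1)%N -> box psi k c thb Q rr' i g p -> box psi k c thb Q rr i g p.
  move=> im [H1 H2 H3 H4 H5]; split => // j /andP[j1 ji]; rewrite H1 ?j1 // /rr'.
  by rewrite ltn_eqF // ltnS (leq_trans ji im).
exists rr', M'; split.
  by move=> i; rewrite /rr'; case: eqP => // _; rewrite ltr_pwDl // sqr_ge0.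
move=> i; rewrite ltnS leq_eqVlt => /orP[/eqP->|im].
  rewrite /rr' /M' !eqxx; split=> // g p g0 g1 /box_eq => /(_ (leqnn _)) bp.
  exact: HC g p g0 g1 bp.
have [E H] := HM i im; rewrite /rr' /M' !eqSS ltn_eqF //; split=> // g p g0 g1.
by move=> /box_eq-/(_ (leqW im)); exact: H.
Qed.

Theorem lyapunov_design (thb : R) : 0 <= thb -> exists al C0 : R, 0 < al /\
  forall q : R, exists (c : R) (r : 'cV[R]_n.-1) (Q : R), [/\ forall i, 0 < r i 0, 0 <= Q,
    forall th x w, lyapunov P (error_of psi k (gains c r) th x w) <= q + 1 ->
      error_bounded psi k (gains c r) th x w Q &
    exists2 K, 0 < K & forall g p, 0 <= g -> g <= 1 -> cf_rho p = r ->
      box psi k c thb Q (fun i => crd r i.-1) n g p ->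
      dlyapunov psi k n_ge2 P (gains c r) (cf_th p) (cf_x p) (cf_w p)
        (plant_rate psi (cf_th p) (cf_x p) (control psi k (gains c r) (cf_ws p) (cf_v p)))
        (ctrl_rate psi k (gains c r) (cf_ws p) (cf_v p)) <=
      - al * lyapunov P (error_of psi k (gains c r) (cf_th p) (cf_x p) (cf_w p)) + C0 + K * g].
Proof.
move=> thb0; have [pp pp1 Hpp] := quad_le_sumsq P.
pose b i := \sum_j (P i j + P j i) * psi j 0.
(* With this rate, [al * quad P v] is at most half the sum of squares of [v], and half is the
   weakest decay left by [ideal_decay]. Both constants are fixed before [q] and the gains. *)
exists (2 * pp)^-1, (n%:R + 2^-1 * thb ^+ 2 + 2^-1 * \sum_i b i ^+ 2); split.
  by rewrite invr_gt0; lra.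
move=> q; have [Q Q0 HQ] := error_bounded_lyapunov (q + 1).
have [L L0 HL] : exists2 L, 0 <= L & forall i y, `|y| <= Q -> `|psi i y - psi i 0| <= L * `|y|.
  have /choice[Lf HL] : forall i, exists L, 0 < L /\ forall y, `|y| <= Q -> `|psi i y - psi i 0| <= L * `|y|.
    move=> i; have [C C0 H] := C1_lipschitz Q (psi_C1 i); exists C; split=> // y yQ.
    by have := H y 0 yQ; rewrite subr0 normr0; exact.
  have Lf0 i : 0 <= Lf i by apply: ltW; exact: (HL i).1.
  exists (\sum_i Lf i); first by rewrite sumr_ge0.
  move=> i y yQ; apply: le_trans ((HL i).2 y yQ) _; rewrite ler_wpM2r //.
  by rewrite (bigD1 i) //= lerDl sumr_ge0.
pose K := \sum_(i < n) Q * \sum_j `|P i j + P j i| * L.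
pose c := 1 + (3 * Q + K) ^+ 2.
have [rr [M [rr0 HM]]] := exists_filter_gains c thb0 Q0 (leqnn n.-1).
pose r : 'cV[R]_n.-1 := \col_i rr i.+2.
have rE i : (i.+1 < n)%N -> crd r i.+1 = rr i.+2.
  by rewrite -ltn_predRL => ni; rewrite (crd_ord _ (Ordinal ni)) mxE.
exists c, r, Q; split => //; first by move=> i; rewrite mxE.
  by move=> th x w; exact: HQ.
(* The sampling error is estimated only now, since its constant depends on the gains. *)
have [C HC] := agree_dlyapunov k n_ge2 psi_C1 c thb0 Q0 (fun i => crd r i.-1) (leqnn n) P.
exists (`|C| + 1); first by have := normr_ge0 C; lra.
move=> g p g0 g1 pr bp; have [_ _] := HC g p g0 g1 bp; rewrite pr => Cg.
have [H1 H2 H3 H4 H5] := bp.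
have M_ok i : (i.+1 < n)%N -> `|dalpha psi k n_ge2 (gains c r) (cf_w p) (crd (cf_x p) 1)
         (ctrl_rate psi k (gains c r) (cf_ws p) (cf_v p))
         (crd (plant_rate psi (cf_th p) (cf_x p)
            (control psi k (gains c r) (cf_ws p) (cf_v p))) 1) i.+1| <= M i.
  move=> ni; have [_ H] := HM i ltac:(by rewrite ltn_predRL).
  have := H g p g0 g1; rewrite pr; apply; split => // j /andP[j1 ji].
  case: j j1 ji => [|[|j]] // _ ji; rewrite pr rE //.
  exact: leq_trans ji (ltnW ni).
have rho_ok i : (i.+1 < n)%N -> crd r i.+1 = 1 + M i ^+ 2.
  by move=> ni; rewrite rE //; have [-> _] := HM i ltac:(by rewrite ltn_predRL).
have Hb : error_bounded psi k (gains c r) (cf_th p) (cf_x p) (cf_w p) Q by rewrite -pr.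
have D := @ideal_decay Q L thb M c r _ _ _ (plant_rate psi (cf_th p) (cf_x p)
            (control psi k (gains c r) (cf_ws p) (cf_v p))) _ Q0 L0 erefl rho_ok M_ok H2 HL Hb.
move: D Cg; set DI := dlyapunov_ideal _ _ _ _ _ _ _ _ _ _; set DV := dlyapunov _ _ _ _ _ _ _ _ _ _.
move=> D Cg; have DV_le : DV <= DI + C * g.
  by have := ler_norm (DV - DI); move: Cg => /=; lra.
have Cg' : C * g <= (`|C| + 1) * g by rewrite ler_wpM2r //; have := ler_norm C; lra.
rewrite /lyapunov /=.
have h1 := Hpp (cf_x p - (xi (cf_w p) + cf_th p *: zeta (cf_w p))).
have h2 := Hpp (zeta (cf_w p)).
have e1 : \sum_(i < n) (\col_(i0 < n) zcoord (cf_w p) (crd (cf_x p) 1) i0.+1) i 0 ^+ 2 =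
   \sum_(i < n) zcoord (cf_w p) (crd (cf_x p) 1) i.+1 ^+ 2 by apply: eq_bigr => i _; rewrite mxE.
have e2 : \sum_(i < n.-1) (\col_(i0 < n.-1) upsilon psi k (gains c r) (cf_w p) (crd (cf_x p) 1) i0.+2) i 0 ^+ 2 =
   \sum_(i < n.-1) upsilon psi k (gains c r) (cf_w p) (crd (cf_x p) 1) i.+2 ^+ 2 by apply: eq_bigr => i _; rewrite mxE.
rewrite e1 e2; move: D h1 h2; rewrite -/b.
set s1 := \sum_(i < n) _ ^+ 2; set s2 := \sum_(i < n.-1) _.
set s3 := \sum_i _; set s4 := \sum_i (zeta _) _ _ ^+ 2.
set q1 := quad _ _; set q2 := quad _ _; set t := (cf_th p - _) ^+ 2; set bb := \sum_i _.
move=> D h1 h2.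
have s10 : 0 <= s1 by rewrite sumr_ge0 // => i _; exact: sqr_ge0.
have s20 : 0 <= s2 by rewrite sumr_ge0 // => i _; exact: sqr_ge0.
have t0 : 0 <= t by exact: sqr_ge0.
have pp0 : 0 < pp by exact: lt_le_trans pp1.
have a0 : 0 < (2 * pp)^-1 by rewrite invr_gt0 mulr_gt0.
have a1 : (2 * pp)^-1 <= 2^-1 by rewrite invfM ler_piMr ?invr_ge0 // invf_le1.
have ap : (2 * pp)^-1 * pp = 2^-1 by rewrite invfM -mulrA mulVf ?mulr1 // gt_eqF.
set a := (2 * pp)^-1 in a0 a1 ap *.
have u1 : a * q1 <= 2^-1 * s3 by rewrite -ap -mulrA ler_wpM2l // ltW.
have u2 : a * q2 <= 2^-1 * s4 by rewrite -ap -mulrA ler_wpM2l // ltW.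
have s30 : 0 <= s3 by rewrite sumr_ge0 // => i _; exact: sqr_ge0.
have v1 : a * s1 <= 2^-1 * s1 by rewrite ler_wpM2r.
have v2 : a * s2 <= 2^-1 * s2 by rewrite ler_wpM2r.
have v3 : a * t <= 2^-1 * t by rewrite ler_wpM2r.
lra.
Qed.

End Design.

(** * Local existence for the plant *)

Section LocalExistence.
Context (R : realType).
Implicit Types (f G : R -> R).

Lemma clamp_lipschitz (a b r s : R) :
  `|Num.max a (Num.min b r) - Num.max a (Num.min b s)| <= `|r - s|.
Proof.
have := ler_norm (r - s); have := ler_norm (s - r); rewrite (distrC s r) => ? ?.
have h : 0 <= `|r - s| by [].
by case: (leP b r) => h1; case: (leP b s) => h2; case: (leP a _) => h3;
  try case: (leP a _) => h4; rewrite ler_norml; apply/andP; split; lra.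
Qed.

Lemma exists_pos_forall m (Q : 'I_m -> R -> Prop) :
  (forall i d d', 0 < d' -> d' <= d -> Q i d -> Q i d') ->
  (forall i, exists2 d, 0 < d & Q i d) -> exists2 d, 0 < d & forall i, Q i d.
Proof.
move=> Qle H; have /choice[d Hd] : forall i, exists d, 0 < d /\ Q i d.
  by move=> i; have [d d0 Qd] := H i; exists d.
have d0 i : 0 < d i by case: (Hd i).
have Qd i : Q i (d i) by case: (Hd i).
have s0 : 0 <= \sum_i (d i)^-1 by rewrite sumr_ge0 // => i _; rewrite invr_ge0 ltW.
(* A positive number below every [d i], which also makes sense for an empty family. *)
have s1 : 0 < (1 + \sum_i (d i)^-1)^-1 by rewrite invr_gt0; lra.
exists (1 + \sum_i (d i)^-1)^-1 => // i; apply: Qle (Qd i) => //.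
rewrite -[leRHS]invrK lef_pV2 ?posrE ?invr_gt0 //; last lra.
rewrite (bigD1 i) //= addrCA lerDl addr_ge0 // sumr_ge0 // => j _.
by rewrite invr_ge0 ltW.
Qed.

Lemma is_derive_econtinuous (D : set R) f :
  (forall s, D s -> exists l, is_derive s 1 f l) -> econtinuous D f.
Proof.
move=> df s /df[l fl] e e0.
have /differentiable_continuous/cvgrPdist_lt/(_ e e0) : differentiable f s.
  by apply/derivable1_diffP; exact: ex_derive.
move=> /nbhs_ballP[d /= d0 H]; exists d => // r _ rs; rewrite distrC; apply: H.
by rewrite /ball /= distrC.
Qed.

Lemma lipschitz_of_is_derive (a b : R) f (M : R) : 0 <= M ->
  (forall s : R, a <= s -> s <= b -> exists2 l : R, is_derive s 1 f l & `|l| <= M) ->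
  forall r s, a <= r -> r <= b -> a <= s -> s <= b -> `|f s - f r| <= M * `|s - r|.
Proof.
move=> M0 df.
have main r s : a <= r -> r <= s -> s <= b -> `|f s - f r| <= M * (s - r).
  move=> ar rs sb; apply: (@lipschitz_of_derive _ r s) => //.
    apply: is_derive_econtinuous => x /=; rewrite in_itv /= => /andP[rx xs].
    by have [||l fl _] := df x; [lra..|exists l].
  move=> x rx xs; exists 1 => // y xy _ ys; apply: df; lra.
move=> r s ar rb as' sb; have [rs|/ltW sr] := leP r s.
  by rewrite (@ger0_norm _ (s - r)) ?subr_ge0 //; exact: main.
by rewrite distrC [in leRHS]distrC (@ger0_norm _ (r - s)) ?subr_ge0 //; exact: main.
Qed.

(** Integrating over [[a - 2, a + 2]] makes every point at distance at most 1 from [a] interior. *)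
Lemma exists_primitive f (a : R) : continuous f -> exists G : R -> R,
  forall s : R, `|s - a| <= 1 -> is_derive s 1 G (f s).
Proof.
move=> cf; exists (fun x => \int[@lebesgue_measure R]_(t in `[a - 2, x]) f t)%R => s.
rewrite ler_norml => /andP[s1 s2].
have [||||dF F'] := @continuous_FTC1_closed R f (a - 2) s (a + 2).
- lra.
- apply: continuous_compact_integrable; first exact: segment_compact.
  exact: continuous_subspaceT.
- lra.
- exact: cf.
by split; rewrite -?derive1E.
Qed.

Lemma is_derive_shift G (s a b l : R) :
  is_derive s (1 : R) G l -> is_derive s (1 : R) (fun r => a + (G r - b)) l.
Proof.
move=> H.
have := @is_deriveD R _ _ (cst a) (fun r => G r - b) s 1 0 (l - 0) _
  (@is_deriveB R _ _ G (cst b) s 1 l 0 H _).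
by rewrite add0r subr0; exact.
Qed.

(** The intervals of centre [u m] and radius [2 * C / 2 ^+ m] are nested, so the supremum of their
    left ends belongs to all of them. *)
Lemma geometric_limit (u : nat -> R) (C : R) : (forall m, `|u m.+1 - u m| <= C / 2 ^+ m) ->
  exists l, forall m, `|u m - l| <= 2 * C / 2 ^+ m.
Proof.
move=> H.
have p2 m : 0 < 2 ^+ m :> R by rewrite exprn_gt0.
have half m : 2 * C / 2 ^+ m = C / 2 ^+ m + 2 * C / 2 ^+ m.+1.
  by rewrite exprS; field; rewrite lt0r_neq0.
have C0 : 0 <= C by have := H 0%N; rewrite expr0 divr1; exact: le_trans.
have tail0 m : 0 <= 2 * C / 2 ^+ m by rewrite divr_ge0 ?mulr_ge0 // ltW.
have up m j : u m - 2 * C / 2 ^+ m <= u (m + j)%N - 2 * C / 2 ^+ (m + j).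
  elim: j => [|j IH]; first by rewrite addn0.
  apply: le_trans IH _; have := H (m + j)%N; have := half (m + j)%N; rewrite addnS.
  by rewrite ler_norml => -> /andP[? ?]; lra.
have down m j : u (m + j)%N + 2 * C / 2 ^+ (m + j) <= u m + 2 * C / 2 ^+ m.
  elim: j => [|j IH]; first by rewrite addn0.
  apply: le_trans IH; have := H (m + j)%N; have := half (m + j)%N; rewrite addnS.
  by rewrite ler_norml => -> /andP[? ?]; lra.
pose A := [set u m - 2 * C / 2 ^+ m | m in [set: nat]].
have ubA m : ubound A (u m + 2 * C / 2 ^+ m).
  move=> _ [j _ <-]; have h1 := up j m; have h2 := down m j; rewrite addnC in h2.
  have := tail0 (j + m)%N; lra.
have Am m : A (u m - 2 * C / 2 ^+ m) by exists m.
have l1 m : sup A <= u m + 2 * C / 2 ^+ m by apply: ge_sup (ubA m); exists (u 0%N - 2 * C / 2 ^+ 0).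
have l2 m : u m - 2 * C / 2 ^+ m <= sup A.
  by apply: ub_le_sup (Am m); exists (u 0%N + 2 * C / 2 ^+ 0).
exists (sup A) => m; rewrite ler_norml; have := l1 m; have := l2 m => ? ?.
by apply/andP; split; lra.
Qed.

Lemma le_geometric_eq0 (a K : R) : (forall m, `|a| <= K / 2 ^+ m) -> a = 0.
Proof.
move=> H; apply/eqP; rewrite -normr_le0 leNgt; apply/negP => a0.
have := archi_boundP (normr_ge0 (K / a)); set m := Num.Def.archi_bound _ => Km.
have := H m; rewrite ler_pdivlMr ?exprn_gt0 //.
have : m%:R < 2 ^+ m :> R by rewrite -natrX ltr_nat ltn_expl.
have E : K = K / a * a by rewrite divfK // -normr_gt0.
have := ler_norm K; rewrite {2}E normrM => h1 h2 h3.
nra.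
Qed.

(** * Picard iteration for a globally Lipschitz field *)

Section Picard.
Context (n : nat).
Implicit Types (X Y : R -> 'cV[R]_n) (u v : 'cV[R]_n).

Definition vcontinuous X := forall s e, 0 < e ->
  exists2 d, 0 < d & forall r, `|r - s| < d -> forall i, `|X r i 0 - X s i 0| < e.

Lemma vcontinuous_of_coords X :
  (forall i, econtinuous setT (fun r => X r i 0)) -> vcontinuous X.
Proof.
move=> H s e e0.
have [||d d0 Hd] := @exists_pos_forall n
  (fun i d => forall r, `|r - s| < d -> `|X r i 0 - X s i 0| < e).
- by move=> i d d' _ d'd H' r rd; apply: H'; exact: lt_le_trans d'd.
- by move=> i; have [d d0 Hd] := H i s I e e0; exists d => // r; exact: Hd.
- by exists d => // r rs i; exact: Hd.
Qed.

Variables (F : 'cV[R]_n -> 'cV[R]_n) (La : R) (t0 : R) (x0 : 'cV[R]_n).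
Hypothesis La_gt0 : 0 < La.
Hypothesis F_lip : forall u v d, (forall i, `|u i 0 - v i 0| <= d) ->
  forall i, `|F u i 0 - F v i 0| <= La * d.

(** Chosen so that [h * La <= 1/2], which makes an iteration halve the uniform distance, and
    [h <= 1], the radius on which primitives are available. *)
Let h : R := (2 * La + 1)^-1.
Let h_gt0 : 0 < h.
Proof. by rewrite /h invr_gt0; have := La_gt0; lra. Qed.
Let h_le1 : h <= 1.
Proof. have L0 := La_gt0; by rewrite /h invf_le1; lra. Qed.
Let hLa : h * La <= 2^-1.
Proof. have L0 := La_gt0; by rewrite /h mulrC ler_pdivrMr; lra. Qed.

Let clamp s : R := Num.max (t0 - h) (Num.min (t0 + h) s).

Let clamp_id s : `|s - t0| < h -> clamp s = s.
Proof.
rewrite ltr_norml => /andP[s1 s2]; rewrite /clamp.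
by rewrite (min_idPr _) ?(max_idPr _) //; lra.
Qed.

Let clamp_near s : `|clamp s - t0| <= h.
Proof.
rewrite ler_norml /clamp; have h0 := h_gt0; apply/andP; split.
  by have : t0 - h <= Num.max (t0 - h) (Num.min (t0 + h) s); [rewrite le_max lexx | lra].
suff : Num.max (t0 - h) (Num.min (t0 + h) s) <= t0 + h by lra.
by rewrite ge_max ge_min lexx /= andbT; lra.
Qed.

Let clamp_lip r s : `|clamp r - clamp s| <= `|r - s|.
Proof. exact: clamp_lipschitz. Qed.

(* One Picard iteration, frozen outside [[t0 - h, t0 + h]]. *)
Let picard_step X Y := forall i, exists2 G, (forall s, `|s - t0| <= 1 ->
    is_derive s 1 G (F (X s) i 0)) & forall s, Y s i 0 = x0 i 0 + (G (clamp s) - G t0).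

Let vcontinuous_F X i : vcontinuous X -> continuous (fun s => F (X s) i 0).
Proof.
move=> cX s; apply/cvgrPdist_lt => e e0.
have e1 : 0 < e / (2 * La) by rewrite divr_gt0 // mulr_gt0.
have [d d0 H] := cX s _ e1; apply/nbhs_ballP; exists d => //= r rs.
have := @F_lip (X s) (X r) (e / (2 * La)) _ i.
have E : La * (e / (2 * La)) = e / 2 by field; rewrite lt0r_neq0.
rewrite E => /(_ _)/le_lt_trans; apply; last lra.
by move=> j; apply: ltW; rewrite distrC; apply: H; rewrite distrC.
Qed.

(** The continuity of [X] is a premise inside the existential so that [choice] yields an operator
    defined on all functions, which can be iterated. *)
Let exists_step X : exists Y, vcontinuous X -> picard_step X Y /\ vcontinuous Y.
Proof.
have [cX|ncX] := pselect (vcontinuous X); last by exists X.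
have /choice[G HG] : forall i, exists G, forall s, `|s - t0| <= 1 -> is_derive s 1 G (F (X s) i 0).
  by move=> i; apply: (@exists_primitive (fun s => F (X s) i 0)); exact: vcontinuous_F.
exists (fun s => \col_i (x0 i 0 + (G i (clamp s) - G i t0))) => _; split.
  by move=> i; exists (G i); [exact: HG | move=> s; rewrite mxE].
apply: vcontinuous_of_coords => i s _ e e0.
have cG : econtinuous [set s | `|s - t0| <= 1] (G i).
  by apply: is_derive_econtinuous => r /HG H; exists (F (X r) i 0).
have cl r : `|clamp r - t0| <= 1 by exact: le_trans h_le1.
have [d d0 Hd] := cG (clamp s) (cl s) e e0; exists d => // r _ rs.
rewrite !mxE; have := Hd (clamp r) (cl r) (le_lt_trans (clamp_lip _ _) rs).
by congr (`|_| < _); ring.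
Qed.

Let step_contraction X X' Y Y' d : picard_step X Y -> picard_step X' Y' ->
  (forall s i, `|X s i 0 - X' s i 0| <= d) ->
  forall s i, `|Y s i 0 - Y' s i 0| <= d / 2.
Proof.
move=> XY XY' H s i; have [G HG ->] := XY i; have [G' HG' ->] := XY' i.
have d0 : 0 <= d by apply: le_trans (H s i).
have L0 : 0 <= La * d by rewrite mulr_ge0 // ltW.
have [h1 h2] : t0 - 1 <= clamp s /\ clamp s <= t0 + 1.
  have := le_trans (clamp_near s) h_le1; rewrite ler_norml => /andP[? ?]; split; lra.
have := @lipschitz_of_is_derive (t0 - 1) (t0 + 1) (fun r => G r - G' r) (La * d) L0 _ t0 (clamp s).
move=> /(_ _ _ _ h1 h2) K.
have {}K : `|(G (clamp s) - G' (clamp s)) - (G t0 - G' t0)| <= La * d * `|clamp s - t0|.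
  apply: K; [|lra|lra] => r r1 r2.
  have rt : `|r - t0| <= 1 by rewrite ler_norml; apply/andP; split; lra.
  exists (F (X r) i 0 - F (X' r) i 0); last exact: F_lip.
  by apply: is_deriveB; [exact: HG | exact: HG'].
have -> : x0 i 0 + (G (clamp s) - G t0) - (x0 i 0 + (G' (clamp s) - G' t0)) =
  (G (clamp s) - G' (clamp s)) - (G t0 - G' t0) by ring.
apply: le_trans K _; apply: (@le_trans _ _ (La * d * h)).
  by rewrite ler_wpM2l.
have hd : h * La * d <= 2^-1 * d by rewrite ler_wpM2r.
have -> : La * d * h = h * La * d by ring.
by move: hd; rewrite [2^-1 * d]mulrC.
Qed.

Lemma picard : exists2 h', 0 < h' & exists X, [/\ X t0 = x0, vcontinuous X &
  forall s, `|s - t0| < h' -> forall i, is_derive s 1 (fun r => X r i 0) (F (X s) i 0)].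
Proof.
exists h => //; have /choice[T HT] := exists_step.
pose X m := iter m T (fun=> x0).
have cX m : vcontinuous (X m).
  elim: m => [|m IH]; first by move=> s e e0; exists 1 => // r _ i; rewrite subrr normr0.
  exact: (HT _ IH).2.
have sX m : picard_step (X m) (X m.+1) := (HT _ (cX m)).1.
pose C := \sum_i `|F x0 i 0|.
have C0 : 0 <= C by rewrite sumr_ge0.
have HC i : `|F x0 i 0| <= C by rewrite /C (bigD1 i) //= lerDl sumr_ge0.
have X01 s i : `|X 1%N s i 0 - X 0%N s i 0| <= C.
  have [G HG ->] := sX 0%N i; rewrite /= addrAC subrr add0r.
  have := le_trans (clamp_near s) h_le1; rewrite ler_norml => /andP[? ?].
  apply: le_trans (@lipschitz_of_is_derive (t0 - 1) (t0 + 1) G C C0 _ t0 (clamp s) _ _ _ _) _; [|lra..|].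
    move=> r r1 r2; exists (F x0 i 0) => //; apply: HG.
    by rewrite ler_norml; apply/andP; split; lra.
  by rewrite ler_piMr // (le_trans (clamp_near s)).
have Xm m s i : `|X m.+1 s i 0 - X m s i 0| <= C / 2 ^+ m.
  elim: m s i => [|m IH] s i; first by rewrite expr0 divr1.
  have := step_contraction (sX m.+1) (sX m) IH s i.
  by rewrite exprSr invfM mulrA.
have /choice[l Hl] : forall s, exists l : 'cV[R]_n, forall m i, `|X m s i 0 - l i 0| <= 2 * C / 2 ^+ m.
  move=> s; have /choice[l Hl] : forall i, exists l, forall m, `|X m s i 0 - l| <= 2 * C / 2 ^+ m.
    by move=> i; apply: geometric_limit => m; exact: Xm.
  by exists (\col_i l i) => m i; rewrite mxE.
have cl : vcontinuous l.
  move=> s e e0.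
  have [m Hm] : exists m, 2 * C / 2 ^+ m < e / 3.
    apply: contrapT => H; have : e / 3 = 0.
      apply: (@le_geometric_eq0 _ (2 * C)) => m; rewrite ger0_norm; last lra.
      by rewrite leNgt; apply/negP => Hm; apply: H; exists m.
    by lra.
  have e3 : 0 < e / 3 by lra.
  have [d d0 Hd] := cX m s _ e3; exists d => // r rs i.
  have := Hd r rs i; have := Hl s m i; have := Hl r m i; rewrite distrC => a b c.
  have -> : l r i 0 - l s i 0 = (l r i 0 - X m r i 0) + (X m r i 0 - X m s i 0) + (X m s i 0 - l s i 0) by ring.
  apply: le_lt_trans (ler_normD _ _) _.
  have := ler_normD (l r i 0 - X m r i 0) (X m r i 0 - X m s i 0); lra.
have [sl _] := HT l cl; set Y := T l in sl.
(* The limit is a fixed point: [l] and its image [Y] are both within [C / 2 ^+ m] of the iterate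
   [X m.+1], for every [m]. *)
have lY s i : l s i 0 = Y s i 0.
  apply/eqP; rewrite -subr_eq0; apply/eqP/(@le_geometric_eq0 _ (2 * C)) => m.
  have a := Hl s m.+1 i; have b := step_contraction (sX m) sl (fun s i => Hl s m i) s i.
  have -> : l s i 0 - Y s i 0 = - (X m.+1 s i 0 - l s i 0) + (X m.+1 s i 0 - Y s i 0) by ring.
  apply: le_trans (ler_normD _ _) _; rewrite normrN.
  move: a; rewrite exprSr invfM mulrA; lra.
exists l; split => //.
  apply/matrixP => i j; rewrite !ord1 lY; have [G _ ->] := sl i.
  by rewrite clamp_id ?subrr ?normr0 // addr0.
move=> s sh i; have [G HG YE] := sl i.
have dG : is_derive s 1 (fun r => x0 i 0 + (G r - G t0)) (F (l s) i 0).
  by apply/is_derive_shift/HG/ltW; exact: lt_le_trans h_le1.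
apply: near_eq_is_derive dG.
apply/nbhs_ballP; exists (h - `|s - t0|) => /=; first by rewrite subr_gt0.
move=> r; rewrite /ball /= => rs; rewrite lY YE clamp_id //.
have := ler_normD (r - s) (s - t0); rewrite addrA subrK distrC in rs *; lra.
Qed.

End Picard.

(** The [psi_i] are only locally Lipschitz. Saturating their argument at [K], one more than the
    initial [|y|], gives a globally Lipschitz field, and by continuity the saturation is inactive
    near [t0]. *)
Lemma plant_local_existence n (psi : 'I_n -> R -> R) th u t0 (x0 : 'cV[R]_n) :
  (forall i, C1 (psi i)) ->
  exists2 h, 0 < h & exists X : R -> 'cV[R]_n, [/\ X t0 = x0, vcontinuous X &
    forall s, `|s - t0| < h -> cderive X s (plant_rate psi th (X s) u)].
Proof.
move=> psi_C1; pose K : R := `|crd x0 1| + 1.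
have K0 : 0 < K by rewrite /K; have := normr_ge0 (crd x0 1); lra.
pose sat y : R := Num.max (- K) (Num.min K y).
have sat_id y : `|y| <= K -> sat y = y.
  by rewrite ler_norml => /andP[a b]; rewrite /sat (min_idPr _) ?(max_idPr _).
have satK y : `|sat y| <= K.
  rewrite ler_norml /sat le_max lexx /= ge_max ge_min lexx andbT; lra.
have sat_lip y y' : `|sat y - sat y'| <= `|y - y'| by exact: clamp_lipschitz.
have /choice[L HL] : forall i, exists L, 0 < L /\ forall y y', `|sat y| <= K -> `|sat y'| <= K ->
    `|psi i (sat y) - psi i (sat y')| <= L * `|sat y - sat y'|.
  by move=> i; have [L L0 H] := C1_lipschitz K (psi_C1 i); exists L; split => // y y'; exact: H.
pose psc i y := psi i (sat y).
pose La := 1 + \sum_i `|th| * L i.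
have L0 i : 0 <= L i by apply/ltW/(HL i).1.
have La0 : 0 < La by rewrite ltr_pwDl // sumr_ge0 // => i _; rewrite mulr_ge0.
have [|h h0 [X [X0 cX dX]]] := @picard n (fun v => plant_rate psc th v u) La t0 x0 La0.
  move=> v v' d H i; have d0 : 0 <= d by apply: le_trans (H i).
  have crdd j : `|crd v j - crd v' j| <= d.
    by have [[j0 E]|E] := crdP R n j; rewrite !E ?subrr ?normr0.
  rewrite !mxE; apply: (@le_trans _ _ (d + `|th| * L i * d)); last first.
    rewrite mulrDl mul1r lerD2l ler_wpM2r // (bigD1 i) //= lerDl sumr_ge0 // => j _.
    by rewrite mulr_ge0.
  rewrite opprD addrACA; apply: le_trans (ler_normD _ _) _; apply: lerD.
    by case: ifP; rewrite ?subrr ?normr0.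
  rewrite -mulrBr normrM -mulrA ler_wpM2l //.
  apply: le_trans ((HL i).2 _ _ (satK _) (satK _)) _; rewrite ler_wpM2l //.
  exact: le_trans (sat_lip _ _) _.
have [d d0 Hd] := cX t0 1 ltr01.
exists (Num.min h d); first by rewrite lt_min h0.
exists X; split => // s; rewrite lt_min => /andP[sh sd] i.
suff <- : plant_rate psc th (X s) u = plant_rate psi th (X s) u by exact: dX.
apply/matrixP => a b; rewrite !mxE /psc sat_id //.
have [[j E]|->] := crdP R n 1; last by rewrite normr0 ltW.
have := Hd s sd j; rewrite X0 /K !E.
have := ler_normD (X s j 0 - x0 j 0) (x0 j 0); rewrite subrK; lra.
Qed.

End LocalExistence.

(** * Event times and derivative of the Lyapunov function *)

Section Events.
Context (R : realType).
Variables (t0 : R) (life : set R) (times : nat -> \bar R) (trig : R -> R -> Prop).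

(** Common form of the two triggering laws: [trig s r] compares the signals at time [s] with those
    at the sampling instant [r]. *)
Definition events : Prop :=
  times 0 = t0%:E /\
  forall i, times i.+1 = ereal_inf [set s%:E | s in
    [set s | [/\ life s, (times i < s%:E)%E & trig s (fine (times i))]]].

Hypothesis ev : events.

Lemma events_leS i : (times i <= times i.+1)%E.
Proof.
by rewrite ev.2; apply: le_ereal_inf_tmp => _ [s [_ /ltW ? _] <-].
Qed.

Lemma events_le i j : (i <= j)%N -> (times i <= times j)%E.
Proof.
move=> /subnK <-; by elim: (j - i)%N => // m IH; apply: le_trans IH (events_leS _).
Qed.

Lemma events_ge i : (t0%:E <= times i)%E.
Proof. by rewrite -ev.1; exact: events_le. Qed.

Lemma events_silent i s : life s -> (times i < s%:E)%E -> (s%:E < times i.+1)%E ->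
  ~ trig s (fine (times i)).
Proof.
move=> ls is_ si H; move: si; rewrite ltNge => /negP; apply.
by rewrite ev.2; apply: ereal_inf_lbound; exists s.
Qed.

Lemma events_real i s : (times i <= s%:E)%E ->
  [/\ times i = (fine (times i))%:E, t0 <= fine (times i) & fine (times i) <= s].
Proof.
by move=> si; have := events_ge i; case: (times i) si => [r| |] //=.
Qed.

Lemma events_lt i j s : (times i <= s%:E)%E -> (s%:E < times j.+1)%E -> (i <= j)%N.
Proof.
move=> is_ sj; rewrite leqNgt; apply/negP => ij.
by have := le_lt_trans (le_trans (events_le ij) is_) sj; rewrite ltxx.
Qed.

Lemma events_unique i j s : (times i <= s%:E)%E -> (s%:E < times i.+1)%E ->
  (times j <= s%:E)%E -> (s%:E < times j.+1)%E -> i = j.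
Proof.
move=> a b c d; apply/eqP.
by rewrite eqn_leq (events_lt a d) (events_lt c b).
Qed.

Lemma events_right i s : (s%:E < times i.+1)%E ->
  exists2 h, 0 < h & forall r, r < s + h -> (r%:E < times i.+1)%E.
Proof.
case: (times i.+1) => [r| |] //; last by exists 1 => // r _; rewrite ltry.
rewrite lte_fin => sr; exists (r - s); first by rewrite subr_gt0.
by move=> x; rewrite lte_fin; lra.
Qed.

Lemma events_dwell w : (forall s, life s -> t0 <= s) ->
  (forall r s, life s -> t0 <= r -> r <= s -> life r) ->
  (forall r s, life r -> life s -> r < s -> trig s r -> r + w <= s) ->
  forall i, (times i + w%:E <= times i.+1)%E.
Proof.
move=> life_ge life_down H i; rewrite ev.2.
apply: le_ereal_inf_tmp => _ [s [ls is_ ts] <-].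
have [E t0i si] := events_real (ltW is_).
rewrite E -EFinD lee_fin; apply: H => //; first exact: life_down ls t0i si.
by move: is_; rewrite E lte_fin.
Qed.

End Events.

Section Continuity.
Context (R : realType) (D : set R).
Implicit Types f g : R -> R.

Lemma within_continuousD f g : {within D, continuous f} ->
  {within D, continuous g} -> {within D, continuous (fun x => f x + g x)}.
Proof. by move=> cf cg x; apply: cvgD; [exact: cf | exact: cg]. Qed.

Lemma within_continuousN f : {within D, continuous f} ->
  {within D, continuous (fun x => - f x)}.
Proof. by move=> cf x; apply: cvgN; exact: cf. Qed.

Lemma within_continuousB f g : {within D, continuous f} ->
  {within D, continuous g} -> {within D, continuous (fun x => f x - g x)}.
Proof. by move=> cf cg; apply: within_continuousD => //; exact: within_continuousN. Qed.

Lemma within_continuousM f g : {within D, continuous f} ->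
  {within D, continuous g} -> {within D, continuous (fun x => f x * g x)}.
Proof. by move=> cf cg x; apply: cvgM; [exact: cf | exact: cg]. Qed.

Lemma within_continuous_cst (a : R) : {within D, continuous (fun=> a)}.
Proof. by move=> x; exact: cvg_cst. Qed.

Lemma within_continuous_sum m (F : 'I_m -> R -> R) :
  (forall i, {within D, continuous (F i)}) ->
  {within D, continuous (fun x => \sum_i F i x)}.
Proof.
elim: m F => [|m IH] F cF.
  under eq_fun do rewrite big_ord0; exact: within_continuous_cst.
under eq_fun do rewrite big_ord_recl.
by apply: within_continuousD => //; apply: IH => i.
Qed.

Lemma within_continuous_comp f g : continuous g -> {within D, continuous f} ->
  {within D, continuous (fun x => g (f x))}.
Proof. by move=> cg cf x; apply: continuous_comp; [exact: cf | exact: cg]. Qed.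

End Continuity.

Section Derivatives.
Context (R : realType) (s : R).
Implicit Types (f g : R -> R) (a b : R).
Local Notation D f a := (is_derive s (1 : R) f a).

Lemma is_derive_val_eq f a b : a = b -> D f a -> D f b.
Proof. by move=> ->. Qed.

Lemma is_derive_addf f g a b : D f a -> D g b -> D (fun x => f x + g x) (a + b).
Proof. exact: is_deriveD. Qed.

Lemma is_derive_subf f g a b : D f a -> D g b -> D (fun x => f x - g x) (a - b).
Proof. exact: is_deriveB. Qed.

Lemma is_derive_mulf f g a b : D f a -> D g b -> D (fun x => f x * g x) (a * g s + f s * b).
Proof.
move=> fa gb; apply: is_derive_val_eq (is_deriveM fa gb); rewrite /GRing.scale /=; ring.
Qed.

Lemma is_derive_cstf (c : R) : D (fun=> c) 0.
Proof. exact: is_derive_cst. Qed.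

Lemma is_derive_scalef (c : R) f a : D f a -> D (fun x => c * f x) (c * a).
Proof. by move=> fa; have := is_derive_mulf (is_derive_cstf c) fa; rewrite mul0r add0r. Qed.

Lemma is_derive_sqrf f a : D f a -> D (fun x => f x ^+ 2) (2 * (f s * a)).
Proof.
move=> fa; under eq_fun do rewrite expr2.
by apply: is_derive_val_eq (is_derive_mulf fa fa); ring.
Qed.

Lemma is_derive_sumf m (F : 'I_m -> R -> R) (dF : 'I_m -> R) :
  (forall i, D (F i) (dF i)) -> D (fun x => \sum_i F i x) (\sum_i dF i).
Proof.
elim: m F dF => [|m IH] F dF H.
  by under eq_fun do rewrite big_ord0; rewrite big_ord0; exact: is_derive_cstf.
under eq_fun do rewrite big_ord_recl; rewrite big_ord_recl.
by apply: is_derive_addf => //; apply: IH => i.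
Qed.

Lemma is_derive_compf f g a b : D f a -> is_derive (f s) (1 : R) g b -> D (fun x => g (f x)) (b * a).
Proof. by move=> fa gb; exact: is_derive1_comp. Qed.

Lemma is_derive_crd m (X : R -> 'cV[R]_m) dx i : cderive X s dx -> D (fun r => crd (X r) i) (crd dx i).
Proof.
move=> H; have [[j E]|E] := crdP R m i.
  by under eq_fun do rewrite E; rewrite E; exact: H.
by under eq_fun do rewrite E; rewrite E; exact: is_derive_cstf.
Qed.

End Derivatives.

(** * Continuity and derivative of [V] along a trajectory *)

Section LyapunovAlongTrajectory.
Context (R : realType) (n : nat) (psi : 'I_n -> R -> R) (k : 'cV[R]_n) (P : 'M[R]_n).
Hypotheses (n_ge2 : (1 < n)%N) (psi_C1 : forall i, C1 (psi i)).
Variables (B : parameters R n) (th : R).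
Variables (X : R -> 'cV[R]_n) (W : R -> ctrl_state R n).

Let psiv1 y : crd (psiv psi y) 1 = psi (Ordinal (ltnW n_ge2)) y.
Proof. by rewrite (crd_ord _ (Ordinal (ltnW n_ge2))) mxE. Qed.

Lemma lyapunovE x w : lyapunov P (error_of psi k B th x w) =
  2^-1 * (\sum_(i < n) zcoord w (crd x 1) i.+1 ^+ 2)
  + 2^-1 * (\sum_(i < n.-1) upsilon psi k B w (crd x 1) i.+2 ^+ 2)
  + 2^-1 * (th - thetahat w) ^+ 2
  + quad P (x - (xi w + th *: zeta w)) + quad P (zeta w).
Proof.
rewrite /lyapunov /=; congr (_ * _ + _ * _ + _ + _ + _).
  by apply: eq_bigr => i _; rewrite mxE.
by apply: eq_bigr => i _; rewrite mxE.
Qed.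

Section AtTime.
Variables (s : R) (dx : 'cV[R]_n) (dw : ctrl_state R n).
Hypotheses (dX : cderive X s dx) (dxi : cderive (fun r => xi (W r)) s (xi dw))
  (dzeta : cderive (fun r => zeta (W r)) s (zeta dw))
  (dth : is_derive s (1 : R) (fun r => thetahat (W r)) (thetahat dw))
  (dalf : cderive (fun r => alphaf (W r)) s (alphaf dw)).

Let y r := crd (X r) 1.
Let dy := crd dx 1.

Let is_derive_zcoord i :
  is_derive s (1 : R) (fun r => zcoord (W r) (y r) i) (zcoord dw dy i).
Proof.
rewrite /zcoord; case: (i == 1%N); first exact: is_derive_crd.
by apply: is_derive_subf; apply: is_derive_crd.
Qed.

Let is_derive_alpha i : is_derive s (1 : R) (fun r => alpha psi k B (W r) (y r) i)
  (dalpha psi k n_ge2 B (W s) (y s) dw dy i).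
Proof.
elim: i => [|[|i] IH]; first exact: is_derive_cstf.
  apply: is_derive_subf; first by apply: is_derive_scalef; exact: is_derive_crd.
  have dpsi : is_derive s (1 : R) (fun r => crd (psiv psi (y r)) 1)
      (derive1 (psi (Ordinal (ltnW n_ge2))) (y s) * dy).
    under eq_fun do rewrite psiv1.
    by apply: is_derive_compf; [exact: is_derive_crd | exact: C1_is_derive].
  exact: is_derive_mulf dth (is_derive_addf dpsi (is_derive_crd 2 dzeta)).
apply: is_derive_subf; first apply: is_derive_subf.
- by apply: is_derive_scalef; exact: is_derive_zcoord.
- by apply: is_derive_scalef; apply: is_derive_subf; [exact: is_derive_crd | exact: is_derive_crd dxi].
- by apply: is_derive_scalef; apply: is_derive_subf; exact: is_derive_crd dalf.
Qed.

Let is_derive_quad (E : R -> 'cV[R]_n) de : cderive E s de ->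
  is_derive s (1 : R) (fun r => quad P (E r)) (dquad P (E s) de).
Proof.
move=> dE; under eq_fun do rewrite quadE.
apply: is_derive_sumf => i; apply: is_derive_sumf => j.
by apply: is_derive_mulf; [exact: dE | apply: is_derive_scalef; exact: dE].
Qed.

Lemma is_derive_lyapunov :
  is_derive s (1 : R) (fun r => lyapunov P (error_of psi k B th (X r) (W r)))
    (dlyapunov psi k n_ge2 P B th (X s) (W s) dx dw).
Proof.
under eq_fun do rewrite lyapunovE.
have half a : 2^-1 * (2 * a) = a :> R by rewrite mulrA mulVf ?mul1r.
apply: is_derive_addf; first apply: is_derive_addf; first apply: is_derive_addf; first apply: is_derive_addf.
- apply: is_derive_val_eq (is_derive_scalef 2^-1 (is_derive_sumf (fun i : 'I_n => is_derive_sqrf (is_derive_zcoord i.+1)))).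
  by rewrite -mulr_sumr half.
- have dups (i : 'I_n.-1) : is_derive s (1 : R) (fun r => upsilon psi k B (W r) (y r) i.+2)
      (crd (alphaf dw) i.+1 - dalpha psi k n_ge2 B (W s) (y s) dw dy i.+1).
    by apply: is_derive_subf; [exact: is_derive_crd dalf | exact: is_derive_alpha].
  apply: is_derive_val_eq (is_derive_scalef 2^-1 (is_derive_sumf (fun i : 'I_n.-1 => is_derive_sqrf (dups i)))).
  by rewrite -mulr_sumr half.
- apply: is_derive_val_eq (is_derive_scalef 2^-1 (is_derive_sqrf (is_derive_subf (is_derive_cstf s th) dth))).
  by rewrite half sub0r.
- apply: is_derive_quad => i.
  have := is_derive_subf (dX i) (is_derive_addf (dxi i) (is_derive_scalef th (dzeta i))).
  rewrite !mxE; apply: (near_eq_is_derive); near=> r.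
  by rewrite !mxE.
- exact: is_derive_quad.
Unshelve. all: end_near. Qed.

End AtTime.

Section OnSet.
Variable D : set R.
Hypotheses (cX : ccontinuous D X) (cxi : ccontinuous D (fun r => xi (W r)))
  (czeta : ccontinuous D (fun r => zeta (W r)))
  (cth : {within D, continuous (fun r => thetahat (W r))})
  (calf : ccontinuous D (fun r => alphaf (W r))).

Let ccrd m (Y : R -> 'cV[R]_m) i : ccontinuous D Y -> {within D, continuous (fun r => crd (Y r) i)}.
Proof.
move=> H; have [[j E]|E] := crdP R m i.
  by under eq_fun do rewrite E; exact: H.
by under eq_fun do rewrite E; exact: within_continuous_cst.
Qed.

Let y r := crd (X r) 1.

Let cz i : {within D, continuous (fun r => zcoord (W r) (y r) i)}.
Proof.
rewrite /zcoord; case: (i == 1%N); first exact: ccrd.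
by apply: within_continuousB; apply: ccrd.
Qed.

Let ccst (a : R) := @within_continuous_cst R D a.

Let calpha i : {within D, continuous (fun r => alpha psi k B (W r) (y r) i)}.
Proof.
elim: i => [|[|i] IH]; first exact: ccst.
  apply: within_continuousB.
    by apply: within_continuousM; [exact: ccst | exact: ccrd].
  apply: within_continuousM => //; apply: within_continuousD; last exact: ccrd.
  under eq_fun do rewrite psiv1.
  apply: within_continuous_comp; last exact: ccrd.
  by move=> u; apply: differentiable_continuous; apply/derivable1_diffP; exact: (psi_C1 _).1.
apply: within_continuousB; first apply: within_continuousB.
- by apply: within_continuousM; [exact: ccst | exact: cz].
- apply: within_continuousM; first exact: ccst.
  by apply: within_continuousB; [exact: ccrd | exact: ccrd cxi].
- apply: within_continuousM; first exact: ccst.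
  by apply: within_continuousB; [exact: ccrd calf | exact: IH].
Qed.

Let cquad (E : R -> 'cV[R]_n) : ccontinuous D E -> {within D, continuous (fun r => quad P (E r))}.
Proof.
move=> cE; under eq_fun do rewrite quadE.
apply: within_continuous_sum => i; apply: within_continuous_sum => j.
apply: within_continuousM; first exact: cE.
by apply: within_continuousM; [exact: ccst | exact: cE].
Qed.

Let csqr (f : R -> R) : {within D, continuous f} -> {within D, continuous (fun r => f r ^+ 2)}.
Proof. by move=> cf; under eq_fun do rewrite expr2; exact: within_continuousM. Qed.

Lemma continuous_lyapunov :
  {within D, continuous (fun r => lyapunov P (error_of psi k B th (X r) (W r)))}.
Proof.
under eq_fun do rewrite lyapunovE.
have cZ (a : R) (f : R -> R) : {within D, continuous f} -> {within D, continuous (fun r => a * f r)}.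
  by move=> cf; apply: within_continuousM => //; exact: ccst.
apply: within_continuousD; first apply: within_continuousD; first apply: within_continuousD; first apply: within_continuousD.
- by apply: cZ; apply: within_continuous_sum => i; apply: csqr; exact: cz.
- apply: cZ; apply: within_continuous_sum => i; apply: csqr.
  by apply: within_continuousB; [exact: ccrd calf | exact: calpha].
- by apply: cZ; apply: csqr; apply: within_continuousB => //; exact: ccst.
- apply: cquad => i; under eq_fun do rewrite !mxE.
  apply: within_continuousB; first exact: cX.
  by apply: within_continuousD; [exact: cxi | apply: cZ; exact: czeta].
- exact: cquad.
Qed.

End OnSet.
End LyapunovAlongTrajectory.

(** * Invariance and dwell times on the lifespan *)

Section EuclideanNorm.
Context (R : realType) (m : nat).
Implicit Types v : 'cV[R]_m.

Lemma coord_le_norm2 v i : `|v i 0| <= norm2 v.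
Proof.
rewrite -sqrtr_sqr ler_wsqrtr // (bigD1 i) //= lerDl sumr_ge0 // => j _.
exact: sqr_ge0.
Qed.

Lemma norm2_le v (C : R) : (forall i, `|v i 0| <= C) -> norm2 v <= m%:R * C.
Proof.
move=> H; have s0 : 0 <= \sum_i `|v i 0| by rewrite sumr_ge0.
apply: (@le_trans _ _ (\sum_i `|v i 0|)); last first.
  apply: le_trans (ler_sum _ (fun i _ => H i)) _.
  by rewrite sumr_const card_ord mulr_natl.
rewrite /norm2 -[leRHS](ger0_norm s0) -sqrtr_sqr ler_wsqrtr //.
rewrite expr2 mulr_suml; apply: ler_sum => i _.
rewrite -real_normK ?num_real // expr2 ler_wpM2l //.
by rewrite (bigD1 i) //= lerDl sumr_ge0.
Qed.

End EuclideanNorm.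

Definition config_bounded (R : realType) n (psi : 'I_n -> R -> R) (k : 'cV[R]_n)
    (c Cb : R) (p : config R n) : Prop :=
  let B := gains c (cf_rho p) in
  let dx := plant_rate psi (cf_th p) (cf_x p) (control psi k B (cf_ws p) (cf_v p)) in
  let dw := ctrl_rate psi k B (cf_ws p) (cf_v p) in
  [/\ forall i, `|cf_x p i 0| <= Cb, forall i, `|dx i 0| <= Cb,
   [/\ forall i, `|xi (cf_w p) i 0| <= Cb, forall i, `|zeta (cf_w p) i 0| <= Cb,
      `|thetahat (cf_w p)| <= Cb & forall i, `|alphaf (cf_w p) i 0| <= Cb],
   [/\ forall i, `|xi dw i 0| <= Cb, forall i, `|zeta dw i 0| <= Cb,
      `|thetahat dw| <= Cb & forall i, `|alphaf dw i 0| <= Cb] &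
   [/\ `|cf_v p| <= Cb, `|control psi k B (cf_ws p) (cf_v p)| <= Cb,
      forall i, (i < n)%N -> `|zcoord (cf_w p) (crd (cf_x p) 1) i.+1| <= Cb,
      forall i, (i.+1 < n)%N -> `|alpha psi k B (cf_ws p) (cf_v p) i.+1| <= Cb &
      forall i, (i.+1 < n)%N -> `|upsilon psi k B (cf_ws p) (cf_v p) i.+2| <= Cb]].

(** * One closed-loop trajectory started in [Omega P q] *)

Section Run.
Context (R : realType) (n : nat) (psi : 'I_n -> R -> R) (k : 'cV[R]_n) (P : 'M[R]_n).
Hypotheses (n_ge2 : (1 < n)%N) (psi_C1 : forall i, C1 (psi i)).
Variables (c : R) (r : 'cV[R]_n.-1) (Q thb q al C0 K gm Cb : R).
Let B := gains c r.
Let cfg th x w ws v := Config r th x w ws v.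
Let cbox (g : R) (p : config R n) := box psi k c thb Q (fun i => crd r i.-1) n g p.
Hypothesis error_boundedH : forall th x w,
  lyapunov P (error_of psi k B th x w) <= q + 1 -> error_bounded psi k B th x w Q.
Hypothesis decayH : forall g p, 0 <= g -> g <= 1 -> cf_rho p = r -> cbox g p ->
  dlyapunov psi k n_ge2 P B (cf_th p) (cf_x p) (cf_w p)
    (plant_rate psi (cf_th p) (cf_x p) (control psi k B (cf_ws p) (cf_v p)))
    (ctrl_rate psi k B (cf_ws p) (cf_v p)) <=
  - al * lyapunov P (error_of psi k B (cf_th p) (cf_x p) (cf_w p)) + C0 + K * g.
Hypothesis boundH : forall g p, 0 <= g -> g <= 1 -> cbox g p -> config_bounded psi k c Cb p.
Hypotheses (al_gt0 : 0 < al) (Cb_gt0 : 0 < Cb) (gm_gt0 : 0 < gm) (gm_le : 2 * gm <= 1)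
  (gm_K : K * (2 * gm) <= 2^-1) (q_large : C0 + 1 < al * q).
Variables (g : thresholds R) (th : R) (tau : trajectory R n).
Hypotheses (g_adm : admissible_thresholds g) (g_le : thresholds_le g gm)
  (th_le : `|th| <= thb) (clH : closed_loop psi k B th tau g)
  (init : Omega P q (eta_at psi k B th tau (t0 tau))).

Let life := lifespan tau.
Let y := output tau.
Let V s := lyapunov P (eta_at psi k B th tau s).
Let w := ctrl tau.
Let ws j := ctrl tau (ctrl_sample tau j).
Let vs j := ybar tau (ctrl_sample tau j).

Let plantE : events (t0 tau) life (plant_time tau)
  (fun s r => gamma_y g <= `|y s - y r|).
Proof. by case: clH. Qed.

Let ctrlE : events (t0 tau) life (ctrl_time tau) (ctrl_triggered tau g).
Proof. by case: clH. Qed.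

Let life_t0 : life (t0 tau).
Proof. by case: clH => t0T _ _ _ _; split. Qed.

Let life_ge s : life s -> t0 tau <= s. Proof. by case. Qed.

Let life_down a s : life s -> t0 tau <= a -> a <= s -> life a.
Proof. by move=> [_ sT] ta as_; split => //; apply: le_lt_trans sT; rewrite lee_fin. Qed.

Let trans : transmission psi k B tau.
Proof. by case: clH. Qed.

Let gy0 : 0 < gamma_y g. Proof. by case: g_adm. Qed.
Let gyle : gamma_y g <= gm. Proof. by case: g_le. Qed.

Lemma ybar_close s : life s -> `|ybar tau s - y s| <= gamma_y g.
Proof.
move=> ls; have [[i [is_ si ->]] _] := trans ls.
have [E _ ris] := events_real plantE is_.
have [<-|ne] := eqVneq (plant_sample tau i) s; first by rewrite subrr normr0 ltW.
have : ~ (gamma_y g <= `|y s - y (plant_sample tau i)|).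
  apply: (events_silent plantE) => //.
  rewrite E lte_fin lt_neqAle ris andbT; apply/eqP => E'; move: ne; rewrite -E' /plant_sample E /=.
  by rewrite eqxx.
by rewrite distrC => /negP; rewrite -ltNge => /ltW.
Qed.

(** The factor 2 comes from the double sampling of the output: [vs j] is within [gamma_ybar] of
    [ybar], which is itself within [gamma_y] of [y]. *)
Lemma sample_close s : life s -> exists j,
  [/\ (ctrl_time tau j <= s%:E)%E, (s%:E < ctrl_time tau j.+1)%E,
      input tau s = control psi k B (ws j) (vs j),
      ctrl_close (w s) (ws j) (2 * gm) & `|y s - vs j| <= 2 * gm].
Proof.
move=> ls; have [_ [j [js sj uE]]] := trans ls; exists j; split=> //.
  have [E rt rs] := events_real ctrlE js.
  (* The absence of triggering is known only strictly after the sampling instant; at that instant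
     the differences vanish. *)
  have [sE|ne] := eqVneq (ctrl_sample tau j) s.
    rewrite /ws sE; split; move=> *; rewrite subrr normr0; move: gm_gt0; lra.
  have : ~ ctrl_triggered tau g s (ctrl_sample tau j).
    apply: (events_silent ctrlE) => //.
    rewrite E lte_fin lt_neqAle rs andbT; apply/eqP => E'; move: ne; rewrite -E' /ctrl_sample E /=.
    by rewrite eqxx.
  case: g_le => _ _ [h1 h2 h3 h4] nt.
  have small x t : t <= gm -> ~ (t <= x) -> x <= 2 * gm.
    by move=> tg /negP; rewrite -ltNge; move: gm_gt0; lra.
  split=> [i|i||i].
  - apply: le_trans (small _ _ h1 (fun H => nt (or_intror (or_introl H)))).
    by have := coord_le_norm2 (xi (w s) - xi (ws j)) i; rewrite !mxE.
  - apply: le_trans (small _ _ h2 (fun H => nt (or_intror (or_intror (or_introl H))))).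
    by have := coord_le_norm2 (zeta (w s) - zeta (ws j)) i; rewrite !mxE.
  - exact: small _ _ h3 (fun H => nt (or_intror (or_intror (or_intror (or_introl H))))).
  - apply: le_trans (small _ _ h4 (fun H => nt (or_intror (or_intror (or_intror (or_intror H)))))).
    by have := coord_le_norm2 (alphaf (w s) - alphaf (ws j)) i; rewrite !mxE.
have [E rt rs] := events_real ctrlE js.
have ys := ybar_close ls.
have [sE|ne] := eqVneq (ctrl_sample tau j) s.
  by rewrite /vs sE distrC; move: ys gyle gm_gt0; lra.
have nt : ~ ctrl_triggered tau g s (ctrl_sample tau j).
  apply: (events_silent ctrlE) => //.
  rewrite E lte_fin lt_neqAle rs andbT; apply/eqP => E'; move: ne; rewrite -E' /ctrl_sample E /=.
  by rewrite eqxx.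
have : ~ (gamma_ybar g <= `|ybar tau s - vs j|) by move=> H; apply: nt; left.
move=> /negP; rewrite -ltNge => hv; case: g_le => _ gyb _.
have -> : y s - vs j = - (ybar tau s - y s) + (ybar tau s - vs j) by ring.
by apply: le_trans (ler_normD _ _) _; rewrite normrN; move: ys gyle; lra.
Qed.

Lemma run_box s j : V s <= q + 1 -> ctrl_close (w s) (ws j) (2 * gm) ->
  `|y s - vs j| <= 2 * gm ->
  cbox (2 * gm) (cfg th (state tau s) (w s) (ws j) (vs j)).
Proof. by move=> Vs cs ys; split => //; exact: error_boundedH. Qed.

Lemma run_rates j s : life s -> (ctrl_time tau j < s%:E)%E -> (s%:E < ctrl_time tau j.+1)%E ->
  let dw := ctrl_rate psi k B (ws j) (vs j) in
  [/\ cderive (state tau) s (plant_rate psi th (state tau s) (control psi k B (ws j) (vs j))),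
      cderive (fun a => xi (w a)) s (xi dw),
      cderive (fun a => zeta (w a)) s (zeta dw),
      is_derive s (1 : R) (fun a => thetahat (w a)) (thetahat dw) &
      cderive (fun a => alphaf (w a)) s (alphaf dw)].
Proof.
move=> ls js sj; have [_ [i [is_ si uE]]] := trans ls.
have ij := events_unique ctrlE is_ si (ltW js) sj.
have [_ _ _ _ [_ dyn]] := clH.
by have := dyn j s ls js sj; rewrite uE ij.
Qed.

Let two_gm : 0 <= 2 * gm. Proof. by rewrite mulr_ge0 // ltW. Qed.

Let contH : [/\ ccontinuous life (state tau), ccontinuous life (fun s => xi (w s)),
  ccontinuous life (fun s => zeta (w s)),
  {within life, continuous (fun s => thetahat (w s))} &
  ccontinuous life (fun s => alphaf (w s))].
Proof. by case: clH => _ _ _ _ []. Qed.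

Let seg_life a b : life a -> life b -> `[a, b]%classic `<=` life.
Proof.
move=> la lb x /=; rewrite in_itv /= => /andP[ax xb].
by apply: life_down lb _ xb; apply: le_trans ax; exact: life_ge.
Qed.

(** [transmission] places [s] in a half-open inter-event interval, so no event occurs immediately
    after [s]. This is the form of differentiability that the real-induction lemmas ask for. *)
Let right_piece s : life s -> exists j, exists2 h, 0 < h &
  forall a, s < a -> a < s + h -> (ctrl_time tau j < a%:E)%E /\ (a%:E < ctrl_time tau j.+1)%E.
Proof.
move=> ls; have [_ [j [js sj _]]] := trans ls.
have [h h0 H] := events_right sj; exists j, h => // a sa ah; split; last exact: H.
by apply: le_lt_trans js _; rewrite lte_fin.
Qed.

Lemma run_invariant s : life s -> V s <= q.
Proof.
move=> ls; have [cx cxi czeta cth calf] := contH.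
have cV : econtinuous `[t0 tau, s] V.
  apply: (econtinuousS (seg_life life_t0 ls)); apply/within_econtinuous.
  exact: (@continuous_lyapunov R n psi k P n_ge2 psi_C1 B th _ _ life cx cxi czeta cth calf).
(* The [2^-1] is the share of the sampling error [K * (2 * gm)]. *)
apply: (@sublevel_invariant _ (t0 tau) s V q al (C0 + 2^-1)) => //; [| |exact: life_ge].
  by move: q_large; lra.
move=> a ta as_; have la : life a by apply: life_down ls ta (ltW as_).
have [j [h h0 H]] := right_piece la; exists h => // b ab bh bs.
have lb : life b by apply: life_down ls _ (ltW bs); lra.
have [jb bj] := H b ab bh.
have [dx dxi dz dt df] := run_rates lb jb bj.
exists (dlyapunov psi k n_ge2 P B th (state tau b) (w b)
  (plant_rate psi th (state tau b) (control psi k B (ws j) (vs j)))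
  (ctrl_rate psi k B (ws j) (vs j))); split.
  exact: (@is_derive_lyapunov R n psi k P n_ge2 psi_C1 B th _ _ _ _ _ dx dxi dz dt df).
move=> Vb; have [i [ib bi _ cs ys]] := sample_close lb.
have ij := events_unique ctrlE ib bi (ltW jb) bj; rewrite {}ij in cs ys.
have bx := run_box Vb cs ys.
have := decayH two_gm gm_le (erefl : cf_rho (cfg th (state tau b) (w b) (ws j) (vs j)) = r) bx; rewrite -[lyapunov _ _]/(V b) /=.
by move: gm_K; lra.
Qed.

Lemma run_bounds s j : life s -> ctrl_close (w s) (ws j) (2 * gm) ->
  `|y s - vs j| <= 2 * gm ->
  config_bounded psi k c Cb (cfg th (state tau s) (w s) (ws j) (vs j)).
Proof.
move=> ls cs ys; apply: (boundH two_gm gm_le); apply: run_box => //.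
by apply: le_trans (run_invariant ls) _; rewrite lerDl.
Qed.

Lemma run_lipschitz_coord (f : R -> R) : {within life, continuous f} ->
  (forall j s, life s -> (ctrl_time tau j < s%:E)%E -> (s%:E < ctrl_time tau j.+1)%E ->
     exists2 l, is_derive s (1 : R) f l & `|l| <= Cb) ->
  forall a s, life a -> life s -> a <= s -> `|f s - f a| <= Cb * (s - a).
Proof.
move=> cf df a s la ls as_.
apply: (@lipschitz_of_derive _ a s) => //; first exact: ltW.
  by apply: (econtinuousS (seg_life la ls)); apply/within_econtinuous.
move=> x ax xs; have lx : life x.
  by apply: life_down ls _ (ltW xs); apply: le_trans ax; exact: life_ge.
have [j [h h0 H]] := right_piece lx; exists h => // b xb bh bs.
have lb : life b by apply: life_down ls _ (ltW bs); have := life_ge lx; lra.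
by have [jb bj] := H b xb bh; exact: df lb jb bj.
Qed.

Let rates_bounded j s : life s -> (ctrl_time tau j < s%:E)%E -> (s%:E < ctrl_time tau j.+1)%E ->
  let dw := ctrl_rate psi k B (ws j) (vs j) in
  (forall i, `|plant_rate psi th (state tau s) (control psi k B (ws j) (vs j)) i 0| <= Cb) /\
  [/\ forall i, `|xi dw i 0| <= Cb, forall i, `|zeta dw i 0| <= Cb,
      `|thetahat dw| <= Cb & forall i, `|alphaf dw i 0| <= Cb].
Proof.
move=> ls js sj; have [i [is_ si _ cs ys]] := sample_close ls.
have ij := events_unique ctrlE is_ si (ltW js) sj; rewrite {}ij in cs ys.
by have [_ h1 _ h2 _] := run_bounds ls cs ys.
Qed.

Lemma run_lipschitz a s : life a -> life s -> a <= s ->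
  (forall i, `|state tau s i 0 - state tau a i 0| <= Cb * (s - a)) /\
  [/\ forall i, `|xi (w s) i 0 - xi (w a) i 0| <= Cb * (s - a),
      forall i, `|zeta (w s) i 0 - zeta (w a) i 0| <= Cb * (s - a),
      `|thetahat (w s) - thetahat (w a)| <= Cb * (s - a) &
      forall i, `|alphaf (w s) i 0 - alphaf (w a) i 0| <= Cb * (s - a)].
Proof.
move=> la ls as_; have [cx cxi czeta cth calf] := contH.
split; last split.
- move=> i; apply: (run_lipschitz_coord (cx i)) => // j x lx jx xj.
  have [dx _ _ _ _] := run_rates lx jx xj; have [h _] := rates_bounded lx jx xj.
  by eexists; [exact: dx | exact: h].
- move=> i; apply: (run_lipschitz_coord (cxi i)) => // j x lx jx xj.
  have [_ dx _ _ _] := run_rates lx jx xj; have [_ [h _ _ _]] := rates_bounded lx jx xj.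
  by eexists; [exact: dx | exact: h].
- move=> i; apply: (run_lipschitz_coord (czeta i)) => // j x lx jx xj.
  have [_ _ dx _ _] := run_rates lx jx xj; have [_ [_ h _ _]] := rates_bounded lx jx xj.
  by eexists; [exact: dx | exact: h].
- apply: (run_lipschitz_coord cth) => // j x lx jx xj.
  have [_ _ _ dx _] := run_rates lx jx xj; have [_ [_ _ h _]] := rates_bounded lx jx xj.
  by eexists; [exact: dx | exact: h].
- move=> i; apply: (run_lipschitz_coord (calf i)) => // j x lx jx xj.
  have [_ _ _ _ dx] := run_rates lx jx xj; have [_ [_ _ _ h]] := rates_bounded lx jx xj.
  by eexists; [exact: dx | exact: h].
Qed.

Lemma run_output_lipschitz a s : life a -> life s -> a <= s ->
  `|y s - y a| <= Cb * (s - a).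
Proof.
move=> la ls as_; have [H _] := run_lipschitz la ls as_.
by have n0 := ltnW n_ge2; rewrite /y /output !(crd_ord _ (Ordinal n0)).
Qed.

Lemma run_plant_dwell i : (plant_time tau i + (gamma_y g / Cb)%:E <= plant_time tau i.+1)%E.
Proof.
apply: (events_dwell plantE) => // a s la ls /ltW as_ trig.
have := le_trans trig (run_output_lipschitz la ls as_).
by rewrite mulrC -ler_pdivrMr // => ?; lra.
Qed.

(** The value held at [s] was taken from [y] at some instant of [(a, s]], while the value held at
    [a] is within [gamma_y] of [y a]. The signal [ybar] may thus jump by [gamma_y] in no time, and
    only the excess over [gamma_y] costs time. *)
Lemma run_ybar_change a s : life a -> life s -> a <= s -> ybar tau s != ybar tau a ->
  `|ybar tau s - ybar tau a| <= gamma_y g + Cb * (s - a).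
Proof.
move=> la ls as_ ne.
have [[i [ia ai aE]] _] := trans la; have [[j [js sj sE]] _] := trans ls.
have ij : (i < j)%N.
  rewrite ltn_neqAle; apply/andP; split; first by apply: contra ne => /eqP ij; rewrite aE sE ij.
  apply: (events_lt plantE) ia _; apply: le_lt_trans sj; exact: as_.
have [E tj js'] := events_real plantE js.
have aj : a < plant_sample tau j.
  rewrite -lte_fin -E; apply: lt_le_trans ai _; exact: (events_le plantE ij).
have lj : life (plant_sample tau j) by exact: life_down ls tj js'.
have h1 := run_output_lipschitz la lj (ltW aj).
have h2 := ybar_close la.
have -> : ybar tau s - ybar tau a = (y (plant_sample tau j) - y a) - (ybar tau a - y a).
  by rewrite sE /y; ring.
apply: le_trans (ler_normB _ _) _.
have h3 : Cb * (plant_sample tau j - a) <= Cb * (s - a) by rewrite ler_wpM2l ?(ltW Cb_gt0) // lerD2r.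
lra.
Qed.

(** The smallest variation that a controller event forces on a Lipschitz signal. For [ybar] it is
    only [gamma_ybar - gamma_y], by [run_ybar_change]; its positivity is the condition
    [gamma_y < gamma_ybar]. *)
Definition ctrl_gap : R :=
  Num.min (gamma_ybar g - gamma_y g) (Num.min (Num.min (gamma_xi g) (gamma_zeta g))
    (Num.min (gamma_h g) (gamma_f g))).

Lemma run_ctrl_dwell j : (ctrl_time tau j + (ctrl_gap / (n%:R * Cb))%:E <= ctrl_time tau j.+1)%E.
Proof.
have n1 : 1 <= n%:R :> R by rewrite ler1n ltnW.
have nC : 0 < n%:R * Cb by rewrite mulr_gt0 // (lt_le_trans ltr01).
apply: (events_dwell ctrlE) => // a s la ls /ltW as_ trig.
have sa : 0 <= s - a by rewrite subr_ge0.
suff : ctrl_gap <= n%:R * Cb * (s - a).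
  by rewrite mulrC -ler_pdivrMr // => ?; lra.
have C0' : 0 <= Cb * (s - a) by rewrite mulr_ge0 // ltW.
have Cn : Cb * (s - a) <= n%:R * Cb * (s - a) by rewrite -mulrA ler_peMl.
have [H [hxi hze hth hal]] := run_lipschitz la ls as_.
rewrite /ctrl_gap.
case: trig => [|[|[|[|]]]] trig.
- rewrite ge_min; apply/orP; left.
  have ne : ybar tau s != ybar tau a.
    apply/eqP => E; move: trig; rewrite E subrr normr0; case: g_adm; lra.
  by have := run_ybar_change la ls as_ ne; lra.
- rewrite !ge_min; apply/orP; right; apply/orP; left; apply/orP; left.
  by apply: le_trans trig _; rewrite -mulrA; apply: norm2_le => i; rewrite !mxE.
- rewrite !ge_min; apply/orP; right; apply/orP; left; apply/orP; right.
  by apply: le_trans trig _; rewrite -mulrA; apply: norm2_le => i; rewrite !mxE.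
- rewrite !ge_min; apply/orP; right; apply/orP; right; apply/orP; left.
  exact: le_trans trig (le_trans hth Cn).
- rewrite !ge_min; apply/orP; right; apply/orP; right; apply/orP; right.
  apply: le_trans trig _; apply: (@le_trans _ _ (n.-1%:R * (Cb * (s - a)))).
    by apply: norm2_le => i; rewrite !mxE.
  by rewrite -mulrA ler_wpM2r // ler_nat leq_pred.
Qed.

Lemma ctrl_gap_gt0 : 0 < ctrl_gap.
Proof.
by case: g_adm => ? ? [? ? ? ?]; rewrite /ctrl_gap !lt_min subr_gt0; do ?[apply/andP; split].
Qed.

Lemma run_signals s : life s ->
  [/\ norm2 (state tau s) <= n%:R * Cb, `|y s| <= n%:R * Cb, `|ybar tau s| <= n%:R * Cb &
      `|input tau s| <= n%:R * Cb] /\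
  [/\ norm2 (xi (w s)) <= n%:R * Cb, norm2 (zeta (w s)) <= n%:R * Cb,
      `|thetahat (w s)| <= n%:R * Cb & norm2 (alphaf (w s)) <= n%:R * Cb] /\
  [/\ forall i, (1 <= i <= n)%N -> `|zcoord (w s) (y s) i| <= n%:R * Cb,
      forall i, (1 <= i < n)%N -> `|alpha psi k B (w s) (ybar tau s) i| <= n%:R * Cb &
      forall i, (2 <= i <= n)%N -> `|upsilon psi k B (w s) (ybar tau s) i| <= n%:R * Cb].
Proof.
move=> ls; have n1 : 1 <= n%:R :> R by rewrite ler1n ltnW.
have Cn x : x <= Cb -> x <= n%:R * Cb.
  by move=> h; apply: le_trans h _; rewrite ler_peMl // ltW.
have [j [js sj uE cs ys]] := sample_close ls.
have [hx _ [hxi hze hth hal] _ [_ hu hz _ _]] := run_bounds ls cs ys.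
(* [signals_bounded] evaluates [alpha] and [upsilon] at the current controller state and [ybar], so
   the bounds are also applied to the configuration in which [w s] is its own sample. *)
have bx : cbox (2 * gm) (cfg th (state tau s) (w s) (w s) (ybar tau s)).
  split => //; first by apply: error_boundedH; apply: le_trans (run_invariant ls) _; rewrite lerDl.
    by split; move=> *; rewrite subrr normr0.
  rewrite distrC; apply: le_trans (ybar_close ls) _; move: gyle gm_gt0 => /=; lra.
have [_ _ _ _ [hv _ _ ha hup]] := boundH two_gm gm_le bx.
split; [|split]; split.
- exact: norm2_le.
- by apply: Cn; exact: (hz 0%N (ltnW n_ge2)).
- exact: Cn.
- by rewrite uE; exact: Cn.
- exact: norm2_le.
- exact: norm2_le.
- exact: Cn.
- by apply: le_trans (norm2_le hal) _; rewrite ler_wpM2r ?(ltW Cb_gt0) // ler_nat leq_pred.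
- by case=> // i /andP[_ ni]; apply: Cn; exact: hz.
- by case=> // i /andP[_ ni]; apply: Cn; exact: ha.
- by case=> [|[|i]] // /andP[_ ni]; apply: Cn; exact: hup.
Qed.

End Run.

(** * Continuation of a solution with finite lifespan *)

Section EventsExtension.
Context (R : realType).
Variables (t0 T : R) (life : set R) (times : nat -> \bar R) (trig : R -> R -> Prop).
Hypotheses (ev : events t0 life times trig) (t0T : t0 < T).
Hypothesis lifeE : forall s, life s <-> t0 <= s /\ s < T.

(** The dwell time makes the event times grow at least linearly, so only finitely many precede
    [T]. *)
Lemma events_last w : 0 < w -> (forall i, (times i + w%:E <= times i.+1)%E) ->
  exists i, (times i < T%:E)%E /\ (T%:E <= times i.+1)%E.
Proof.
move=> w0 dwell.
have growth m : ((t0 + m%:R * w)%:E <= times m)%E.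
  elim: m => [|m IH]; first by rewrite mul0r addr0 ev.1.
  apply: le_trans (dwell m); rewrite -natr1 mulrDl mul1r addrA EFinD.
  by apply: leeD.
have ex : exists m, (T%:E <= times m)%E.
  have := archi_boundP (normr_ge0 ((T - t0) / w)); set m := Num.Def.archi_bound _ => Tm.
  exists m; apply: le_trans (growth m); rewrite lee_fin -lerBlDl -ler_pdivrMr //.
  exact: ltW (le_lt_trans (ler_norm _) Tm).
case: (ex_minnP ex) => -[|m] Tm min_m; first by move: Tm; rewrite ev.1 lee_fin leNgt t0T.
exists m; split=> //; rewrite ltNge; apply/negP => /min_m.
by rewrite ltnn.
Qed.

Variables (h : R) (life' : set R) (trig' : R -> R -> Prop) (I : nat).
Hypotheses (h_gt0 : 0 < h) (lifeE' : forall s, life' s <-> t0 <= s /\ s < T + h).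
Hypothesis trig_old : forall s a, t0 <= s -> s < T -> t0 <= a -> a < T -> (trig' s a <-> trig s a).
Hypotheses (IT : (times I < T%:E)%E) (TI : (T%:E <= times I.+1)%E).

Let tI := fine (times I).

(* The last sampling instant in [[t0, T]] once the event generator has been
   evaluated at [T]. *)
Definition held_sample : R := if `[< trig' T tI >] then T else tI.

Hypothesis quiet : forall s, T < s -> s < T + h -> ~ trig' s held_sample.

(** [T] lies outside the old lifespan, so an event at [T] escaped the old infimum and has to be
    inserted after the event of index [I]. By [quiet] none follows before [T + h], whence [+oo]. *)
Definition times_extended (m : nat) : \bar R :=
  if (m <= I)%N then times m
  else if (m == I.+1) && `[< trig' T tI >] then T%:E else +oo%E.

Let real_times m : (m <= I)%N -> [/\ times m = (fine (times m))%:E, t0 <= fine (times m) & fine (times m) < T].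
Proof.
move=> mI; have mT : (times m < T%:E)%E by exact: le_lt_trans (events_le ev mI) IT.
have [E a _] := events_real ev (ltW mT); split=> //.
by move: mT; rewrite E lte_fin.
Qed.

Let inf_empty (A : set R) : (forall s, ~ A s) -> ereal_inf [set s%:E | s in A] = +oo%E.
Proof.
move=> A0; have -> : A = set0 by apply/seteqP; split=> // s /A0.
by rewrite image_set0 ereal_inf0.
Qed.

Let no_old s : life s -> (times I < s%:E)%E -> ~ trig s tI.
Proof.
move=> ls Is H; have /lifeE[_ sT] := ls.
suff : (times I.+1 <= s%:E)%E by move=> /(le_trans TI); rewrite lee_fin leNgt sT.
by rewrite ev.2; apply: ereal_inf_lbound; exists s.
Qed.

Lemma events_extend : events t0 life' times_extended trig'.
Proof.
have [IE t0I tIT] := real_times (leqnn I).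
split=> [|m]; first by rewrite /times_extended /= ev.1.
have [mI|] := ltnP m I.
  rewrite /times_extended mI (ltnW mI) ev.2.
  have [mE t0m mT] := real_times (ltnW mI).
  apply/eqP; rewrite eq_le; apply/andP; split.
    apply: le_ereal_inf_tmp => _ [s [/lifeE'[ts _] ms tr] <-].
    have [sT|Ts] := ltP s T.
      apply: ereal_inf_lbound; exists s => //; split=> //; first exact/lifeE.
      exact/trig_old.
    rewrite -ev.2; apply: le_trans (events_le ev mI) _.
    by apply: le_trans (ltW IT) _; rewrite lee_fin.
  apply: ereal_inf_le_tmp => _ [s [/lifeE[ts sT] ms tr] <-]; exists s => //; split=> //.
    by apply/lifeE'; split=> //; move: h_gt0; lra.
  exact/trig_old.
rewrite leq_eqVlt => /orP[/eqP <-|Im].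
  rewrite /times_extended ltnn leqnn eqxx /= -/tI.
  have old s : life' s -> (times I < s%:E)%E -> trig' s tI -> T <= s.
    move=> /lifeE'[ts _] Is tr; rewrite leNgt; apply/negP => sT.
    by apply: (@no_old s) => //; [exact/lifeE | exact/trig_old].
  case: asboolP => trT.
    apply/eqP; rewrite eq_le; apply/andP; split.
      by apply: le_ereal_inf_tmp => _ [s [l' Is tr] <-]; rewrite lee_fin; exact: old.
    apply: ereal_inf_lbound; exists T => //; split=> //; apply/lifeE'; split; first exact: ltW.
    by move: h_gt0; lra.
  rewrite inf_empty // => s [l' Is tr]; have := old s l' Is tr.
  rewrite le_eqVlt => /orP[/eqP sT|Ts]; first by rewrite -sT in tr.
  have /lifeE'[_ sh] := l'; apply: (quiet Ts sh).
  by rewrite /held_sample asboolF.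
have mE : times_extended m.+1 = +oo%E.
  by rewrite /times_extended leqNgt (leqW Im) /= eqSS gtn_eqF.
rewrite mE inf_empty // => s [/lifeE'[_ sh]].
rewrite /times_extended leqNgt Im /=; case: ifP => [/andP[_ /asboolP trT] /=|//].
rewrite lte_fin => Ts tr; apply: (quiet Ts sh).
by rewrite /held_sample asboolT.
Qed.

Lemma extended_old j s : s < T -> (times j <= s%:E)%E -> (s%:E < times j.+1)%E ->
  [/\ times_extended j = times j, (times_extended j <= s%:E)%E & (s%:E < times_extended j.+1)%E].
Proof.
move=> sT js sj; have jI : (j <= I)%N.
  have := js; rewrite leqNgt => js'; apply/negP => Ij.
  have := le_trans TI (le_trans (events_le ev Ij) js); rewrite lee_fin; lra.
have E : times_extended j = times j by rewrite /times_extended jI.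
rewrite E; split=> //; rewrite /times_extended; case: ifP => // _; case: ifP => _.
  by rewrite lte_fin.
by rewrite ltry.
Qed.

Lemma extended_old_inv j s : s < T -> (times_extended j <= s%:E)%E ->
  (s%:E < times_extended j.+1)%E ->
  times_extended j = times j /\ (s%:E < times j.+1)%E.
Proof.
move=> sT; rewrite /times_extended; have [jI|Ij] := leqP j I; last first.
  case: (_ && _) => //; first by rewrite lee_fin leNgt sT.
move=> _; have [//|Ij _] := ltnP j I.
have -> : j = I by apply/eqP; rewrite eqn_leq jI.
by split=> //; apply: lt_le_trans TI; rewrite lte_fin.
Qed.

Lemma extended_new s : T <= s -> exists j, [/\ (times_extended j <= s%:E)%E,
  (s%:E < times_extended j.+1)%E & times_extended j = held_sample%:E].
Proof.
move=> Ts; have [IE t0I tIT] := real_times (leqnn I).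
rewrite /held_sample; case: asboolP => trT.
  exists I.+1; rewrite /times_extended ltnn eqxx asboolT //=.
  have -> : (I.+1 < I)%N = false by rewrite ltnNge leqnSn.
  by rewrite gtn_eqF //= ltry lee_fin.
exists I; rewrite /times_extended leqnn ltnn asboolF // andbF -IE ltry.
by split=> //; apply: le_trans (ltW IT) _; rewrite lee_fin.
Qed.

Lemma extended_new_inv j s : T <= s -> (times_extended j < s%:E)%E ->
  (s%:E < times_extended j.+1)%E ->
  times_extended j = held_sample%:E /\ held_sample < s.
Proof.
move=> Ts js sj; have [i [is_ si iE]] := extended_new Ts.
have ij := events_unique events_extend (ltW js) sj is_ si.
by rewrite ij in js *; rewrite iE in js *; rewrite lte_fin in js.
Qed.

End EventsExtension.

(** * Gluing two functions at the end of a lifespan *)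

Section Glue.
Context (R : realType) (T : R).

Definition glue (A : Type) (f F : R -> A) (s : R) : A := if s < T then f s else F s.

Lemma glue_lt A (f F : R -> A) s : s < T -> glue f F s = f s.
Proof. by rewrite /glue => ->. Qed.

Lemma glue_ge A (f F : R -> A) s : T <= s -> glue f F s = F s.
Proof. by rewrite /glue ltNge => ->. Qed.

Lemma glue_comp A A' (p : A -> A') (f F : R -> A) :
  (fun s => p (glue f F s)) = glue (fun s => p (f s)) (fun s => p (F s)).
Proof. by apply/funext => s; rewrite /glue; case: ifP. Qed.

(** The function [f s + C * s] is nondecreasing and bounded, so its supremum is its limit at [T]. *)
Lemma lipschitz_left_limit (t0 C : R) (f : R -> R) : t0 < T -> 0 <= C ->
  (forall a s, t0 <= a -> a <= s -> s < T -> `|f s - f a| <= C * (s - a)) ->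
  exists l, forall s, t0 <= s -> s < T -> `|f s - l| <= C * (T - s).
Proof.
move=> t0T C0 H.
pose A := [set f s + C * s | s in [set s | t0 <= s /\ s < T]].
have ub s0 : t0 <= s0 -> s0 < T -> ubound A (f s0 + C * T + C * (T - s0)).
  move=> ts0 s0T _ [s [ts sT] <-]; have [ss0|s0s] := leP s s0.
    have := H s s0 ts ss0 s0T; rewrite ler_norml => /andP[h1 _].
    have : C * s0 <= C * T by rewrite ler_wpM2l // ltW.
    have : 0 <= C * (T - s0) by rewrite mulr_ge0 // subr_ge0 ltW.
    by move: h1; rewrite mulrBr; lra.
  have := H s0 s ts0 (ltW s0s) sT; rewrite ler_norml => /andP[_ h1].
  have : C * s <= C * T by rewrite ler_wpM2l // ltW.
  by move: h1; rewrite !mulrBr; lra.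
have A0 : A (f t0 + C * t0) by exists t0.
exists (sup A - C * T) => s ts sT.
have h1 : sup A <= f s + C * T + C * (T - s) by apply: ge_sup; [exists (f t0 + C * t0) | exact: ub].
have h2 : f s + C * s <= sup A.
  by apply: ub_le_sup; [exists (f t0 + C * T + C * (T - t0)); exact: ub | exists s].
rewrite ler_norml; apply/andP; split; first lra.
by rewrite mulrBr; lra.
Qed.

Lemma glue_continuous (t0 b C l : R) (f F : R -> R) : 0 <= C ->
  (forall s, t0 <= s -> s < T -> `|f s - l| <= C * (T - s)) ->
  econtinuous [set s | t0 <= s /\ s < T] f -> F T = l -> econtinuous setT F ->
  {within [set s | t0 <= s /\ s < b], continuous (glue f F)}.
Proof.
move=> C0 fl cf FT cF; apply/within_econtinuous => s [ts sb] e e0.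
have [sT|Ts|sT] := ltgtP s T.
- have [|d d0 Hd] := cf s _ e e0; first by split.
  exists (Num.min d (T - s)); first by rewrite lt_min d0 subr_gt0.
  move=> a [ta ab]; rewrite lt_min => /andP[ad aT].
  have aT' : a < T by have := ler_norm (a - s); lra.
  by rewrite !glue_lt //; apply: Hd.
- have [d d0 Hd] := cF s Logic.I e e0.
  exists (Num.min d (s - T)); first by rewrite lt_min d0 subr_gt0.
  move=> a _; rewrite lt_min => /andP[ad aT].
  have aT' : T <= a by have := ler_norm (s - a); rewrite distrC; lra.
  by rewrite !glue_ge ?(ltW Ts) //; apply: Hd.
have [d d0 Hd] := cF T Logic.I e e0.
have ec : 0 < e / (C + 1) by rewrite divr_gt0 //; lra.
exists (Num.min d (e / (C + 1))); first by rewrite lt_min d0.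
move=> a [ta ab]; rewrite lt_min sT => /andP[ad ae].
rewrite [in X in _ - X]glue_ge //.
have [aT|Ta] := ltP a T; last by rewrite glue_ge //; apply: Hd.
rewrite glue_lt // FT; apply: le_lt_trans (fl a ta aT) _.
move: ae; rewrite distrC ger0_norm ?subr_ge0 ?(ltW aT) // ltr_pdivlMr; last lra.
by have : 0 <= T - a by [lra]; nra.
Qed.

Lemma glue_derive_lt (f F : R -> R) (s d : R) : s < T -> is_derive s (1 : R) f d ->
  is_derive s (1 : R) (glue f F) d.
Proof.
move=> sT; apply: near_eq_is_derive; apply/nbhs_ballP; exists (T - s) => /=; first by rewrite subr_gt0.
move=> a; rewrite /ball /= => aT; rewrite glue_lt //.
by have := ler_norm (a - s); rewrite distrC; lra.
Qed.

Lemma glue_derive_gt (f F : R -> R) (s d : R) : T < s -> is_derive s (1 : R) F d ->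
  is_derive s (1 : R) (glue f F) d.
Proof.
move=> sT; apply: near_eq_is_derive; apply/nbhs_ballP; exists (s - T) => /=; first by rewrite subr_gt0.
move=> a; rewrite /ball /= => aT; rewrite glue_ge //.
by have := ler_norm (s - a); lra.
Qed.

(** By the mean value theorem, difference quotients at [T] are values of [G] nearer to [T]. This
    serves when the controller has no event at [T]: the glued trajectory must then be differentiable
    there. *)
Lemma is_derive_of_limit (f G : R -> R) (a b L : R) : a < T -> T < b ->
  econtinuous [set s | a < s /\ s < b] f ->
  (forall s, a < s -> s < b -> s != T -> is_derive s (1 : R) f (G s)) ->
  (forall e, 0 < e -> exists2 d, 0 < d & forall s, a < s -> s < b -> `|s - T| < d -> `|G s - L| < e) ->
  is_derive T (1 : R) f L.
Proof.
move=> aT Tb cf df GL.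
have mv s : a < s -> s < b -> s != T -> exists x, [/\ a < x, x < b, `|x - T| < `|s - T| & f s - f T = G x * (s - T)].
  move=> as_ sb sT.
  have drv x l : a < x -> x < b -> x != T -> is_derive x (1 : R) f l -> l = G x.
    move=> ax xb xT dx; have dG := df x ax xb xT.
    by rewrite -(@derive_val _ _ _ _ _ _ _ dx) (@derive_val _ _ _ _ _ _ _ dG).
  have [sT'|Ts|E] := ltgtP s T; last by rewrite E eqxx in sT.
    have [||x [l [sx xT dx E]]] := @mean_value R s T f sT'.
    - by apply: econtinuousS cf => z /=; rewrite in_itv /= => /andP[? ?]; split; lra.
    - by move=> z sz zT; exists (G z); apply: df; [lra|lra|rewrite lt_eqF].
    exists x; have lx : l = G x by apply: drv dx; [lra|lra|rewrite lt_eqF].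
    split; [lra|lra| |by rewrite -lx; move: E; lra].
    by rewrite !ltr0_norm ?subr_lt0 //; lra.
  have [||x [l [sx xT dx E]]] := @mean_value R T s f Ts.
  - by apply: econtinuousS cf => z /=; rewrite in_itv /= => /andP[? ?]; split; lra.
  - by move=> z sz zT; exists (G z); apply: df; [lra|lra|rewrite gt_eqF].
  exists x; have lx : l = G x by apply: drv dx; [lra|lra|rewrite gt_eqF].
  split; [lra|lra| |by rewrite -lx; move: E; lra].
  by rewrite !gtr0_norm ?subr_gt0 //; lra.
have cvL : (fun h : R => h^-1 *: ((f \o shift T) (h *: (1 : R)) - f T)) @ 0^' --> L.
  apply/cvgrPdist_lt => e e0; have [d d0 Hd] := GL e e0.
  rewrite near_withinE; apply/nbhs_ballP.
  exists (Num.min d (Num.min (T - a) (b - T))) => /=; first by rewrite !lt_min d0 !subr_gt0 aT.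
  move=> h; rewrite /ball /= sub0r normrN !lt_min => /and3P[hd ha hb] h0.
  have h1 := ler_norm h; have h2 := ler_norm (- h); rewrite normrN in h2.
  have [|||x [ax xb xT E]] := mv (h + T); [lra..| |].
    by rewrite -subr_eq0 addrK.
  rewrite /= /GRing.scale /= mulr1 E addrK mulrCA mulVf // mulr1 distrC.
  by apply: Hd => //; apply: lt_trans xT _; rewrite addrK.
by split; [exact: cvgP cvL | exact: cvg_lim cvL].
Qed.

End Glue.

(** * Continuation of a closed-loop trajectory beyond a finite end time *)

Section Extension.
Context (R : realType) (n : nat) (psi : 'I_n -> R -> R) (k : 'cV[R]_n).
Hypothesis psi_C1 : forall i, C1 (psi i).
Variables (B : parameters R n) (th : R) (g : thresholds R) (tau : trajectory R n).
Hypotheses (g_adm : admissible_thresholds g) (clH : closed_loop psi k B th tau g).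
Variables (T C : R).
Hypotheses (tendE : tend tau = T%:E) (C_ge0 : 0 <= C).
Let y := output tau.
Let ws j := ctrl tau (ctrl_sample tau j).
Let vs j := ybar tau (ctrl_sample tau j).

Let t0T : t0 tau < T.
Proof. by case: clH; rewrite tendE lte_fin. Qed.

Let lifeE s : lifespan tau s <-> t0 tau <= s /\ s < T.
Proof. by rewrite /lifespan /= tendE lte_fin. Qed.

Let plantE : events (t0 tau) (lifespan tau) (plant_time tau)
  (fun s r => gamma_y g <= `|y s - y r|).
Proof. by case: clH. Qed.

Let ctrlE : events (t0 tau) (lifespan tau) (ctrl_time tau) (ctrl_triggered tau g).
Proof. by case: clH. Qed.

Let old_rates j s : lifespan tau s -> (ctrl_time tau j < s%:E)%E ->
  (s%:E < ctrl_time tau j.+1)%E ->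
  let dw := ctrl_rate psi k B (ws j) (vs j) in
  input tau s = control psi k B (ws j) (vs j) /\
  [/\ cderive (state tau) s (plant_rate psi th (state tau s) (control psi k B (ws j) (vs j))),
      cderive (fun a => xi (ctrl tau a)) s (xi dw),
      cderive (fun a => zeta (ctrl tau a)) s (zeta dw),
      is_derive s (1 : R) (fun a => thetahat (ctrl tau a)) (thetahat dw) &
      cderive (fun a => alphaf (ctrl tau a)) s (alphaf dw)].
Proof.
move=> ls js sj; have [_ _ _ tr [_ dyn]] := clH.
have [_ [i [is_ si uE]]] := tr s ls.
have ij := events_unique ctrlE is_ si (ltW js) sj.
by have := dyn j s ls js sj; rewrite uE ij.
Qed.

Section Glued.
Variables (xT : 'cV[R]_n) (wT : ctrl_state R n) (pI cJ : nat).
Hypothesis state_lim : forall s, t0 tau <= s -> s < T ->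
  (forall i, `|state tau s i 0 - xT i 0| <= C * (T - s)) /\
  [/\ forall i, `|xi (ctrl tau s) i 0 - xi wT i 0| <= C * (T - s),
      forall i, `|zeta (ctrl tau s) i 0 - zeta wT i 0| <= C * (T - s),
      `|thetahat (ctrl tau s) - thetahat wT| <= C * (T - s) &
      forall i, `|alphaf (ctrl tau s) i 0 - alphaf wT i 0| <= C * (T - s)].
Hypotheses (pIT : (plant_time tau pI < T%:E)%E) (TpI : (T%:E <= plant_time tau pI.+1)%E).
Hypotheses (cJT : (ctrl_time tau cJ < T%:E)%E) (TcJ : (T%:E <= ctrl_time tau cJ.+1)%E).

Let tp := plant_sample tau pI.
Let tc := ctrl_sample tau cJ.

(** [ctrl_triggered] on values instead of times, so that it can be tested at [T] before the extended
    trajectory exists. *)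
Definition sample_trigger (v v' : R) (w w' : ctrl_state R n) : Prop :=
  gamma_ybar g <= `|v - v'| \/ gamma_xi g <= norm2 (xi w - xi w') \/
  gamma_zeta g <= norm2 (zeta w - zeta w') \/
  gamma_h g <= `|thetahat w - thetahat w'| \/
  gamma_f g <= norm2 (alphaf w - alphaf w').

(** At [T] the plant detector is evaluated first; the controller detector then sees the updated
    [ybT]. This order determines the values [wh] and [vh] held after [T]. *)
Let ptrig : Prop := gamma_y g <= `|crd xT 1 - y tp|.
Let ybT : R := if `[< ptrig >] then crd xT 1 else y tp.
Let ctrig : Prop := sample_trigger ybT (ybar tau tc) wT (ctrl tau tc).
Let wh : ctrl_state R n := if `[< ctrig >] then wT else ctrl tau tc.
Let vh : R := if `[< ctrig >] then ybT else ybar tau tc.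
Let u : R := control psi k B wh vh.
Let dw := ctrl_rate psi k B wh vh.
(** Between events the rates of the controller states are constant, so these states are affine in
    time; only the plant needs an existence theorem. *)
Let Wn s := CtrlState (xi wT + (s - T) *: xi dw) (zeta wT + (s - T) *: zeta dw)
  (thetahat wT + (s - T) * thetahat dw) (alphaf wT + (s - T) *: alphaf dw).

Variables (X : R -> 'cV[R]_n) (h : R).
Hypotheses (h_gt0 : 0 < h) (XT : X T = xT) (cX : vcontinuous X)
  (dX : forall s, `|s - T| < h -> cderive X s (plant_rate psi th (X s) u))
  (quietX : forall s, `|s - T| < h -> `|crd (X s) 1 - ybT| < gamma_y g)
  (quietW : forall s, `|s - T| < h ->
    [/\ norm2 (xi (Wn s) - xi wh) < gamma_xi g, norm2 (zeta (Wn s) - zeta wh) < gamma_zeta g,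
        `|thetahat (Wn s) - thetahat wh| < gamma_h g &
        norm2 (alphaf (Wn s) - alphaf wh) < gamma_f g]).

Let st' := glue T (state tau) X.
Let w' := glue T (ctrl tau) Wn.
Let yb' := glue T (ybar tau) (fun=> ybT).
Let u' := glue T (input tau) (fun=> u).
Let trigP s a : Prop := gamma_y g <= `|crd (st' s) 1 - crd (st' a) 1|.
Let trigC s a : Prop := sample_trigger (yb' s) (yb' a) (w' s) (w' a).
Let ptime := times_extended T (plant_time tau) trigP pI.
Let ctime := times_extended T (ctrl_time tau) trigC cJ.

Let tau' := Trajectory (t0 tau) (T + h)%:E ptime ctime st' w' yb' u'.

Let lifeE' s : lifespan tau' s <-> t0 tau <= s /\ s < T + h.
Proof. by rewrite /lifespan /= lte_fin. Qed.

Let WnT : Wn T = wT.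
Proof. by rewrite /Wn subrr !scale0r mul0r !addr0; case: wT. Qed.

Let tp_bound : t0 tau <= tp < T.
Proof.
have [E a _] := events_real plantE (ltW pIT).
by move: pIT; rewrite E lte_fin => b; apply/andP.
Qed.

Let tc_bound : t0 tau <= tc < T.
Proof.
have [E a _] := events_real ctrlE (ltW cJT).
by move: cJT; rewrite E lte_fin => b; apply/andP.
Qed.

Let trigP_T : `[< trigP T tp >] = `[< ptrig >].
Proof.
apply: asbool_equiv_eq; rewrite /trigP /st' glue_ge // XT glue_lt //.
by case/andP: tp_bound.
Qed.

Let trigC_T : `[< trigC T tc >] = `[< ctrig >].
Proof.
have [_ tcT] := andP tc_bound.
by apply: asbool_equiv_eq; rewrite /trigC /w' /yb' !(glue_lt _ _ tcT) !(glue_ge _ _ (lexx T)) WnT.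
Qed.

Let hp := held_sample T (plant_time tau) trigP pI.
Let hc := held_sample T (ctrl_time tau) trigC cJ.

Let hp_out : crd (st' hp) 1 = ybT.
Proof.
have [_ tpT] := andP tp_bound.
rewrite /hp /held_sample -[fine _]/tp trigP_T /ybT; case: asboolP => _.
  by rewrite /st' glue_ge // XT.
by rewrite /st' glue_lt.
Qed.

Let hc_out : w' hc = wh /\ yb' hc = vh.
Proof.
have [_ tcT] := andP tc_bound.
rewrite /hc /held_sample -[fine _]/tc trigC_T /wh /vh; case: asboolP => _.
  by rewrite /w' /yb' !glue_ge // WnT.
by rewrite /w' /yb' !glue_lt.
Qed.

Let quietP s : T < s -> s < T + h -> ~ trigP s hp.
Proof.
move=> Ts sh; rewrite /trigP hp_out /st' glue_ge ?(ltW Ts) // => H.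
have sT : `|s - T| < h by rewrite gtr0_norm ?subr_gt0 //; lra.
by have := quietX sT; lra.
Qed.

Let gamma_ybar_gt0 : 0 < gamma_ybar g.
Proof. by case: g_adm => a b _; exact: lt_trans b. Qed.

Let quietC s : T < s -> s < T + h -> ~ trigC s hc.
Proof.
move=> Ts sh; have [wE vE] := hc_out.
rewrite /trigC wE vE /w' /yb' !glue_ge ?(ltW Ts) //.
have sT : `|s - T| < h by rewrite gtr0_norm ?subr_gt0 //; lra.
have [h1 h2 h3 h4] := quietW sT.
case=> [|[|[|[|]]]]; try by move: h1 h2 h3 h4; lra.
rewrite /vh; case: asboolP => [_|nt]; last by move=> H; apply: nt; left.
by rewrite subrr normr0; have := gamma_ybar_gt0; lra.
Qed.

Let trigP_old s a : t0 tau <= s -> s < T -> t0 tau <= a -> a < T ->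
  trigP s a <-> gamma_y g <= `|y s - y a|.
Proof. by move=> _ sT _ aT; rewrite /trigP /st' !glue_lt. Qed.

Let trigC_old s a : t0 tau <= s -> s < T -> t0 tau <= a -> a < T ->
  trigC s a <-> ctrl_triggered tau g s a.
Proof. by move=> _ sT _ aT; rewrite /trigC /w' /yb' !glue_lt. Qed.

Let plantE' : events (t0 tau) (lifespan tau') ptime trigP.
Proof.
exact: (@events_extend R (t0 tau) T _ _ _ plantE t0T lifeE h _ trigP pI h_gt0 lifeE' trigP_old pIT TpI quietP).
Qed.

Let ctrlE' : events (t0 tau) (lifespan tau') ctime trigC.
Proof.
exact: (@events_extend R (t0 tau) T _ _ _ ctrlE t0T lifeE h _ trigC cJ h_gt0 lifeE' trigC_old cJT TcJ quietC).
Qed.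

Let transmission' : transmission psi k B tau'.
Proof.
move=> s /lifeE'[ts sh]; have [_ _ _ tr _] := clH.
have [sT|Ts] := ltP s T.
  have [[i [is_ si yE]] [j [js sj uE]]] := tr s (proj2 (lifeE s) (conj ts sT)).
  split.
    have [E a b] := extended_old plantE trigP TpI sT is_ si.
    exists i; split=> //=; rewrite /yb' glue_lt // yE /output /plant_sample /= [ptime i]E.
    rewrite /st' glue_lt //; have [_ _ ii] := events_real plantE is_.
    exact: le_lt_trans ii sT.
  have [E a b] := extended_old ctrlE trigC TcJ sT js sj.
  exists j; split=> //=; rewrite /u' glue_lt // uE /ctrl_sample /= [ctime j]E.
  have [_ _ jj] := events_real ctrlE js.
  by rewrite /w' /yb' !glue_lt //; exact: le_lt_trans jj sT.
split.
  have [i [a b E]] := extended_new plantE trigP pIT Ts.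
  by exists i; split=> //=; rewrite /yb' glue_ge // /output /plant_sample /= [ptime i]E /= hp_out.
have [j [a b E]] := extended_new ctrlE trigC cJT Ts.
exists j; split=> //=; rewrite /u' glue_ge // /ctrl_sample /= [ctime j]E /=.
by have [-> ->] := hc_out.
Qed.

Let held j s : lifespan tau' s -> (ctime j < s%:E)%E -> (s%:E < ctime j.+1)%E ->
  (s < T -> [/\ w' (fine (ctime j)) = ws j, yb' (fine (ctime j)) = vs j,
     lifespan tau s, (ctrl_time tau j < s%:E)%E & (s%:E < ctrl_time tau j.+1)%E]) /\
  (T <= s -> [/\ w' (fine (ctime j)) = wh, yb' (fine (ctime j)) = vh & hc < s]).
Proof.
move=> /lifeE'[ts sh] js sj; split=> [sT|Ts].
  have [E b] := extended_old_inv TcJ sT (ltW js) sj.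
  rewrite -/ctime in E; rewrite E in js *.
  have [_ _ jj] := events_real ctrlE (ltW js).
  have jT := le_lt_trans jj sT.
  by rewrite /w' /yb' !glue_lt //; split=> //; exact/lifeE.
have [E hs] := @extended_new_inv R (t0 tau) T _ _ _ ctrlE t0T lifeE h _ trigC cJ h_gt0 lifeE' trigC_old cJT TcJ quietC j s Ts js sj.
by rewrite -/ctime in E; rewrite E /=; have [-> ->] := hc_out.
Qed.

Let coordX i : econtinuous setT (fun s => X s i 0).
Proof. by move=> s _ e e0; have [d d0 H] := cX s e0; exists d => // r _ /H. Qed.

Let affineD (a d : R) s : is_derive s (1 : R) (fun r => a + (r - T) * d) d.
Proof.
apply: is_derive_val_eq (is_derive_addf (is_derive_cstf s a) (is_derive_mulf (is_derive_subf (is_derive_id s 1) (is_derive_cstf s T)) (is_derive_cstf s d))).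
by ring.
Qed.

Let affine_coord m (a d : 'cV[R]_m) i s :
  is_derive s (1 : R) (fun r => (a + (r - T) *: d) i 0) (d i 0).
Proof. by under eq_fun do rewrite !mxE; exact: affineD. Qed.

Let affineC (a d : R) : econtinuous setT (fun r => a + (r - T) * d).
Proof. by apply: is_derive_econtinuous => s _; exists d; exact: affineD. Qed.

Let lifespan'E : lifespan tau' = [set s | t0 tau <= s /\ s < T + h].
Proof. by apply/seteqP; split => s /lifeE'. Qed.

Let lifespanE : lifespan tau = [set s | t0 tau <= s /\ s < T].
Proof. by apply/seteqP; split => s /lifeE. Qed.

Let glue_cont (f F : R -> R) l : (forall s, t0 tau <= s -> s < T -> `|f s - l| <= C * (T - s)) ->
  {within lifespan tau, continuous f} -> F T = l -> econtinuous setT F ->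
  {within lifespan tau', continuous (glue T f F)}.
Proof.
move=> fl; rewrite lifespanE => /within_econtinuous cf FT cF; rewrite lifespan'E.
exact: (glue_continuous (b := T + h) C_ge0 fl cf FT cF).
Qed.

Let contS i : {within lifespan tau', continuous (glue T (fun s => state tau s i 0) (fun s => X s i 0))}.
Proof.
have [_ _ _ _ [[cs _ _ _ _] _]] := clH.
apply: (glue_cont (l := xT i 0)) => //; last by rewrite XT.
by move=> s ts sT; exact: (state_lim ts sT).1.
Qed.

Let cont1 i : {within lifespan tau', continuous
  (glue T (fun s => xi (ctrl tau s) i 0) (fun s => xi (Wn s) i 0))}.
Proof.
have [_ _ _ _ [[_ cs _ _ _] _]] := clH.
apply: (glue_cont (l := xi wT i 0)) => //; last by under eq_fun do rewrite /= !mxE; exact: affineC.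
  by move=> s ts sT; have [_ []] := state_lim ts sT.
by rewrite WnT.
Qed.

Let cont2 i : {within lifespan tau', continuous
  (glue T (fun s => zeta (ctrl tau s) i 0) (fun s => zeta (Wn s) i 0))}.
Proof.
have [_ _ _ _ [[_ _ cs _ _] _]] := clH.
apply: (glue_cont (l := zeta wT i 0)) => //; last by under eq_fun do rewrite /= !mxE; exact: affineC.
  by move=> s ts sT; have [_ []] := state_lim ts sT.
by rewrite WnT.
Qed.

Let cont3 : {within lifespan tau', continuous
  (glue T (fun s => thetahat (ctrl tau s)) (fun s => thetahat (Wn s)))}.
Proof.
have [_ _ _ _ [[_ _ _ cs _] _]] := clH.
apply: (glue_cont (l := thetahat wT)) => //; last exact: affineC.
  by move=> s ts sT; have [_ []] := state_lim ts sT.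
by rewrite WnT.
Qed.

Let cont4 i : {within lifespan tau', continuous
  (glue T (fun s => alphaf (ctrl tau s) i 0) (fun s => alphaf (Wn s) i 0))}.
Proof.
have [_ _ _ _ [[_ _ _ _ cs] _]] := clH.
apply: (glue_cont (l := alphaf wT i 0)) => //; last by under eq_fun do rewrite /= !mxE; exact: affineC.
  by move=> s ts sT; have [_ []] := state_lim ts sT.
by rewrite WnT.
Qed.

Let glue_derive (f F Dn : R -> R) (Dold : nat -> R -> R) :
  {within lifespan tau', continuous (glue T f F)} ->
  (forall j s, lifespan tau s -> (ctrl_time tau j < s%:E)%E -> (s%:E < ctrl_time tau j.+1)%E ->
     is_derive s (1 : R) f (Dold j s)) ->
  (forall s, T < s -> s < T + h -> is_derive s (1 : R) F (Dn s)) ->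
  (~ ctrig -> forall e, 0 < e -> exists2 d, 0 < d & forall s, tc < s -> s < T + h ->
     `|s - T| < d -> `|glue T (Dold cJ) Dn s - Dn T| < e) ->
  forall j s, lifespan tau' s -> (ctime j < s%:E)%E -> (s%:E < ctime j.+1)%E ->
    is_derive s (1 : R) (glue T f F) (if s < T then Dold j s else Dn s).
Proof.
move=> cfF df dF lim j s ls js sj; have /lifeE'[ts sh] := ls.
have [Hlt Hge] := held ls js sj.
have [tct0 tcT] := andP tc_bound.
have [sT|Ts|sT] := ltgtP s T.
- by have [_ _ l' a b] := Hlt sT; apply: glue_derive_lt => //; exact: df.
- by apply: glue_derive_gt => //; exact: dF.
have Ts : T <= s by rewrite sT.
have [_ _ hcs] := Hge Ts.
(* [T] lies strictly inside an inter-event interval only if no controller event occurs there. The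
   held values are then the same on both sides of [T], and the one-sided rates match. *)
have nct : ~ ctrig.
  move=> H; move: hcs; rewrite /hc /held_sample -[fine _]/tc trigC_T asboolT // sT.
  by rewrite ltxx.
rewrite sT; apply: (@is_derive_of_limit R T _ (glue T (Dold cJ) Dn) tc (T + h)) => //.
- by rewrite ltrDl.
- apply: (@econtinuousS _ _ (lifespan tau')); last exact/within_econtinuous.
  by move=> a /= [ta ah]; apply/lifeE'; split=> //; apply: le_trans (ltW ta).
- move=> a ta ah aT; have [aT'|Ta|E] := ltgtP a T; last by rewrite E eqxx in aT.
    rewrite glue_lt //; apply: glue_derive_lt => //; apply: df.
    + by apply/lifeE; split=> //; apply: le_trans (ltW ta).
    + by have [E _ _] := events_real ctrlE (ltW cJT); rewrite E lte_fin.
    + by apply: lt_le_trans TcJ; rewrite lte_fin.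
  by rewrite glue_ge ?(ltW Ta) //; apply: glue_derive_gt => //; exact: dF.
- exact: lim.
Qed.

Let held_cst : ~ ctrig -> wh = ws cJ /\ vh = vs cJ.
Proof. by move=> H; rewrite /wh /vh asboolF. Qed.

Let glue_derive_cst (f F : R -> R) (p : ctrl_state R n -> R) :
  {within lifespan tau', continuous (glue T f F)} ->
  (forall j s, lifespan tau s -> (ctrl_time tau j < s%:E)%E -> (s%:E < ctrl_time tau j.+1)%E ->
     is_derive s (1 : R) f (p (ctrl_rate psi k B (ws j) (vs j)))) ->
  (forall s, is_derive s (1 : R) F (p dw)) ->
  forall j s, lifespan tau' s -> (ctime j < s%:E)%E -> (s%:E < ctime j.+1)%E ->
    is_derive s (1 : R) (glue T f F)
      (p (ctrl_rate psi k B (w' (fine (ctime j))) (yb' (fine (ctime j))))).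
Proof.
move=> cfF df dF j s ls js sj.
have [Hlt Hge] := held ls js sj.
have := @glue_derive f F (fun=> p dw) (fun j _ => p (ctrl_rate psi k B (ws j) (vs j))) cfF df
  (fun s _ _ => dF s) _ j s ls js sj.
have [sT|Ts] := ltP s T.
  have [-> -> _ _ _] := Hlt sT; apply=> nct e e0; exists 1 => // a _ _ _.
  have [wE vE] := held_cst nct.
  by rewrite /glue -wE -vE; case: ifP => _; rewrite subrr normr0.
have [-> -> _] := Hge Ts; apply=> nct e e0; exists 1 => // a _ _ _.
have [wE vE] := held_cst nct.
by rewrite /glue -wE -vE; case: ifP => _; rewrite subrr normr0.
Qed.

Let input'E j s : lifespan tau' s -> (ctime j < s%:E)%E -> (s%:E < ctime j.+1)%E ->
  u' s = control psi k B (w' (fine (ctime j))) (yb' (fine (ctime j))).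
Proof.
move=> ls js sj; have [Hlt Hge] := held ls js sj.
have [sT|Ts] := ltP s T.
  have [-> -> l' a b] := Hlt sT; rewrite /u' glue_lt //.
  by have [-> _] := old_rates l' a b.
by have [-> -> _] := Hge Ts; rewrite /u' glue_ge.
Qed.

Let plant_rate_cont (c : R) i : {within lifespan tau',
  continuous (fun s => plant_rate psi th (st' s) c i 0)}.
Proof.
have cs j : {within lifespan tau', continuous (fun s => crd (st' s) j)}.
  have [[m E]|E] := crdP R n j.
    by under eq_fun do rewrite E; rewrite (glue_comp _ (fun v : 'cV[R]_n => v m 0)); exact: contS.
  by under eq_fun do rewrite E; exact: within_continuous_cst.
under eq_fun do rewrite mxE.
apply: within_continuousD.
  by case: (_ == _); [exact: within_continuous_cst | exact: cs].
apply: within_continuousM; first exact: within_continuous_cst.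
apply: within_continuous_comp => //.
by move=> a; apply: differentiable_continuous; apply/derivable1_diffP; exact: (psi_C1 _).1.
Qed.

Let dynamics' : dynamics psi k B th tau'.
Proof.
split.
  split.
  - by move=> i; rewrite /= (glue_comp _ (fun v : 'cV[R]_n => v i 0)); exact: contS.
  - by move=> i; rewrite /= (glue_comp _ (fun v : ctrl_state R n => xi v i 0)); exact: cont1.
  - by move=> i; rewrite /= (glue_comp _ (fun v : ctrl_state R n => zeta v i 0)); exact: cont2.
  - by rewrite /= (glue_comp _ (fun v : ctrl_state R n => thetahat v)); exact: cont3.
  - by move=> i; rewrite /= (glue_comp _ (fun v : ctrl_state R n => alphaf v i 0)); exact: cont4.
move=> j s ls js sj w v.
have uE := input'E ls js sj.
split.
- move=> i; rewrite /= (glue_comp _ (fun v : 'cV[R]_n => v i 0)).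
  have := @glue_derive (fun s => state tau s i 0) (fun s => X s i 0)
    (fun s => plant_rate psi th (X s) u i 0)
    (fun j s => plant_rate psi th (state tau s) (control psi k B (ws j) (vs j)) i 0) (@contS i).
  move=> /(_ _ _ _ j s ls js sj) H.
  have [Hlt Hge] := held ls js sj.
  have -> : plant_rate psi th (st' s) (u' s) i 0 = if s < T
     then plant_rate psi th (state tau s) (control psi k B (ws j) (vs j)) i 0
     else plant_rate psi th (X s) u i 0.
    rewrite uE; have [sT|Ts] := ltP s T.
      by have [-> -> _ _ _] := Hlt sT; rewrite /st' glue_lt.
    by have [-> -> _] := Hge Ts; rewrite /st' glue_ge.
  apply: H.
  + by move=> j' s' l' a b; have [_ [dx _ _ _ _]] := old_rates l' a b; exact: dx.
  + by move=> s' Ts' sh'; apply: dX; rewrite gtr0_norm ?subr_gt0; lra.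
  + move=> nct e e0; have [wE vE] := held_cst nct.
    have lT : lifespan tau' T by apply/lifeE'; split; [exact: ltW | rewrite ltrDl].
    have [d d0 Hd] := (within_econtinuous _ _).1 (@plant_rate_cont u i) T lT e e0.
    exists d => // a ta ah aT; have [tct0 tcT] := andP tc_bound.
    have la : lifespan tau' a by apply/lifeE'; split=> //; apply: le_trans (ltW ta).
    have := Hd a la aT; rewrite /st' [glue T _ _ T]glue_ge // -wE -vE.
    by rewrite /glue; case: ifP.
- move=> i; rewrite /= uE (glue_comp _ (fun v : ctrl_state R n => xi v i 0)).
  apply: (glue_derive_cst (p := fun v => xi v i 0)) => //.
    by move=> j' s' l' a b; have [_ [_ dx _ _ _]] := old_rates l' a b; exact: dx.
  by move=> s'; exact: affine_coord.
- move=> i; rewrite /= (glue_comp _ (fun v : ctrl_state R n => zeta v i 0)).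
  apply: (glue_derive_cst (p := fun v => zeta v i 0)) => //.
    by move=> j' s' l' a b; have [_ [_ _ dx _ _]] := old_rates l' a b; exact: dx.
  by move=> s'; exact: affine_coord.
- rewrite /= (glue_comp _ (fun v : ctrl_state R n => thetahat v)).
  apply: (glue_derive_cst (p := fun v => thetahat v)) => //; last by move=> s'; exact: affineD.
  by move=> j' s' l' a b; have [_ [_ _ _ dx _]] := old_rates l' a b; exact: dx.
- move=> i; rewrite /= (glue_comp _ (fun v : ctrl_state R n => alphaf v i 0)).
  apply: (glue_derive_cst (p := fun v => alphaf v i 0)) => //.
    by move=> j' s' l' a b; have [_ [_ _ _ _ dx]] := old_rates l' a b; exact: dx.
  by move=> s'; exact: affine_coord.
Qed.

Lemma closed_loop_glued : exists tau'' : trajectory R n,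
  [/\ closed_loop psi k B th tau'' g, t0 tau'' = t0 tau, (tend tau < tend tau'')%E &
      forall s, lifespan tau s -> state tau'' s = state tau s /\ ctrl tau'' s = ctrl tau s].
Proof.
exists tau'; split=> //.
- split; [|exact: plantE'|exact: ctrlE'|exact: transmission'|exact: dynamics'].
  by rewrite /= lte_fin; move: t0T h_gt0; lra.
- by rewrite tendE /= lte_fin ltrDl.
- by move=> s /lifeE[_ sT]; rewrite /= /st' /w' !glue_lt.
Qed.

End Glued.

Lemma closed_loop_extendable (wp wc : R) : 0 < wp -> 0 < wc ->
  (forall i, (plant_time tau i + wp%:E <= plant_time tau i.+1)%E) ->
  (forall j, (ctrl_time tau j + wc%:E <= ctrl_time tau j.+1)%E) ->
  (forall a s, lifespan tau a -> lifespan tau s -> a <= s ->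
    (forall i, `|state tau s i 0 - state tau a i 0| <= C * (s - a)) /\
    [/\ forall i, `|xi (ctrl tau s) i 0 - xi (ctrl tau a) i 0| <= C * (s - a),
        forall i, `|zeta (ctrl tau s) i 0 - zeta (ctrl tau a) i 0| <= C * (s - a),
        `|thetahat (ctrl tau s) - thetahat (ctrl tau a)| <= C * (s - a) &
        forall i, `|alphaf (ctrl tau s) i 0 - alphaf (ctrl tau a) i 0| <= C * (s - a)]) ->
  exists tau' : trajectory R n,
  [/\ closed_loop psi k B th tau' g, t0 tau' = t0 tau, (tend tau < tend tau')%E &
      forall s, lifespan tau s -> state tau' s = state tau s /\ ctrl tau' s = ctrl tau s].
Proof.
move=> wp0 wc0 dwp dwc lip.
have lim_vec m (f : R -> 'cV[R]_m) : (forall a s, lifespan tau a -> lifespan tau s -> a <= s ->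
    forall i, `|f s i 0 - f a i 0| <= C * (s - a)) ->
  exists l : 'cV[R]_m, forall s, t0 tau <= s -> s < T -> forall i, `|f s i 0 - l i 0| <= C * (T - s).
  move=> H; have /choice[l Hl] : forall i, exists l, forall s, t0 tau <= s -> s < T -> `|f s i 0 - l| <= C * (T - s).
    move=> i; apply: lipschitz_left_limit => // a s ta as_ sT.
    by apply: H => //; apply/lifeE; split=> //; [exact: le_lt_trans sT | exact: le_trans as_].
  by exists (\col_i l i) => s ts sT i; rewrite mxE; exact: Hl.
have [xT HxT] := lim_vec _ _ (fun a s la ls as_ => (lip a s la ls as_).1).
have [x1 Hx1] := lim_vec _ (fun s => xi (ctrl tau s)) (fun a s la ls as_ => let: And4 H _ _ _ := (lip a s la ls as_).2 in H).
have [x2 Hx2] := lim_vec _ (fun s => zeta (ctrl tau s)) (fun a s la ls as_ => let: And4 _ H _ _ := (lip a s la ls as_).2 in H).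
have [x4 Hx4] := lim_vec _ (fun s => alphaf (ctrl tau s)) (fun a s la ls as_ => let: And4 _ _ _ H := (lip a s la ls as_).2 in H).
have [x3 Hx3] : exists l, forall s, t0 tau <= s -> s < T -> `|thetahat (ctrl tau s) - l| <= C * (T - s).
  apply: lipschitz_left_limit => // a s ta as_ sT.
  have la : lifespan tau a by apply/lifeE; split=> //; exact: le_lt_trans sT.
  have ls : lifespan tau s by apply/lifeE; split=> //; exact: le_trans as_.
  by have [_ []] := lip a s la ls as_.
pose wT := CtrlState x1 x2 x3 x4.
have state_lim s : t0 tau <= s -> s < T ->
  (forall i, `|state tau s i 0 - xT i 0| <= C * (T - s)) /\
  [/\ forall i, `|xi (ctrl tau s) i 0 - xi wT i 0| <= C * (T - s),
      forall i, `|zeta (ctrl tau s) i 0 - zeta wT i 0| <= C * (T - s),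
      `|thetahat (ctrl tau s) - thetahat wT| <= C * (T - s) &
      forall i, `|alphaf (ctrl tau s) i 0 - alphaf wT i 0| <= C * (T - s)].
  by move=> ts sT; split; [exact: HxT | split; [exact: Hx1 | exact: Hx2 | exact: Hx3 | exact: Hx4]].
have [pI [pIT TpI]] := events_last plantE t0T wp0 dwp.
have [cJ [cJT TcJ]] := events_last ctrlE t0T wc0 dwc.
pose tp := plant_sample tau pI; pose tc := ctrl_sample tau cJ.
pose ptrig : Prop := gamma_y g <= `|crd xT 1 - y tp|.
pose ybT : R := if `[< ptrig >] then crd xT 1 else y tp.
pose ctrig : Prop := sample_trigger ybT (ybar tau tc) wT (ctrl tau tc).
pose wh : ctrl_state R n := if `[< ctrig >] then wT else ctrl tau tc.
pose vh : R := if `[< ctrig >] then ybT else ybar tau tc.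
pose u : R := control psi k B wh vh.
pose dw := ctrl_rate psi k B wh vh.
pose Wn s := CtrlState (xi wT + (s - T) *: xi dw) (zeta wT + (s - T) *: zeta dw)
  (thetahat wT + (s - T) * thetahat dw) (alphaf wT + (s - T) *: alphaf dw).
have [h1 h10 [X [XT cX dX]]] := plant_local_existence th u T xT psi_C1.
(* At [T] every held quantity is either the value at [T] or one whose detector did not fire. All
   triggering inequalities are thus strictly violated at [T], and remain so nearby. *)
have radius (F : R -> R) ga : {within setT, continuous F} -> F T < ga ->
    exists2 d, 0 < d & forall s, `|s - T| < d -> F s < ga.
  move=> /within_econtinuous cF FT.
  have e0 : 0 < ga - F T by rewrite subr_gt0.
  have [d d0 Hd] := cF T Logic.I _ e0; exists d => // s sT.
  by have := Hd s Logic.I sT; have := ler_norm (F s - F T); lra.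
have affine_cont (a d b : R) : {within setT, continuous (fun s => a + (s - T) * d - b)}.
  apply/within_econtinuous/is_derive_econtinuous => s _; exists d.
  apply: is_derive_val_eq (is_derive_subf (is_derive_addf (is_derive_cstf s a) (is_derive_mulf (is_derive_subf (is_derive_id s 1) (is_derive_cstf s T)) (is_derive_cstf s d))) (is_derive_cstf s b)).
  by ring.
have norm2_cont m (a d b : 'cV[R]_m) : {within setT, continuous (fun s => norm2 (a + (s - T) *: d - b))}.
  apply: within_continuous_comp; first exact: sqrt_continuous.
  apply: within_continuous_sum => i; under eq_fun do rewrite !mxE expr2.
  by apply: within_continuousM; exact: affine_cont.
have norm20 m (a : 'cV[R]_m) : norm2 (a - a) = 0.
  apply/eqP; rewrite eq_le sqrtr_ge0 andbT -(mulr0 m%:R).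
  by apply: norm2_le => i; rewrite subrr mxE normr0.
have [gy0 gyb [g1 g2 g3 g4]] := g_adm.
have [d1 d10 H1] : exists2 d, 0 < d & forall s, `|s - T| < d -> `|crd (X s) 1 - ybT| < gamma_y g.
  apply: radius.
    apply: within_continuous_comp; first exact: norm_continuous.
    apply: within_continuousB; last exact: within_continuous_cst.
    apply/within_econtinuous => s _ e e0; have [d d0 H] := cX s e e0.
    exists d => // a _ /H Ha; have [[i E]|E] := crdP R n 1; rewrite !E //.
    by rewrite subrr normr0.
  rewrite XT /ybT; case: asboolP => [_|]; first by rewrite subrr normr0.
  by move=> /negP; rewrite -ltNge.
have [d2 d20 H2] : exists2 d, 0 < d & forall s, `|s - T| < d -> norm2 (xi (Wn s) - xi wh) < gamma_xi g.
  apply: radius; first exact: norm2_cont.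
  rewrite /= subrr scale0r addr0 /wh; case: asboolP => [_|nt]; first by rewrite norm20.
  by rewrite ltNge; apply/negP => H; apply: nt; right; left.
have [d3 d30 H3] : exists2 d, 0 < d & forall s, `|s - T| < d -> norm2 (zeta (Wn s) - zeta wh) < gamma_zeta g.
  apply: radius; first exact: norm2_cont.
  rewrite /= subrr scale0r addr0 /wh; case: asboolP => [_|nt]; first by rewrite norm20.
  by rewrite ltNge; apply/negP => H; apply: nt; right; right; left.
have [d4 d40 H4] : exists2 d, 0 < d & forall s, `|s - T| < d -> `|thetahat (Wn s) - thetahat wh| < gamma_h g.
  apply: radius.
    by apply: within_continuous_comp; [exact: norm_continuous | exact: affine_cont].
  rewrite /= subrr mul0r addr0 /wh; case: asboolP => [_|nt]; first by rewrite subrr normr0.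
  by rewrite ltNge; apply/negP => H; apply: nt; right; right; right; left.
have [d5 d50 H5] : exists2 d, 0 < d & forall s, `|s - T| < d -> norm2 (alphaf (Wn s) - alphaf wh) < gamma_f g.
  apply: radius; first exact: norm2_cont.
  rewrite /= subrr scale0r addr0 /wh; case: asboolP => [_|nt]; first by rewrite norm20.
  by rewrite ltNge; apply/negP => H; apply: nt; right; right; right; right.
pose h := Num.min (Num.min h1 d1) (Num.min (Num.min d2 d3) (Num.min d4 d5)).
have h0 : 0 < h by rewrite !lt_min h10 d10 d20 d30 d40 d50.
have hle s : `|s - T| < h -> [/\ `|s - T| < h1, `|s - T| < d1 &
    [/\ `|s - T| < d2, `|s - T| < d3, `|s - T| < d4 & `|s - T| < d5]].
  by rewrite !lt_min => /andP[/andP[? ?] /andP[/andP[? ?] /andP[? ?]]].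
apply: (@closed_loop_glued xT wT pI cJ state_lim pIT TpI cJT TcJ X h h0 XT cX).
- by move=> s /hle[sh _ _]; exact: dX.
- by move=> s /hle[_ sh _]; exact: H1.
- by move=> s /hle[_ _ [? ? ? ?]]; split; [exact: H2 | exact: H3 | exact: H4 | exact: H5].
Qed.

End Extension.

(** * Practical stability and choice of the final constants *)

Lemma limf_esup_pinfty_le (R : realType) (f : R -> R) (t0 M : R) :
  (forall s, t0 <= s -> f s <= M) ->
  (limf_esup (fun s : R => (f s)%:E) (pinfty_nbhs R) <= M%:E)%E.
Proof.
move=> H; apply: (@le_trans _ _ (ereal_sup ((fun s => (f s)%:E) @` [set s | t0 < s]))).
  apply: ereal_inf_lbound; exists [set s | t0 < s] => //.
  by exists t0; split=> //; exact: num_real.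
by apply: ge_ereal_sup => _ [s /ltW ts <-]; rewrite lee_fin H.
Qed.

Theorem mainTheorem1 (R : realType) (n : nat) (n_ge2 : (2 <= n)%N)
  (psi : 'I_n -> R -> R) (thetabar : R)
  (D : set R) (L Psi : 'I_n -> R)
  (psi_C1 : forall i, C1 (psi i))
  (D_closed : closed D)
  (psi_lip : forall i y y', D y -> D y' ->
    `|psi i y - psi i y'| <= L i * `|y - y'|)
  (Psi_gt0 : forall i, 0 < Psi i)
  (dpsi_le : forall i y, D y -> `|derive1 (psi i) y| <= Psi i)
  (k : 'cV[R]_n) (k_hurwitz : hurwitz (Ac k))
  (P : 'M[R]_n) (P_posdef : posdef P)
  (P_lyapunov : P *m Ac k + (Ac k)^T *m P = - 1%:M) :
  exists q0 : R, forall q : R, 0 < q -> q0 < q ->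
  exists B : parameters R n, admissible_parameters B /\
  exists gammamax : R, 0 < gammamax /\
  forall g : thresholds R, admissible_thresholds g ->
    thresholds_le g gammamax ->
  exists M eps wbar w : R, [/\ 0 < eps, 0 < wbar & 0 < w] /\
  forall (theta : R) (tau : trajectory R n),
    `|theta| <= thetabar ->
    solution psi k B theta g tau ->
    Omega P q (eta_at psi k B theta tau (t0 tau)) ->
  [/\ tend tau = +oo%E,
      forall s, t0 tau <= s -> Omega P q (eta_at psi k B theta tau s),
      signals_bounded psi k B tau M,
      practically_stable tau eps &
      dwell_time tau wbar w].
Proof.
(* The design asks for a nonnegative bound on [theta], and the sign of [thetabar] is not
   prescribed. *)
have thb0 : 0 <= `|thetabar| by [].
have [al [C0 [al0 design]]] := lyapunov_design n_ge2 psi_C1 P_posdef P_lyapunov thb0.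
exists ((C0 + 1) / al) => q q0 qlarge.
have [c [r [Q [r0 Q0 HQ [K K0 HK]]]]] := design q.
have [Cb Cb0 Hb] := bounded_signals k n_ge2 psi_C1 c thb0 Q0 (fun i => crd r i.-1) (leqnn n).
exists (gains c r); split.
  by split=> //= i; rewrite mxE.
have alq : C0 + 1 < al * q by move: qlarge; rewrite ltr_pdivrMr // mulrC.
(* The first entry keeps the sampling radius [2 * gm] in [[0, 1]], where [agree] applies; the second
   keeps the error [K * (2 * gm)] below [1/2]. *)
pose gm := Num.min 2^-1 (4 * K)^-1.
have gm0 : 0 < gm by rewrite lt_min !invr_gt0 mulr_gt0 // ltr0n.
have gm1 : 2 * gm <= 1.
  have : gm <= 2^-1 by rewrite ge_min lexx.
  by lra.
have gmK : K * (2 * gm) <= 2^-1.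
  have h : gm <= (4 * K)^-1 by rewrite ge_min lexx orbT.
  have : gm * (4 * K) <= 1 by rewrite -ler_pdivlMr ?mulr_gt0 // div1r.
  by lra.
exists gm; split=> // g g_adm g_le.
have n0 : 0 < n%:R :> R by rewrite ltr0n ltnW.
have nC : 0 < n%:R * Cb by rewrite mulr_gt0.
have gap0 := ctrl_gap_gt0 g_adm.
have [gy0 _ _] := g_adm.
have wp0 : 0 < gamma_y g / Cb by rewrite divr_gt0.
have wc0 : 0 < ctrl_gap g / (n%:R * Cb) by rewrite divr_gt0.
exists (n%:R * Cb), (n%:R * Cb), (gamma_y g / Cb), (ctrl_gap g / (n%:R * Cb)).
split=> // th tau thle [cl noext] init.
have thle' : `|th| <= `|thetabar| by apply: le_trans thle (ler_norm _).
have inv s := run_invariant psi_C1 HQ HK al0 gm0 gm1 gmK alq g_adm g_le thle' cl init (s := s).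
have lip a s := run_lipschitz psi_C1 HQ HK Hb al0 Cb0 gm0 gm1 gmK alq g_adm g_le thle' cl init (a := a) (s := s).
have sig s := run_signals psi_C1 HQ HK Hb al0 Cb0 gm0 gm1 gmK alq g_adm g_le thle' cl init (s := s).
have dwp := run_plant_dwell psi_C1 HQ HK Hb al0 Cb0 gm0 gm1 gmK alq g_adm g_le thle' cl init.
have dwc := run_ctrl_dwell psi_C1 HQ HK Hb al0 Cb0 gm0 gm1 gmK alq g_adm g_le thle' cl init.
have tend_oo : tend tau = +oo%E.
  (* A finite end time would make the trajectory continuable, against the definition of
     [solution]. *)
  case E : (tend tau) => [T|//|]; last by case: cl; rewrite E.
  exfalso; apply: noext.
  exact: (closed_loop_extendable psi_C1 g_adm cl E (ltW Cb0) wp0 wc0 dwp dwc lip).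
have life s : t0 tau <= s -> lifespan tau s by move=> ts; split=> //; rewrite tend_oo ltry.
split=> //.
- by move=> s /life; exact: inv.
- by move=> s /life; exact: sig.
- by apply: limf_esup_pinfty_le => s /life/sig[[]].
Qed.
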